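(* Let $\alpha\in(1,2)$, $\alpha^*=\alpha/(\alpha-1)$, $\beta\ge0$, $\gamma>0$. Let $\xi,\xi'$ be two terminal conditions, $g,g'$ two generators (continuous in $(y,z)$), and let $(Y_t,Z_t)_{t\in[0,T]}$ and $(Y'_t,Z'_t)_{t\in[0,T]}$ be solutions of BSDE$(\xi,g)$ and BSDE$(\xi',g')$ respectively such that for every $p>0$, $$\mathbb{E}\Big[\exp\Big\{p\Big(\sup_{t\in[0,T]}(|Y_t|+|Y'_t|)+\int_0^T\big(|g(t,0,0)|+|g'(t,0,0)|\big){\rm d}t\Big)^{2/\alpha^*}\Big\}\Big]<+\infty .$$ Assume that $\mathbb{P}$-a.s. $\xi\le\xi'$. Assume further that one of the following holds: (1) ${\rm d}\mathbb{P}\times{\rm d}t$-a.e., $|g(\omega,t,y,z)|\le|g(\omega,t,0,0)|+\beta|y|+\gamma|z|^\alpha$ for all $(y,z)\in\mathbb{R}\times\mathbb{R}^d$; ${\rm d}\mathbb{P}\times{\rm d}t$-a.e., $g$ is convex or concave in $(y,z)$; and ${\rm d}\mathbb{P}\times{\rm d}t$-a.e., $g(t,Y'_t,Z'_t)\le g'(t,Y'_t,Z'_t)$; (2) ${\rm d}\mathbb{P}\times{\rm d}t$-a.e., $|g'(\omega,t,y,z)|\le|g'(\omega,t,0,0)|+\beta|y|+\gamma|z|^\alpha$ for all $(y,z)\in\mathbb{R}\times\mathbb{R}^d$; ${\rm d}\mathbb{P}\times{\rm d}t$-a.e., $g'$ is convex or concave in $(y,z)$; and ${\rm d}\mathbb{P}\times{\rm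 d}t$-a.e., $g(t,Y_t,Z_t)\le g'(t,Y_t,Z_t)$. Then $\mathbb{P}$-a.s., for each $t\in[0,T]$, $Y_t\le Y'_t$.
   Context: Fix $T>0$ and an integer $d\ge1$. $(B_t)_{t\in[0,T]}$ is a standard $\mathbb{R}^d$-valued Brownian motion on a complete probability space $(\Omega,\mathcal{F},\mathbb{P})$, with natural filtration $(\mathcal{F}_t)_{t\in[0,T]}$ augmented by all $\mathbb{P}$-null sets; all measurability of processes refers to this filtration. A terminal condition is an $\mathcal{F}_T$-measurable scalar random variable $\xi$. A generator is a function $g:\Omega\times[0,T]\times\mathbb{R}\times\mathbb{R}^d\to\mathbb{R}$, progressively measurable for each $(y,z)$ and continuous in $(y,z)$. BSDE$(\xi,g)$ is the equation $$Y_t=\xi+\int_t^Tg(s,Y_s,Z_s)\,{\rm d}s-\int_t^TZ_s\cdot{\rm d}B_s,\quad t\in[0,T].$$ A solution is a pair of progressively measurable processes $(Y_t,Z_t)_{t\in[0,T]}$ with values in $\mathbb{R}\times\mathbb{R}^d$ such that $\mathbb{P}$-a.s. $t\mapsto Y_t$ is continuous, $t\mapsto Z_t$ is square-integrable, $t\mapsto g(t,Y_t,Z_t)$ is integrable, and the equation holds. ''A.e. convex or concave'' means: either convex for a.e. $(\omega,t)$, or concave for a.e. $(\omega,t)$. *)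

(* Defs.v *)
From HB Require Import structures.
From mathcomp Require Import all_boot all_order all_algebra.
From mathcomp Require Import all_classical all_reals all_analysis.

Set Implicit Arguments.
Unset Strict Implicit.
Unset Printing Implicit Defensive.

Import Order.TTheory GRing.Theory Num.Theory.
Import numFieldNormedType.Exports.

Local Open Scope classical_set_scope.
Local Open Scope ring_scope.

(* The norm that the library puts on 'rV[R]_d is the sup norm; |z| and z . z'
   in R^d are the Euclidean ones. *)
Definition dotrv (R : realType) (d : nat) (u v : 'rV[R]_d) : R :=
  \sum_(i < d) u 0 i * v 0 i.

Definition enorm (R : realType) (d : nat) (z : 'rV[R]_d) : R :=
  Num.sqrt (dotrv z z).

Section Brownian.
Context {R : realType} {dO : measure_display} {Omega : measurableType dO}.
Context {d : nat}.
Variables (P : probability Omega R) (T : R).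

(* Processes are functions of (w, t), defined for all real t; only their values
   for t in [0, T] are ever used. *)
Implicit Types (B : Omega -> R -> 'rV[R]_d).

Definition past_gen B (t : R) : set (set Omega) :=
  \bigcup_(s in `[0, t]%classic) \bigcup_(i in [set: 'I_d])
    preimage_set_system setT (fun w => B w s 0 i) measurable.

Definition increment_gen B (s t : R) : set (set Omega) :=
  \bigcup_(i in [set: 'I_d])
    preimage_set_system setT (fun w => (B w t - B w s) 0 i) measurable.

(* The second parameter of normal_prob is the standard deviation. *)
Record is_brownian_motion B : Prop := {
  bm_measurable : forall (t : R) (i : 'I_d), 0 <= t <= T ->
    measurable_fun setT (fun w => B w t 0 i);
  bm_start : {ae P, forall w, B w 0 = 0};
  bm_continuous : {ae P, forall w, {within `[0, T], continuous (B w)}};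
  bm_gaussian : forall s t (U : 'I_d -> set R), 0 <= s -> s < t -> t <= T ->
    (forall i, measurable (U i)) ->
    P [set w | forall i, U i ((B w t - B w s) 0 i)] =
    (\prod_(i < d) fine (normal_prob 0 (Num.sqrt (t - s)) (U i)))%:E;
  bm_independent : forall s t (A C : set Omega), 0 <= s -> s < t -> t <= T ->
    <<s past_gen B s >> A -> <<s increment_gen B s t >> C ->
    P (A `&` C) = (P A * P C)%E }.

(* F_t is the sigma-algebra generated by filtration_gen B t; a function is
   F_t-measurable when it is measurable on g_sigma_algebraType of it. *)
Definition filtration_gen B (t : R) : set (set Omega) :=
  past_gen B t `|` [set A | P.-negligible A].

Definition adapted_at B (t : R) (f : Omega -> R) : Prop :=
  measurable_fun setT (f : g_sigma_algebraType (filtration_gen B t) -> R).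

Definition progressive B (X : Omega -> R -> R) : Prop :=
  forall t, 0 <= t <= T ->
    measurable_fun (setT `*` `[0, t])
      ((fun x => X x.1 x.2) :
         (g_sigma_algebraType (filtration_gen B t) * R)%type -> R).

Definition progressive_rv B (Z : Omega -> R -> 'rV[R]_d) : Prop :=
  forall i, progressive B (fun w t => Z w t 0 i).

Definition ae_dPdt (Q : Omega -> R -> Prop) : Prop :=
  {ae (P \x lebesgue_measure)%E, forall x : Omega * R,
    0 <= x.2 <= T -> Q x.1 x.2}.

(* The process sum_(k < n) h_k 1_(t_k, t_(k+1)]. *)
Record step_process : Type := StepProcess {
  sp_size : nat;
  sp_time : nat -> R;
  sp_coef : nat -> Omega -> 'rV[R]_d }.

Record is_simple_process B (H : step_process) : Prop := {
  sp_time_ge0 : 0 <= sp_time H 0;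
  sp_time_le : forall k, (k < sp_size H)%N -> sp_time H k <= sp_time H k.+1;
  sp_time_leT : sp_time H (sp_size H) <= T;
  sp_adapted : forall k (i : 'I_d), (k < sp_size H)%N ->
    adapted_at B (sp_time H k) (fun w => sp_coef H k w 0 i);
  sp_bounded : forall k, (k < sp_size H)%N ->
    exists C : R, forall w, enorm (sp_coef H k w) <= C }.

Definition sp_value (H : step_process) (w : Omega) (t : R) : 'rV[R]_d :=
  \sum_(k < sp_size H)
    if sp_time H k < t <= sp_time H k.+1 then sp_coef H k w else 0.

Definition sp_integral B (H : step_process) (w : Omega) (t : R) : R :=
  \sum_(k < sp_size H)
    dotrv (sp_coef H k w)
      (B w (Num.min (sp_time H k.+1) t) - B w (Num.min (sp_time H k) t)).

Definition cvg0_in_probability (X : nat -> Omega -> \bar R) : Prop :=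
  forall eps : R, 0 < eps ->
    P [set w | (eps%:E <= X n w)%E] @[n --> \oo] --> 0%E.

(* M is (a version of) the process t |-> int_0^t Z_s . dB_s on [0, T], for
   Z progressive with int_0^T |Z_s|^2 ds < +oo almost surely: the limit,
   uniformly on [0, T] in probability, of the integrals of simple processes
   H n such that int_0^T |H n - Z|^2 ds --> 0 in probability. *)
Record is_ito_integral B (Z : Omega -> R -> 'rV[R]_d) (M : Omega -> R -> R)
    : Prop := {
  ito_adapted : forall t, 0 <= t <= T -> adapted_at B t (M^~ t);
  ito_continuous : {ae P, forall w, {within `[0, T], continuous (M w)}};
  ito_approx : exists H : nat -> step_process,
    [/\ forall n, is_simple_process B (H n),
        cvg0_in_probability (fun n w =>
          \int[lebesgue_measure]_(t in `[0%R, T])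
             (enorm (sp_value (H n) w t - Z w t) ^+ 2)%:E)%E
      & cvg0_in_probability (fun n w =>
          ereal_sup [set `|sp_integral B (H n) w t - M w t|%:E
                    | t in `[0%R, T]%classic])] }.

Definition is_terminal_condition B (xi : Omega -> R) : Prop :=
  adapted_at B T xi.

Record is_generator B (g : Omega -> R -> R -> 'rV[R]_d -> R) : Prop := {
  gen_progressive : forall y z, progressive B (fun w t => g w t y z);
  gen_continuous : forall w t, 0 <= t <= T ->
    continuous (fun yz : R * 'rV[R]_d => g w t yz.1 yz.2) }.

(* int_t^T Z . dB is M_T - M_t, for M the integral process of Z. *)
Record bsde_solution B (xi : Omega -> R) (g : Omega -> R -> R -> 'rV[R]_d -> R)
    (Y : Omega -> R -> R) (Z : Omega -> R -> 'rV[R]_d) : Prop := {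
  sol_Y_progressive : progressive B Y;
  sol_Z_progressive : progressive_rv B Z;
  sol_Y_continuous : {ae P, forall w, {within `[0, T], continuous (Y w)}};
  sol_Z_square_integrable : {ae P, forall w,
    lebesgue_measure.-integrable `[0, T] (fun t => (enorm (Z w t) ^+ 2)%:E)};
  sol_g_integrable : {ae P, forall w,
    lebesgue_measure.-integrable `[0, T] (fun t => (g w t (Y w t) (Z w t))%:E)};
  sol_equation : exists2 M : Omega -> R -> R, is_ito_integral B Z M &
    {ae P, forall w, forall t, 0 <= t <= T ->
      Y w t = xi w
              + \int[lebesgue_measure]_(s in `[t, T]) g w s (Y w s) (Z w s)
              - (M w T - M w t)} }.

Definition convex_yz (f : R -> 'rV[R]_d -> R) : Prop :=
  convex_function [set: R * 'rV[R]_d] (fun yz => f yz.1 yz.2).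

Definition concave_yz (f : R -> 'rV[R]_d -> R) : Prop :=
  convex_yz (fun y z => - f y z).

Definition ae_convex_or_concave (g : Omega -> R -> R -> 'rV[R]_d -> R) : Prop :=
  ae_dPdt (fun w t => convex_yz (g w t)) \/
  ae_dPdt (fun w t => concave_yz (g w t)).

Definition growth_bound (alpha beta gamma : R)
    (g : Omega -> R -> R -> 'rV[R]_d -> R) : Prop :=
  ae_dPdt (fun w t => forall y z,
    `|g w t y z| <= `|g w t 0 0| + beta * `|y| + gamma * enorm z `^ alpha).

End Brownian.

(* Main.v *)
(* For r >= 1 put U = r Y - (r-1) Y' if the controlled generator is convex and
   U = (r-1) Y - r Y' if it is concave, and let V be
   the same combination of Z and Z'. Convexity (concavity) bounds the drift of U
   by f + beta |U| + gamma |V|^alpha with f = |g(.,0,0)| + |g'(.,0,0)|, a bound that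
   does not depend on r, and U_T <= |Y_T| + |Y'_T| because xi <= xi'.
   With q = 2 / alpha^* in (0, 1), the test function
     G(s, F, x) = exp(mu_s (1 + |F| + ln(1 + e^x))^q),  mu_s = (2/q) e^(b s),
   satisfies Gx (c0 (1 + |x|) + gam v^alpha) <= Gs + Gxx v^2 / 2, so that
   G(t, int_0^t f, U_t) is a submartingale up to localisation. Hence
   G(0, 0, y - 1) P(U_t >= y) <= C with C independent of r and y. Where
   Y_t - Y'_t >= eps one has U_t >= r eps - |Y_t| - |Y'_t|, and r -> oo gives
   P(Y_t - Y'_t >= eps) = 0.
   The submartingale inequality is obtained without Ito's formula: the stochastic
   integrals are replaced by integrals of simple processes, and on a fine grid that
   contains their jump times the second order Taylor expansion of G is summed over
   the steps taken before the first bad event. The increments of the simple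
   integrals have conditionally Gaussian second and fourth moments, and the error
   terms sum up to a constant. *)

Require Import Defs.
From HB Require Import structures.
From mathcomp Require Import all_boot all_order all_algebra.
From mathcomp Require Import all_classical all_reals all_analysis.
From mathcomp Require Import measurable_realfun ring lra.
Set Implicit Arguments.
Unset Strict Implicit.
Unset Printing Implicit Defensive.
Import Order.TTheory GRing.Theory Num.Theory.
Import numFieldNormedType.Exports.
Local Open Scope classical_set_scope.
Local Open Scope ring_scope.

(** * Test function *)

Section Calculus.
Context {R : realType}.
Implicit Types (f : R -> R) (x a : R).

(** The growth of order alpha in z gives no Lipschitz bound for the difference of the generators. In
    the convex case the identity Y = U / r + (1 - 1/r) Y' lets convexity compare values of a single
    generator; after multiplication by r there remains that generator at (U, V), with the same beta
    and gamma for every r. Three balances fix the test function. Softplus makes it increasing in x,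
    so one-sided bounds on the drift suffice. The exponent q is the one for which Young's
    inequality, setting gamma v^alpha against y^(q-1) v^2, leaves a remainder linear in y, and the
    growth exp(mu y^q) is what the assumed moments can integrate. The summand |F| pays for the drift
    f in full. Along the whole path U is of size r, so the dominating variable there needs a moment
    whose order depends on r; it is integrated only over an event chosen after r, where it
    contributes at most 1. No stopping times occur in the discrete scheme: each step is gated by an
    event known at its left endpoint, and the sum freezes once the gate closes. *)

Lemma mean_value (f f1 : R -> R) a x :
  (forall t, (a <= t <= x) || (x <= t <= a) -> is_derive t 1 f (f1 t)) ->
  exists2 c, (a <= c <= x) || (x <= c <= a) & f x - f a = f1 c * (x - a).
Proof.
move=> df.
have key (u v : R) : u <= v -> (forall t : R, u <= t <= v -> is_derive t 1 f (f1 t)) ->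
    exists2 c, u <= c <= v & f v - f u = f1 c * (v - u).
  move=> uv dfuv.
  have [c cuv E] := @MVT_segment R f f1 u v uv
    (fun t (h : t \in `]u, v[) => dfuv t (subset_itv_oo_cc h))
    (derivable_within_continuous (fun t (h : t \in `[u, v]) =>
       @ex_derive _ _ _ _ _ _ _ (dfuv t h))).
  by exists c.
have [ax|/ltW xa] := leP a x.
  have [|c cax E] := key a x ax; first by move=> t h; apply: df; rewrite h.
  by exists c => //; rewrite cax.
have [|c cax E] := key x a xa.
  by move=> t h; apply: df; rewrite h orbT.
exists c; first by rewrite cax orbT.
by rewrite -(opprB a) mulrN -E opprB.
Qed.

(** After the quadratic is subtracted, the derivative is [f1 t - f1 a - lam * (t - a)], which has
    the sign of [t - a] by the mean value theorem for [f1]; a second use of that theorem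
    concludes. *)
Lemma taylor2_lower (f f1 f2 : R -> R) a x lam :
  (forall t, (a <= t <= x) || (x <= t <= a) -> is_derive t 1 f (f1 t)) ->
  (forall t, (a <= t <= x) || (x <= t <= a) -> is_derive t 1 f1 (f2 t)) ->
  (forall t, (a <= t <= x) || (x <= t <= a) -> lam <= f2 t) ->
  f a + f1 a * (x - a) + lam / 2 * (x - a) ^+ 2 <= f x.
Proof.
move=> df df1 lamf2.
pose g := (f : R -> R^o) - (f1 a) \*: (id : R -> R^o)
  - (lam / 2) \*: ((id - cst a : R -> R^o) ^+ 2).
have [|c cI E] := @mean_value g (fun t => f1 t - f1 a - lam * (t - a)) a x.
  move=> t tI; have := df _ tI => dft.
  apply: is_derive_eq; rewrite /= /GRing.scale/= /cst/=.
  rewrite !fctE/=; lra.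
have [|c' c'I E'] := @mean_value f1 f2 a c.
  by move=> t tI; apply: df1; lra.
have : 0 <= (f1 c - f1 a - lam * (c - a)) * (x - a).
  rewrite E' -mulrBl -mulrA mulr_ge0//.
    by rewrite subr_ge0 lamf2//; lra.
  by have /orP[/andP[? ?]|/andP[? ?]] := cI; nra.
rewrite -E /g !fctE/= /GRing.scale/= subrr expr0n/= mulr0 subr0; lra.
Qed.

End Calculus.

(** * Softplus, a smooth convex substitute for the positive part *)

Section Softplus.
Context {R : realType}.
Implicit Types x : R.

Definition softplus x : R := ln (1 + expR x).
Definition sigmoid x : R := expR x / (1 + expR x).

Lemma onepexp_gt0 x : 0 < 1 + expR x. Proof. by rewrite addr_gt0 ?expR_gt0. Qed.

Lemma softplus_ge0 x : 0 <= softplus x.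
Proof. by rewrite ln_ge0// lerDl expR_ge0. Qed.

Lemma softplus_ge_id x : x <= softplus x.
Proof.
rewrite -[leLHS](@expRK R) /softplus ler_ln ?posrE ?expR_gt0 ?onepexp_gt0//.
by rewrite lerDr.
Qed.

Lemma softplus_le x x' : x <= x' -> softplus x <= softplus x'.
Proof.
by move=> xx'; rewrite /softplus ler_ln ?posrE ?onepexp_gt0// lerD2l ler_expR.
Qed.

Lemma softplus_le_norm x : softplus x <= `|x| + 1.
Proof.
rewrite -[leRHS](@expRK R) /softplus ler_ln ?posrE ?expR_gt0 ?onepexp_gt0//.
rewrite expRD; have e2 : 2 <= expR 1 :> R by have := @expR_ge1Dx R 1; lra.
have := @expR_ge1Dx R `|x|; have : expR x <= expR `|x| by rewrite ler_expR ler_norm.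
have : 0 <= `|x| by []. nra.
Qed.

Lemma sigmoid_gt0 x : 0 < sigmoid x.
Proof. by rewrite divr_gt0 ?expR_gt0 ?onepexp_gt0. Qed.

Lemma sigmoid_lt1 x : sigmoid x < 1.
Proof. by rewrite ltr_pdivrMr ?onepexp_gt0// mul1r ltrDr. Qed.

(** For positive x the slope is below 1 and x is below its softplus; for negative x the slope is at
    most [expR x], and [expR x * - x] is at most 1. This lets the drift term linear in |U| be
    absorbed by [tf_y]. *)
Lemma sigmoid_norm_le x : sigmoid x * `|x| <= 1 + softplus x.
Proof.
have p0 := sigmoid_gt0 x; have p1 := sigmoid_lt1 x; have k0 := softplus_ge0 x.
have [x0|x0] := leP 0 x.
  by rewrite ger0_norm//; have := softplus_ge_id x; nra.
rewrite ltr0_norm//; suff : sigmoid x * - x <= 1 by lra.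
apply: (@le_trans _ _ (expR x * - x)).
  rewrite ler_wpM2r//; first by lra.
  by rewrite ler_pdivrMr ?onepexp_gt0//; have := expR_gt0 x; nra.
have := @expR_ge1Dx R (- x); rewrite expRN => h.
have e0 := expR_gt0 x.
have -> : 1 = expR x * (expR x)^-1 by rewrite divff ?gt_eqF.
by rewrite ler_pM2l//; lra.
Qed.

Lemma is_derive_softplus x : is_derive x 1 softplus (sigmoid x).
Proof.
have h := onepexp_gt0 x.
have dln : is_derive ((cst 1 + expR) x) 1 (@ln R) (1 + expR x)^-1.
  by apply: is_derive1_ln.
have d1 : is_derive x 1 (cst 1 + expR : R -> R^o) (0 + expR x).
  exact: is_deriveD.
have := @is_derive1_comp _ _ _ _ _ _ dln d1.
by rewrite add0r mulrC.
Qed.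

Lemma is_derive_sigmoid x :
  is_derive x 1 sigmoid (sigmoid x * (1 - sigmoid x)).
Proof.
have h := onepexp_gt0 x.
have -> : sigmoid = cst 1 - (fun y => (1 + expR y)^-1).
  apply/funext => y; rewrite ?fctE /sigmoid.
  by have := onepexp_gt0 y; move=> ?; field; rewrite gt_eqF.
have dV : is_derive x 1 ((fun y => (1 + expR y)^-1) : R -> R^o)
    (- (1 + expR x) ^- 2 *: (0 + expR x)).
  by apply: (@is_deriveV _ (cst 1 + expR)); rewrite fctE gt_eqF.
apply: is_derive_eq.
by rewrite /GRing.scale/=?fctE; field; rewrite gt_eqF.
Qed.

Lemma softplus_tangent x x' :
  softplus x + sigmoid x * (x' - x) <= softplus x'.
Proof.
have := @taylor2_lower R softplus sigmoid (fun x => sigmoid x * (1 - sigmoid x))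
  x x' 0 (fun t _ => is_derive_softplus t) (fun t _ => is_derive_sigmoid t).
rewrite mul0r mul0r addr0; apply => t _.
by have := sigmoid_gt0 t; have := sigmoid_lt1 t; nra.
Qed.

End Softplus.

(** * The test function and its differential inequality *)

Section TestFunction.
Context {R : realType}.
Variables (q b : R).
Hypotheses (q0 : 0 < q) (q1 : q < 1) (b0 : 0 <= b).
Implicit Types s y F x : R.

(** The factor [2 / q] gives [2 <= tf_mu s * q], which makes the exponential outweigh the concavity
    of the power q in [tf_phi2_ge]. The growth in s produces the time derivative that pays for the
    drift. *)
Definition tf_mu s : R := 2 / q * expR (b * s).
Definition tf_phi s y := expR (tf_mu s * y `^ q).
Definition tf_phi1 s y := tf_mu s * q * y `^ (q - 1) * tf_phi s y.
Definition tf_phi2 s y :=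
  ((tf_mu s * q * y `^ (q - 1)) ^+ 2
   + tf_mu s * q * ((q - 1) * y `^ (q - 1 - 1))) * tf_phi s y.

Lemma tf_mu_gt0 s : 0 < tf_mu s.
Proof. by rewrite mulr_gt0 ?expR_gt0// divr_gt0. Qed.

Lemma tf_mu_ge s : 0 <= s -> 2 / q <= tf_mu s.
Proof.
move=> s0; rewrite /tf_mu -[leLHS]mulr1 ler_pM2l ?divr_gt0//.
by rewrite -[leLHS](@expR0 R) ler_expR mulr_ge0.
Qed.

Lemma tf_mu_le s s' : s <= s' -> tf_mu s <= tf_mu s'.
Proof. by move=> ss'; rewrite ler_pM2l ?divr_gt0// ler_expR ler_wpM2l. Qed.

Lemma tf_phi_gt0 s y : 0 < tf_phi s y. Proof. exact: expR_gt0. Qed.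

Lemma tf_phi1_ge0 s y : 0 <= tf_phi1 s y.
Proof.
apply: mulr_ge0; last exact: expR_ge0.
apply: mulr_ge0; last exact: powR_ge0.
by apply: mulr_ge0; apply/ltW => //; exact: tf_mu_gt0.
Qed.

Lemma is_derive_tf_phi s y : 0 < y -> is_derive y 1 (tf_phi s) (tf_phi1 s y).
Proof.
move=> y0.
have dpow : is_derive y 1 ((tf_mu s) \*: ((fun z : R => z `^ q) : R -> R^o))
   (tf_mu s *: (q * y `^ (q - 1))).
  by apply: is_deriveZ; exact: is_derive1_powR.
have := @is_derive1_comp _ expR _ y _ _ (is_derive_expR _) dpow.
move=> /is_derive_eq; apply.
by rewrite /GRing.scale/= /tf_phi1 /tf_phi mulrC mulrA.
Qed.

Lemma is_derive_tf_phi1 s y : 0 < y -> is_derive y 1 (tf_phi1 s) (tf_phi2 s y).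
Proof.
move=> y0.
have dpow : is_derive y 1 ((tf_mu s * q) \*: ((fun z : R => z `^ (q - 1)) : R -> R^o))
   ((tf_mu s * q) *: ((q - 1) * y `^ (q - 1 - 1))).
  by apply: is_deriveZ; exact: is_derive1_powR.
have := @is_deriveM _ _ _ _ _ _ _ _ dpow (is_derive_tf_phi s y0).
move=> /is_derive_eq; apply.
rewrite /GRing.scale/= /tf_phi2 /tf_phi1.
change (((tf_mu s * q) * y `^ (q - 1)) * (tf_mu s * q * y `^ (q - 1) * tf_phi s y) +
  tf_phi s y * (tf_mu s * q * ((q - 1) * y `^ (q - 1 - 1))) =
  ((tf_mu s * q * y `^ (q - 1)) ^+ 2 +
   tf_mu s * q * ((q - 1) * y `^ (q - 1 - 1))) * tf_phi s y).
by ring.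
Qed.

(** With m = [tf_mu s * q] and z = y^(q-1), the second derivative divided by [tf_phi s y] is m z (m
    z + (q-1)/y). Since m is at least 2 and z is at least 1/y, the bracket is at least z. *)
Lemma tf_phi2_ge s y : 0 <= s -> 1 <= y ->
  y `^ (q - 1) * tf_phi1 s y <= tf_phi2 s y.
Proof.
move=> s0 y1.
have y0 : 0 < y by lra.
have m2 := tf_mu_ge s0.
have mq : 2 <= tf_mu s * q by rewrite -ler_pdivrMr.
rewrite /tf_phi2 /tf_phi1 mulrA ler_pM2r ?tf_phi_gt0//.
have zE : y `^ (q - 1 - 1) = y `^ (q - 1) / y.
  by rewrite powRB ?powRr1 ?ltW// (gt_eqF y0) implybT.
set z := y `^ (q - 1) in zE *.
have z0 : 0 < z by rewrite powR_gt0.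
have yz : y^-1 <= z.
  by rewrite -(powR_inv1 (ltW y0)); apply: ler_powR => //; rewrite lerBrDr addNr ltW.
rewrite zE; set w := y^-1 in yz *; have w0 : 0 < w by rewrite invr_gt0.
set m := tf_mu s * q in mq *.
have h : z <= m * z + (q - 1) * w.
  have : 0 <= (m - 2) * z by rewrite mulr_ge0//; lra.
  have : 0 <= q * w by rewrite mulr_ge0// ltW.
  by clear -yz; lra.
have -> : (m * z) ^+ 2 + m * ((q - 1) * (z * w)) =
  (z * m) * (m * z + (q - 1) * w) by ring.
rewrite (_ : z * (m * z) = (z * m) * z); last by ring.
by apply: ler_wpM2l => //; nra.
Qed.

Lemma tf_phi2_ge0 s y : 0 <= s -> 1 <= y -> 0 <= tf_phi2 s y.
Proof.
move=> s0 y1; apply: le_trans (tf_phi2_ge s0 y1).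
by rewrite mulr_ge0 ?powR_ge0 ?tf_phi1_ge0.
Qed.

Lemma tf_phi_tangent s y y' : 0 <= s -> 1 <= y -> 1 <= y' ->
  tf_phi s y + tf_phi1 s y * (y' - y) <= tf_phi s y'.
Proof.
move=> s0 y1 y'1.
have := @taylor2_lower R (tf_phi s) (tf_phi1 s) (tf_phi2 s) y y' 0.
rewrite mul0r mul0r addr0; apply => t tI.
- by apply: is_derive_tf_phi; lra.
- by apply: is_derive_tf_phi1; lra.
- by apply: tf_phi2_ge0 => //; lra.
Qed.

Lemma tf_phi_le_y s y y' : 0 <= y -> y <= y' -> tf_phi s y <= tf_phi s y'.
Proof.
move=> y0 yy'; rewrite ler_expR ler_pM2l ?tf_mu_gt0//.
by apply: ge0_ler_powR; rewrite ?nnegrE//; [exact: ltW|exact: le_trans yy'].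
Qed.

Lemma tf_phi_le_s s s' y : s <= s' -> tf_phi s y <= tf_phi s' y.
Proof. by move=> ss'; rewrite ler_expR ler_wpM2r ?powR_ge0// tf_mu_le. Qed.

(** The inequality [1 + t <= expR t] is used twice, for the outer exponential and for the one inside
    [tf_mu]. *)
Lemma tf_phi_tangent_s s s' y : s <= s' ->
  tf_phi s y + b * tf_mu s * y `^ q * tf_phi s y * (s' - s) <= tf_phi s' y.
Proof.
move=> ss'; set w := y `^ q; have w0 : 0 <= w by exact: powR_ge0.
have -> : tf_phi s' y = tf_phi s y * expR ((tf_mu s' - tf_mu s) * w).
  by rewrite /tf_phi -expRD -/w; congr expR; ring.
have -> : tf_phi s y + b * tf_mu s * w * tf_phi s y * (s' - s) =
  tf_phi s y * (1 + b * (s' - s) * tf_mu s * w) by ring.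
rewrite ler_pM2l ?tf_phi_gt0//; apply: le_trans (expR_ge1Dx _).
rewrite lerD2l ler_wpM2r//.
have -> : tf_mu s' = tf_mu s * expR (b * (s' - s)).
  by rewrite /tf_mu -[RHS]mulrA -expRD -mulrDr subrKC.
have := tf_mu_gt0 s; have := @expR_ge1Dx R (b * (s' - s)); nra.
Qed.

(** Being at least 1 for all arguments, it keeps the powers with negative exponent smooth and
    bounded. *)
Definition tf_y F x : R := 1 + `|F| + softplus x.
Definition tfG s F x := tf_phi s (tf_y F x).
Definition tfGs s F x := b * tf_mu s * tf_y F x `^ q * tf_phi s (tf_y F x).
Definition tfGx s F x := tf_phi1 s (tf_y F x) * sigmoid x.
Definition tfGxx s F x := tf_phi2 s (tf_y F x) * sigmoid x ^+ 2
  + tf_phi1 s (tf_y F x) * (sigmoid x * (1 - sigmoid x)).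

Lemma tf_y_ge1 F x : 1 <= tf_y F x.
Proof. by rewrite /tf_y -addrA lerDl addr_ge0 ?softplus_ge0. Qed.

Lemma tfG_gt0 s F x : 0 < tfG s F x. Proof. exact: tf_phi_gt0. Qed.

Lemma tfGx_ge0 s F x : 0 <= tfGx s F x.
Proof. by rewrite mulr_ge0 ?tf_phi1_ge0 ?ltW ?sigmoid_gt0. Qed.

(** The weights p^2 and p (1 - p) of the two terms, with p the sigmoid, add up to p. The first term
    is handled by [tf_phi2_ge], the second by y^(q-1) being at most 1. *)
Lemma tfGxx_ge s F x : 0 <= s ->
  tf_y F x `^ (q - 1) * tfGx s F x <= tfGxx s F x.
Proof.
move=> s0; rewrite /tfGx /tfGxx; have y1 := tf_y_ge1 F x.
have := tf_phi2_ge s0 y1; have := tf_phi1_ge0 s (tf_y F x).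
have := sigmoid_gt0 x; have := sigmoid_lt1 x.
have : tf_y F x `^ (q - 1) <= 1.
  by rewrite -[leRHS](powRr0 (tf_y F x)); apply: ler_powR => //; rewrite subr_le0 ltW.
have := powR_ge0 (tf_y F x) (q - 1).
set p := sigmoid x; set m := _ `^ _; set f1 := tf_phi1 _ _; set f2 := tf_phi2 _ _.
move=> m0 m1 p1 p0 f10 f12.
have : m * f1 * p ^+ 2 <= f2 * p ^+ 2 by rewrite ler_wpM2r// sqr_ge0.
have : m * f1 * (p * (1 - p)) <= f1 * (p * (1 - p)).
  by rewrite ler_wpM2r// ?mulr_ge0//; nra.
nra.
Qed.

Lemma tfGxx_ge0 s F x : 0 <= s -> 0 <= tfGxx s F x.
Proof.
move=> s0; apply: le_trans (tfGxx_ge F x s0).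
by rewrite mulr_ge0 ?powR_ge0 ?tfGx_ge0.
Qed.

Lemma tfG_le s s' F F' x x' : s <= s' -> 0 <= F -> F <= F' -> x <= x' ->
  tfG s F x <= tfG s' F' x'.
Proof.
move=> ss' F0 FF' xx'; apply: le_trans (tf_phi_le_s _ ss').
apply: tf_phi_le_y; first exact: le_trans (tf_y_ge1 _ _).
by rewrite /tf_y !ger0_norm ?lerD ?softplus_le//; lra.
Qed.

Lemma tfG_taylor s F x x' (lam : R) :
  (forall t : R, (x <= t <= x') || (x' <= t <= x) -> lam <= tfGxx s F t) ->
  tfG s F x + tfGx s F x * (x' - x) + lam / 2 * (x' - x) ^+ 2 <= tfG s F x'.
Proof.
move=> hlam.
have dy (t : R) : is_derive t 1 (tf_y F) (sigmoid t).
  have -> : tf_y F = cst (1 + `|F|) + softplus by apply/funext.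
  have := is_derive_softplus t => ?.
  by apply: is_derive_eq; rewrite add0r.
have y0 t : 0 < tf_y F t by apply: lt_le_trans (tf_y_ge1 _ _).
have d1 (t : R) : is_derive t 1 (tfG s F) (tfGx s F t).
  exact: (@is_derive1_comp _ (tf_phi s) (tf_y F) _ _ _ (is_derive_tf_phi _ _) (dy t)).
have d2 (t : R) : is_derive t 1 (tfGx s F) (tfGxx s F t).
  have d3 := @is_derive1_comp _ (tf_phi1 s) (tf_y F) _ _ _ (is_derive_tf_phi1 s (y0 t)) (dy t).
  have := @is_deriveM _ _ _ _ _ _ _ _ d3 (is_derive_sigmoid t).
  move=> /is_derive_eq; apply.
  rewrite /GRing.scale/= /tfGxx.
  by rewrite /comp; ring.
exact: (taylor2_lower (fun t _ => d1 t) (fun t _ => d2 t) hlam).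
Qed.

(** The slope of softplus is below 1, so the rise of F inside [tf_y] makes up for the loss [F' - F]
    in x. Only the further loss D is charged, at the rate [sigmoid x]; tangent lines in s and in y
    do the rest. *)
Lemma tfG_step s s' F F' x x' (D : R) : 0 <= s -> s <= s' -> 0 <= F -> F <= F' ->
  0 <= D -> x - (F' - F) - D <= x' ->
  tfG s F x + tfGs s F x * (s' - s) - tfGx s' F x * D <= tfG s' F' x'.
Proof.
move=> s0 ss' F0 FF' D0 xx'.
have s'0 : 0 <= s' by lra.
have y1 := tf_y_ge1 F x; have y'1 := tf_y_ge1 F' x'.
have yy' : tf_y F x - sigmoid x * D <= tf_y F' x'.
  rewrite /tf_y !ger0_norm//; last by lra.
  have := softplus_le xx'.
  have := softplus_tangent x (x - (F' - F) - D).
  have := sigmoid_gt0 x; have := sigmoid_lt1 x; nra.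
have := tf_phi_tangent s'0 y1 y'1.
have := tf_phi_tangent_s (tf_y F x) ss'.
rewrite -/(tfG s F x) -/(tfG s' F' x') -/(tfGs s F x).
have := tf_phi1_ge0 s' (tf_y F x).
have := sigmoid_gt0 x.
have -> : tfGx s' F x = tf_phi1 s' (tf_y F x) * sigmoid x by [].
move: (tf_phi1 _ _) (sigmoid x) yy' => f1 p yy' p0 f10 h1 h2.
move: h1 h2 yy'; move: (tfG _ _ _) (tfGs _ _ _) (tfG _ _ _) (tf_phi _ _) => G0 G1 G2 G3.
move: (tf_y F' x') (tf_y F x) => y' y h1 h2 yy'.
have : f1 * (- (p * D)) <= f1 * (y' - y) by rewrite ler_wpM2l//; lra.
lra.
Qed.

End TestFunction.

(** Either v is so large that the quadratic term alone dominates, or v^(2-alpha) is at most 2 gam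
    y^(1-q); raising this to the power alpha/(2-alpha) gives a multiple of y, because (1-q)
    alpha/(2-alpha) = 1. This identity is what determines q. *)
Lemma young_powR (R : realType) (alpha gam y v : R) (q := 2 * (alpha - 1) / alpha) :
  1 < alpha -> alpha < 2 -> 0 < gam -> 1 <= y -> 0 <= v ->
  gam * v `^ alpha <=
    gam * (2 * gam) `^ (alpha / (2 - alpha)) * y + y `^ (q - 1) / 2 * v ^+ 2.
Proof.
move=> a1 a2 g0 y1 v0.
have y0 : 0 < y by lra.
have [yv|vy] := leP (2 * gam * y `^ (1 - q)) (v `^ (2 - alpha)).
  apply: (@le_trans _ _ (y `^ (q - 1) / 2 * v ^+ 2)); last first.
    by rewrite lerDr !mulr_ge0 ?powR_ge0//; lra.
  have -> : v ^+ 2 = v `^ (2 - alpha) * v `^ alpha.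
    rewrite -powR_mulrn// -powRD ?subrK//.
    by apply/implyP => /eqP; lra.
  rewrite mulrA ler_wpM2r ?powR_ge0//.
  apply: (@le_trans _ _ (y `^ (q - 1) / 2 * (2 * gam * y `^ (1 - q)))); last first.
    by rewrite ler_wpM2l// divr_ge0 ?powR_ge0.
  have E : y `^ (q - 1) * y `^ (1 - q) = 1.
    by rewrite -powRD ?(gt_eqF y0) ?implybT// addrA subrK subrr powRr0.
  suff -> : y `^ (q - 1) / 2 * (2 * gam * y `^ (1 - q)) = gam * (y `^ (q - 1) * y `^ (1 - q)).
    by rewrite E mulr1.
  by field.
apply: (@le_trans _ _ (gam * (2 * gam) `^ (alpha / (2 - alpha)) * y)); last first.
  by rewrite lerDl mulr_ge0 ?sqr_ge0// divr_ge0 ?powR_ge0.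
rewrite -mulrA ler_pM2l//.
have -> : v `^ alpha = (v `^ (2 - alpha)) `^ (alpha / (2 - alpha)).
  by rewrite -powRrM; congr powR; field; lra.
rewrite [X in _ <= _ * X](_ : y = (y `^ (1 - q)) `^ (alpha / (2 - alpha))); last first.
  rewrite -powRrM -[LHS]powRr1 ?ltW//; congr powR; rewrite /q; field.
  by apply/andP; split; lra.
rewrite -powRM ?powR_ge0//; last by lra.
apply: ge0_ler_powR; rewrite ?nnegrE ?powR_ge0 ?mulr_ge0 ?powR_ge0 ?ltW//; try lra.
by rewrite invr_gt0; lra.
Qed.

(* The gain Gxx v^2 / 2 absorbs the sub-quadratic growth of the generator up to
   a multiple of y, which the growth of tf_mu in time absorbs in turn. *)
Lemma tfG_drift (R : realType) (alpha gam c0 s F x v : R)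
    (q := 2 * (alpha - 1) / alpha)
    (b := q * (2 * c0 + gam * (2 * gam) `^ (alpha / (2 - alpha)))) :
  1 < alpha -> alpha < 2 -> 0 < gam -> 0 <= c0 -> 0 <= s -> 0 <= v ->
  tfGx q b s F x * (c0 * (1 + `|x|) + gam * v `^ alpha) <=
  tfGs q b s F x + tfGxx q b s F x / 2 * v ^+ 2.
Proof.
move=> a1 a2 g0 c00 s0 v0.
have q0 : 0 < q by rewrite /q divr_gt0 ?mulr_gt0//; lra.
have q1 : q < 1 by rewrite /q ltr_pdivrMr; lra.
have b0 : 0 <= b.
  apply: mulr_ge0; first exact: ltW.
  by rewrite addr_ge0// mulr_ge0 ?powR_ge0// ltW.
set y := tf_y F x; have y1 : 1 <= y := tf_y_ge1 F x.
have Gxx := tfGxx_ge q0 q1 b0 F x s0.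
have Gx0 := tfGx_ge0 b q0 s F x.
have yng := young_powR a1 a2 g0 y1 v0.
set C := gam * (2 * gam) `^ _ in yng b b0 Gxx Gx0 *.
have C0 : 0 <= C by rewrite mulr_ge0 ?powR_ge0// ltW.
(* The leading factor q of b turns [y ^ q] into [y] times the derivative of the power. The term 2 c0
   answers [spy], and C answers the remainder in Young's inequality. *)
have -> : tfGs q b s F x = (2 * c0 + C) * y * tf_phi1 q b s y.
  rewrite /tfGs /tf_phi1 -/y -(mulr_powRB1 (ltW (lt_le_trans ltr01 y1)) q0).
  rewrite {1}/b; move: (tf_mu _ _ _) (tf_phi _ _ _ _) => ? ?; ring.
have f10 := tf_phi1_ge0 b q0 s y.
set f1 := tf_phi1 _ _ _ _ in f10 *.
have GxE : tfGx q b s F x = f1 * sigmoid x by [].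
have sp := sigmoid_norm_le x.
have p0 := sigmoid_gt0 x; have p1 := sigmoid_lt1 x.
have spy : sigmoid x * (1 + `|x|) <= 2 * y.
  have : 1 + softplus x <= y by rewrite /y /tf_y lerD2r lerDl.
  by lra.
move: Gxx Gx0; rewrite GxE -/y -/q in yng * => Gxx Gx0.
set m := y `^ (q - 1) in yng Gxx; set w := v ^+ 2 in yng *.
have w0 : 0 <= w by exact: sqr_ge0.
have h1 : m * (f1 * sigmoid x) / 2 * w <= tfGxx q b s F x / 2 * w.
  by rewrite ler_wpM2r// ler_pM2r.
set V := gam * _ `^ _ in yng *.
have h2 : f1 * sigmoid x * V <= f1 * sigmoid x * (C * y + m / 2 * w).
  by rewrite ler_wpM2l.
have h3 : f1 * (sigmoid x * (1 + `|x|)) * c0 <= f1 * (2 * y) * c0.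
  by rewrite ler_wpM2r// ler_wpM2l.
have h4 : f1 * sigmoid x * (C * y) <= f1 * (C * y).
  rewrite -mulrA; apply: ler_wpM2l => //; apply: ler_piMl; last exact: ltW.
  by rewrite mulr_ge0//; lra.
move: h1 h2 h3 h4; rewrite -/C.
move: (tfGxx _ _ _ _ _) (sigmoid x) `|x| => gxx p nx.
clearbody V w m f1 C y; clear => h1 h2 h3 h4; lra.
Qed.

(** * Uniform continuity and boundedness on cubes *)

Section Heine.
Context {R : realType}.
Implicit Types (f : R * R * R -> R) (K eps : R).

Let cube K : set (R * R * R) := (`[- K, K] `*` `[- K, K]) `*` `[- K, K].

Let cubeP K a b c : `|a| <= K -> `|b| <= K -> `|c| <= K -> cube K (a, b, c).
Proof.
by move=> ha hb hc; split=> //=; [split=> //=|]; rewrite in_itv/= -ler_norml.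
Qed.

Let compact_cube K : compact (cube K).
Proof. by apply: compact_setX; [apply: compact_setX|]; exact: segment_compact. Qed.

(** Only the first point is confined to the cube; compactness in its near-covering form gives a
    radius that serves all second points, inside or outside. *)
Lemma cube_unif_continuous f K eps : continuous f -> 0 < eps ->
  exists2 eta : R, 0 < eta & forall a b c a' b' c' : R,
    `|a| <= K -> `|b| <= K -> `|c| <= K ->
    `|a - a'| < eta -> `|b - b'| < eta -> `|c - c'| < eta ->
    `|f (a, b, c) - f (a', b', c')| < eps.
Proof.
move=> cf eps0.
have /compact_near_coveringP/(_ _ (0^'+ : set_system R)
  (fun i v => forall v', ball v i v' -> `|f v - f v'| < eps)) := @compact_cube K.
case.
  move=> v _.
  have /cvgrPdist_lt/(_ (eps / 2)) := cf v.
  rewrite divr_gt0// => /(_ isT) /nbhs_ballP[r /= r0 hr].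
  have r20 : 0 < r / 2 by rewrite divr_gt0.
  exists (ball v (r / 2), [set i | i < r / 2]).
    split; first by exact: nbhsx_ballx.
    by near=> i; near: i; exact: nbhs_right_lt.
  move=> [v' i] /= [vv' ir] v'' vv''.
  have h1 : `|f v - f v'| < eps / 2.
    by apply: hr; apply: le_ball vv'; rewrite ler_pdivrMr// ler_peMr ?ltW// ltrDl.
  have h2 : `|f v - f v''| < eps / 2.
    apply: hr; rewrite (splitr r); apply: ball_triangle vv' _.
    by apply: le_ball vv''; exact: ltW.
  rewrite (splitr eps) -(subrKA (f v)).
  by rewrite (le_lt_trans (ler_normD _ _))// ltrD// distrC.
move=> e /= e0 he.
exists (e / 2); first by rewrite divr_gt0.
move=> a b c a' b' c' ha hb hc haa' hbb' hcc'.
have e20 : 0 < e / 2 by rewrite divr_gt0.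
apply: (he (e / 2)) => //=.
- by rewrite sub0r normrN gtr0_norm// ltr_pdivrMr// ltr_pMr// ltrDl.
- exact: cubeP.
Unshelve. all: by end_near. Qed.

Lemma cube_bounded f K : continuous f ->
  exists C : R, forall a b c : R, `|a| <= K -> `|b| <= K -> `|c| <= K ->
    `|f (a, b, c)| <= C.
Proof.
move=> cf.
have /compact_near_coveringP/(_ _ (+oo : set_system R)
  (fun i v => `|f v| <= i)) := @compact_cube K.
case.
  move=> v _.
  have /cvgrPdist_lt/(_ 1) := cf v.
  rewrite ltr01 => /(_ isT) /nbhs_ballP[r /= r0 hr].
  exists (ball v r, [set i | `|f v| + 1 <= i]).
    split; first exact: nbhsx_ballx.
    by near=> i; near: i; exact: nbhs_pinfty_ge.
  move=> [v' i] /= [/hr h]; apply: le_trans.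
  rewrite -(subrK (f v) (f v')) addrC.
  by rewrite (le_trans (ler_normD _ _))// lerD2l distrC ltW.
move=> M /= [_ hM].
exists (M + 1) => a b c ha hb hc; apply: hM; first by rewrite ltrDl.
exact: cubeP.
Unshelve. all: by end_near. Qed.
End Heine.

Section TestFunctionContinuity.
Context {R : realType}.
Variables (q b : R).
Hypotheses (q0 : 0 < q).
Let V : Type := (R * R * R)%type.

Let cfst : continuous (fun v : R * R * R => v.1.1).
Proof. by move=> v; apply: (@continuous_comp _ _ _ fst fst); exact: cvg_fst. Qed.

Let csnd : continuous (fun v : R * R * R => v.1.2).
Proof. by move=> v; apply: (@continuous_comp _ _ _ fst snd); [exact: cvg_fst|exact: cvg_snd]. Qed.

Let cthd : continuous (fun v : R * R * R => v.2).
Proof. by move=> v; exact: cvg_snd. Qed.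

Lemma continuous_sigmoid : continuous (@sigmoid R).
Proof.
by move=> x; apply/differentiable_continuous/derivable1_diffP;
  apply: ex_derive; exact: is_derive_sigmoid.
Qed.

Lemma continuous_softplus : continuous (@softplus R).
Proof.
by move=> x; apply/differentiable_continuous/derivable1_diffP;
  apply: ex_derive; exact: is_derive_softplus.
Qed.

Let cmu : continuous (fun v : R * R * R => tf_mu q b v.1.1).
Proof.
move=> v; apply: cvgM; first exact: cvg_cst.
apply: (@continuous_comp _ _ _ (fun v : R * R * R => b * v.1.1) expR); last exact: continuous_expR.
by apply: cvgM; [exact: cvg_cst|exact: cfst].
Qed.

Let cy : continuous (fun v : R * R * R => tf_y v.1.2 v.2).
Proof.
move=> v; apply: cvgD.
  apply: cvgD; first exact: cvg_cst.
  by apply: cvg_norm; exact: csnd.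
by apply: (@continuous_comp _ _ _ snd softplus); [exact: cthd|exact: continuous_softplus].
Qed.

Let cpow a : continuous (fun v : R * R * R => tf_y v.1.2 v.2 `^ a).
Proof.
move=> v.
apply: (@continuous_comp _ _ _ (fun v : R * R * R => tf_y v.1.2 v.2) (@powR R ^~ a)).
  exact: cy.
apply/differentiable_continuous/derivable1_diffP; apply: ex_derive.
by apply: is_derive1_powR; apply: lt_le_trans (tf_y_ge1 _ _).
Qed.

Let cphi : continuous (fun v : R * R * R => tf_phi q b v.1.1 (tf_y v.1.2 v.2)).
Proof.
move=> v.
apply: (@continuous_comp _ _ _ (fun v : R * R * R => tf_mu q b v.1.1 * tf_y v.1.2 v.2 `^ q) expR); last exact: continuous_expR.
by apply: cvgM; [exact: cmu|exact: cpow].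
Qed.

Let csg : continuous (fun v : R * R * R => sigmoid v.2).
Proof.
by move=> v; apply: (@continuous_comp _ _ _ snd sigmoid); [exact: cthd|exact: continuous_sigmoid].
Qed.

Let ccst (a : R) : continuous (fun v : R * R * R => a).
Proof. by move=> v; exact: cvg_cst. Qed.

Lemma continuous_tfG : continuous (fun v : R * R * R => tfG q b v.1.1 v.1.2 v.2).
Proof. exact: cphi. Qed.

Lemma continuous_tfGs : continuous (fun v : R * R * R => tfGs q b v.1.1 v.1.2 v.2).
Proof.
move=> v; apply: cvgM; last exact: cphi.
apply: cvgM; last exact: cpow.
by apply: cvgM; [exact: ccst|exact: cmu].
Qed.

Let cphi1 : continuous (fun v : R * R * R => tf_phi1 q b v.1.1 (tf_y v.1.2 v.2)).
Proof.
move=> v; apply: cvgM; last exact: cphi.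
apply: cvgM; last exact: cpow.
by apply: cvgM; [exact: cmu|exact: ccst].
Qed.

Lemma continuous_tfGx : continuous (fun v : R * R * R => tfGx q b v.1.1 v.1.2 v.2).
Proof. by move=> v; apply: cvgM; [exact: cphi1|exact: csg]. Qed.

Let cphi2 : continuous (fun v : R * R * R => tf_phi2 q b v.1.1 (tf_y v.1.2 v.2)).
Proof.
move=> v; apply: cvgM; last exact: cphi.
have cmq : {for v, continuous (fun v : R * R * R => tf_mu q b v.1.1 * q)}.
  by apply: cvgM; [exact: cmu|exact: ccst].
apply: cvgD.
  have h : {for v, continuous (fun v : R * R * R => tf_mu q b v.1.1 * q * tf_y v.1.2 v.2 `^ (q - 1))}.
    by apply: cvgM; [exact: cmq|exact: cpow].
  exact: (cvgM h h).
apply: cvgM; first exact: cmq.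
by apply: cvgM; [exact: ccst|exact: cpow].
Qed.

Lemma continuous_tfGxx : continuous (fun v : R * R * R => tfGxx q b v.1.1 v.1.2 v.2).
Proof.
move=> v; apply: cvgD.
  apply: cvgM; first exact: cphi2.
  have h := csg; rewrite (_ : (fun _ => _) = (fun v : R * R * R => sigmoid v.2 * sigmoid v.2)).
    exact: (cvgM (h v) (h v)).
  by apply/funext => ?; rewrite expr2.
apply: cvgM; first exact: cphi1.
apply: cvgM; first exact: csg.
by apply: cvgB; [exact: ccst|exact: csg].
Qed.

End TestFunctionContinuity.

(** * Growth of the test function *)

Section TestFunctionGrowth.
Context {R : realType}.
Variables (q b : R).
Hypotheses (q0 : 0 < q) (q1 : q < 1) (b0 : 0 <= b).

(** A fraction t in (0, 1] satisfies t <= t^q; this is applied to x/(x+y) and y/(x+y), which sum to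
    1. *)
Lemma powR_subadd (x y : R) : 0 <= x -> 0 <= y -> (x + y) `^ q <= x `^ q + y `^ q.
Proof.
move=> x0 y0.
have [xy0|xy0] := eqVneq (x + y) 0.
  by rewrite xy0 powR0 ?gt_eqF// addr_ge0 ?powR_ge0.
have xyp : 0 < x + y by rewrite lt_neqAle eq_sym xy0 addr_ge0.
have key (z : R) : 0 <= z -> z <= x + y -> z / (x + y) * (x + y) `^ q <= z `^ q.
  move=> z0 zxy; rewrite le_eqVlt in z0; case/predU1P : z0 => [<-|z0].
    by rewrite mul0r mul0r powR_ge0.
  have w0 : 0 < z / (x + y) by rewrite divr_gt0.
  have {2}-> : z = z / (x + y) * (x + y) by rewrite divfK.
  rewrite powRM ?(ltW w0) ?(ltW xyp)// ler_pM2r ?powR_gt0//.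
  apply: ger1_powR; last exact: ltW.
  by rewrite w0 ler_pdivrMr// mul1r.
have := key x x0; have := key y y0; rewrite lerDl lerDr => /(_ x0) hy /(_ y0) hx.
apply: le_trans (lerD hx hy).
by rewrite -mulrDl -mulrDl divff ?mul1r.
Qed.

(** The bounds give [tf_y F x <= 3 + (1 + c) * S], and subadditivity of the power q separates the
    constant 3 from the random part. *)
Lemma tfG_growth (T c S F x : R) : 0 <= F -> F <= S -> 0 <= c -> `|x| <= c * S + 1 ->
  tfG q b T F x <= expR (tf_mu q b T * 3 `^ q) *
                   expR (tf_mu q b T * (1 + c) `^ q * S `^ q).
Proof.
move=> F0 FS c0 xcS.
rewrite -expRD /tfG /tf_phi ler_expR -mulrA -mulrDr.
rewrite ler_pM2l ?tf_mu_gt0//.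
have S0 : 0 <= S by exact: le_trans FS.
rewrite -powRM ?addr_ge0//.
apply: le_trans (powR_subadd _ _) => //; last by rewrite mulr_ge0 ?addr_ge0.
apply: ge0_ler_powR; rewrite ?nnegrE ?(ltW q0)//.
- exact: le_trans (tf_y_ge1 _ _).
- by rewrite addr_ge0// mulr_ge0// addr_ge0.
rewrite /tf_y ger0_norm//; have := softplus_le_norm x; lra.
Qed.

Lemma tfG_coercive (A : R) : exists z, A <= tfG q b 0 0 z.
Proof.
have [A1|A1] := leP A 1.
  exists 0; apply: le_trans A1 _; rewrite -[leLHS](@expR0 R) ler_expR.
  by rewrite mulr_ge0 ?powR_ge0// ltW// tf_mu_gt0.
have A0 : 0 < A by lra.
(* At time 0 the coefficient [tf_mu] is 2/q, hence at least 1, and [tf_y 0 z] is at least z, so it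
   suffices that z^q = ln A. *)
exists ((ln A) `^ q^-1).
have -> : A = expR (ln A) by rewrite lnK.
rewrite expRK ler_expR.
have l0 : 0 <= ln A by rewrite ln_ge0// ltW.
apply: (@le_trans _ _ ((ln A `^ q^-1) `^ q)).
  by rewrite -powRrM mulVf ?gt_eqF// powRr1.
have m1 : 1 <= tf_mu q b 0.
  by rewrite /tf_mu mulr0 expR0 mulr1 ler_pdivlMr// mul1r; apply: ltW; apply: lt_trans q1 _; rewrite ltrDl.
apply: (@le_trans _ _ (1 * tf_y 0 (ln A `^ q^-1) `^ q)); last first.
  by rewrite ler_wpM2r ?powR_ge0.
rewrite mul1r; apply: ge0_ler_powR; rewrite ?nnegrE ?(ltW q0) ?powR_ge0//.
  exact: le_trans (tf_y_ge1 _ _).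
by rewrite /tf_y normr0 addr0; apply: le_trans (softplus_ge_id _) _; rewrite lerDr.
Qed.
End TestFunctionGrowth.

Section TestFunctionMeasurability.
Context {R : realType} {d : measure_display} {X : measurableType d}.
Variables (q b s : R) (F x : X -> R).
Hypotheses (mF : measurable_fun setT F) (mx : measurable_fun setT x).

Let mexp (f : X -> R) : measurable_fun setT f -> measurable_fun setT (fun w => expR (f w)).
Proof. by move=> mf; exact: measurableT_comp. Qed.

Let msg : measurable_fun setT (fun w => sigmoid (x w)).
Proof.
apply: (@measurableT_comp _ _ _ _ _ _ (@sigmoid R)) => //.
by apply: continuous_measurable_fun; exact: continuous_sigmoid.
Qed.

Let my : measurable_fun setT (fun w => tf_y (F w) (x w)).
Proof.
apply: measurable_funD.
  apply: measurable_funD; first exact: measurable_cst.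
  exact: measurableT_comp.
apply: (@measurableT_comp _ _ _ _ _ _ (@softplus R)) => //.
by apply: continuous_measurable_fun; exact: continuous_softplus.
Qed.

Let mpow a : measurable_fun setT (fun w => tf_y (F w) (x w) `^ a).
Proof. by apply: (@measurableT_comp _ _ _ _ _ _ (@powR R ^~ a)) => //; exact: measurable_powR. Qed.

Lemma measurable_tfG : measurable_fun setT (fun w => tfG q b s (F w) (x w)).
Proof. by apply: mexp; apply: measurable_funM => //; exact: mpow. Qed.

Let mphi1 : measurable_fun setT (fun w => tf_phi1 q b s (tf_y (F w) (x w))).
Proof.
by apply: measurable_funM; [apply: measurable_funM => //; exact: mpow|exact: measurable_tfG].
Qed.

Lemma measurable_tfGx : measurable_fun setT (fun w => tfGx q b s (F w) (x w)).
Proof. by apply: measurable_funM; [exact: mphi1|exact: msg]. Qed.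

Lemma measurable_tfGxx : measurable_fun setT (fun w => tfGxx q b s (F w) (x w)).
Proof.
apply: measurable_funD; apply: measurable_funM.
- apply: measurable_funM; last exact: measurable_tfG.
  apply: measurable_funD.
    by apply: measurable_funX; apply: measurable_funM => //; exact: mpow.
  by apply: measurable_funM => //; apply: measurable_funM => //; exact: mpow.
- exact: measurable_funX.
- exact: mphi1.
- by apply: measurable_funM => //; apply: measurable_funB.
Qed.
End TestFunctionMeasurability.

(** * Discrete submartingale inequality *)

(* The properties of the test function that the discrete argument uses; keeping
   them abstract also keeps its formula out of the arithmetic below. *)
Record is_test_function (R : realType) (alpha gam c0 : R)
    (G Gs Gx Gxx : R -> R -> R -> R) : Prop := {
  tf_gt0 : forall s F x, 0 < G s F x;
  tf_x_ge0 : forall s F x, 0 <= Gx s F x;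
  tf_xx_ge0 : forall s F x, 0 <= s -> 0 <= Gxx s F x;
  tf_le : forall s s' F F' x x', s <= s' -> 0 <= F -> F <= F' -> x <= x' ->
    G s F x <= G s' F' x';
  tf_taylor : forall s F x x' (lam : R),
    (forall t : R, (x <= t <= x') || (x' <= t <= x) -> lam <= Gxx s F t) ->
    G s F x + Gx s F x * (x' - x) + lam / 2 * (x' - x) ^+ 2 <= G s F x';
  tf_step : forall s s' F F' x x' (D : R), 0 <= s -> s <= s' -> 0 <= F ->
    F <= F' -> 0 <= D -> x - (F' - F) - D <= x' ->
    G s F x + Gs s F x * (s' - s) - Gx s' F x * D <= G s' F' x';
  tf_drift : forall s F x (v : R), 0 <= s -> 0 <= v ->
    Gx s F x * (c0 * (1 + `|x|) + gam * v `^ alpha) <=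
    Gs s F x + Gxx s F x / 2 * v ^+ 2;
  tf_meas : forall (d : measure_display) (X : measurableType d) s (F x : X -> R),
    measurable_fun setT F -> measurable_fun setT x ->
    measurable_fun setT (fun w => G s (F w) (x w));
  tf_meas_x : forall (d : measure_display) (X : measurableType d) s (F x : X -> R),
    measurable_fun setT F -> measurable_fun setT x ->
    measurable_fun setT (fun w => Gx s (F w) (x w));
  tf_meas_xx : forall (d : measure_display) (X : measurableType d) s (F x : X -> R),
    measurable_fun setT F -> measurable_fun setT x ->
    measurable_fun setT (fun w => Gxx s (F w) (x w));
  tf_cont : continuous (fun v : R * R * R => G v.1.1 v.1.2 v.2);
  tf_cont_s : continuous (fun v : R * R * R => Gs v.1.1 v.1.2 v.2);
  tf_cont_x : continuous (fun v : R * R * R => Gx v.1.1 v.1.2 v.2);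
  tf_cont_xx : continuous (fun v : R * R * R => Gxx v.1.1 v.1.2 v.2) }.

(** In the last clause c is used at 1 for the terminal bound and at 2r - 1 for the bound along the
    path. The order p of the second moment therefore depends on r, which is where the exponential
    moments of all orders enter. *)
Lemma exists_test_function (R : realType) (alpha gam c0 : R)
    (q := 2 * (alpha - 1) / alpha) :
  1 < alpha -> alpha < 2 -> 0 < gam -> 0 <= c0 ->
  exists G Gs Gx Gxx : R -> R -> R -> R,
  [/\ is_test_function alpha gam c0 G Gs Gx Gxx,
      forall A : R, exists z, A <= G 0 0 z &
      forall T : R, exists2 B : R, 0 < B & forall c : R, 0 <= c ->
        exists2 p : R, 0 < p & forall S F x : R, 0 <= F -> F <= S ->
        `|x| <= c * S + 1 -> G T F x <= B * expR (p * S `^ q)].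
Proof.
move=> a1 a2 g0 c00.
pose b := q * (2 * c0 + gam * (2 * gam) `^ (alpha / (2 - alpha))).
have q0 : 0 < q by rewrite /q divr_gt0 ?mulr_gt0//; lra.
have q1 : q < 1 by rewrite /q ltr_pdivrMr; lra.
have b0 : 0 <= b.
  apply: mulr_ge0; first exact: (ltW q0).
  by apply: addr_ge0; rewrite ?mulr_ge0 ?powR_ge0 ?(ltW g0).
exists (tfG q b), (tfGs q b), (tfGx q b), (tfGxx q b); split.
- split.
  + exact: tfG_gt0.
  + exact: tfGx_ge0.
  + by move=> s F x; exact: tfGxx_ge0.
  + by move=> s s' F F' x x'; exact: tfG_le.
  + by move=> s F x x' lam; exact: tfG_taylor.
  + by move=> s s' F F' x x' D; exact: tfG_step.
  + by move=> s F x v; exact: tfG_drift.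
  + by move=> d X s F x mF mx; exact: measurable_tfG.
  + by move=> d X s F x mF mx; exact: measurable_tfGx.
  + by move=> d X s F x mF mx; exact: measurable_tfGxx.
  + exact: continuous_tfG.
  + exact: continuous_tfGs.
  + exact: continuous_tfGx.
  + exact: continuous_tfGxx.
- by move=> A; exact: tfG_coercive.
- move=> T; exists (expR (tf_mu q b T * 3 `^ q)); first exact: expR_gt0.
  move=> c c1; exists (tf_mu q b T * (1 + c) `^ q).
    by rewrite mulr_gt0 ?tf_mu_gt0// powR_gt0//; lra.
  by move=> S F x F0 FS xS; exact: tfG_growth.
Qed.

Section DiscreteSubmartingale.
Context {R : realType}.
Variables (alpha gam c0 T N : R) (G Gs Gx Gxx : R -> R -> R -> R).
Hypotheses (T0 : 0 <= T) (N0 : 0 <= N)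
  (tfH : is_test_function alpha gam c0 G Gs Gx Gxx).

Let K := T + N + 2.

Let box (s F x : R) : 0 <= s -> s <= T -> 0 <= F -> F <= N -> `|x| <= N + 2 ->
  [/\ `|s| <= K, `|F| <= K & `|x| <= K].
Proof.
move=> s0 sT F0 FN xN; have ? := T0; have ? := N0.
by rewrite /K; split; [rewrite ger0_norm//|rewrite ger0_norm//|]; lra.
Qed.

Let unif (g : R -> R -> R -> R) (cg : continuous (fun v : R * R * R => g v.1.1 v.1.2 v.2))
  (eps : R) : 0 < eps -> exists2 eta : R, 0 < eta & forall s s' F x x' : R,
  0 <= s -> s <= T -> 0 <= F -> F <= N -> `|x| <= N + 2 ->
  `|s - s'| < eta -> `|x - x'| < eta -> `|g s F x - g s' F x'| < eps.
Proof.
move=> e0; have [eta eta0 h] := cube_unif_continuous K cg e0.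
exists eta => // s s' F x x' s0 sT F0 FN xN ss' xx'.
have [sK FK xK] := box s0 sT F0 FN xN.
by apply: (h s F x s' F x') => //; rewrite subrr normr0.
Qed.

Let bnd (g : R -> R -> R -> R) (cg : continuous (fun v : R * R * R => g v.1.1 v.1.2 v.2)) :
  exists2 C : R, 0 <= C & forall s F x : R,
  0 <= s -> s <= T -> 0 <= F -> F <= N -> `|x| <= N + 2 -> `|g s F x| <= C.
Proof.
have [C hC] := cube_bounded K cg.
exists `|C| => // s F x s0 sT F0 FN xN.
have [sK FK xK] := box s0 sT F0 FN xN.
by apply: le_trans (ler_norm C); apply: (hC s F x).
Qed.

Local Ltac lra_only := clear -T0 N0 tfH box unif bnd; lra.

(** For small z this is Taylor's formula with the modulus of continuity of [Gxx] as error; for large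
    z the quartic term makes the left side nonpositive. The truncation at CH keeps the sums of such
    terms bounded even on exceptional events. Between N + 1 and N + 2 there is room for one
    increment. *)
Lemma tfG_taylor_min (CH : R) :
  (forall s F x : R, 0 <= s -> s <= T -> 0 <= F -> F <= N -> `|x| <= N + 2 ->
    G s F x <= CH) ->
  forall eps1 : R, 0 < eps1 -> exists2 K4 : R, 0 <= K4 & forall s F u z : R,
    0 <= s -> s <= T -> 0 <= F -> F <= N -> `|u| <= N + 1 ->
    G s F u + Gx s F u * z + Gxx s F u / 2 * z ^+ 2 - eps1 * z ^+ 2 - K4 * z ^+ 4
      <= Num.min (G s F (u + z)) CH.
Proof.
move=> hCH eps1 e0.
have e20 : 0 < 2 * eps1 by rewrite mulr_gt0.
have [d d0 hd] := unif (tf_cont_xx tfH) e20.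
have [Cx Cx0 hCx] := bnd (tf_cont_x tfH).
have [Cxx Cxx0 hCxx] := bnd (tf_cont_xx tfH).
pose dl := Num.min d 1.
have dl0 : 0 < dl by rewrite lt_min d0 ltr01.
have CH0 : 0 <= CH.
  apply: le_trans (hCH 0 0 0 _ _ _ _ _) => //.
    exact: ltW (tf_gt0 tfH _ _ _).
  by rewrite normr0 addr_ge0.
(* Once |z| is at least dl, and dl at most 1, each of the terms in G, Gx z and Gxx z^2 / 2 is at
   most its constant times (|z| / dl)^4. *)
exists ((CH + Cx + Cxx) / dl ^+ 4).
  by rewrite divr_ge0 ?exprn_ge0 ?(ltW dl0)// !addr_ge0.
move=> s F u z s0 sT F0 FN uN.
have uN2 : `|u| <= N + 2 by lra.
have Gu := hCH s F u s0 sT F0 FN uN2.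
have hGx := hCx s F u s0 sT F0 FN uN2.
have hGxx := hCxx s F u s0 sT F0 FN uN2.
have [zd|dz] := ltP `|z| dl.
  have [zd1 z1] : `|z| < d /\ `|z| < 1 by move: zd; rewrite lt_min => /andP.
  have K4z : 0 <= (CH + Cx + Cxx) / dl ^+ 4 * z ^+ 4.
    apply: mulr_ge0; last exact: exprn_even_ge0.
    by rewrite divr_ge0 ?exprn_ge0 ?(ltW dl0) ?addr_ge0.
  have tay : G s F u + Gx s F u * z + Gxx s F u / 2 * z ^+ 2 - eps1 * z ^+ 2 <=
      G s F (u + z).
    have := @tf_taylor _ _ _ _ _ _ _ _ tfH s F u (u + z) (Gxx s F u - 2 * eps1).
    have -> : u + z - u = z by rewrite addrAC subrr add0r.
    have -> : (Gxx s F u - 2 * eps1) / 2 * z ^+ 2 = Gxx s F u / 2 * z ^+ 2 - eps1 * z ^+ 2.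
      by field.
    rewrite addrA; apply => t tI.
    have ut : `|u - t| < d.
      apply: le_lt_trans zd1; have [z0|z0] := leP 0 z.
        by rewrite (ger0_norm z0) ler0_norm; move: z0 tI => + /orP[]/andP[]; lra_only.
      by rewrite (ltr0_norm z0) ger0_norm; move: z0 tI => + /orP[]/andP[]; lra_only.
    have := hd s s F u t s0 sT F0 FN uN2; rewrite subrr normr0 => /(_ d0 ut).
    by rewrite ltr_norml => /andP[_]; lra_only.
  have Guz : G s F (u + z) <= CH.
    by apply: hCH => //; have := ler_normD u z; move: uN z1; lra_only.
  by rewrite (min_idPl Guz); move: tay K4z; lra_only.
have -> : (CH + Cx + Cxx) / dl ^+ 4 * z ^+ 4 = (CH + Cx + Cxx) * (`|z| / dl) ^+ 4.
  have -> : z ^+ 4 = `|z| ^+ 4 by rewrite -normrX ger0_norm// exprn_even_ge0.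
  by rewrite expr_div_n; ring.
set r := `|z| / dl.
have r1 : 1 <= r by rewrite ler_pdivlMr// mul1r.
have zr : `|z| <= r by rewrite ler_pdivlMr// ler_piMr// /dl ge_min lexx orbT.
have h1 : 1 <= r ^+ 4 by rewrite exprn_ege1.
have h2 : `|z| <= r ^+ 4.
  by apply: le_trans zr _; rewrite -[leLHS]expr1; apply: ler_weXn2l.
have h3 : z ^+ 2 <= r ^+ 4.
  apply: (@le_trans _ _ (r ^+ 2)); last by apply: ler_weXn2l.
  by rewrite -(real_normK (num_real z)) ler_sqr// nnegrE ?normr_ge0// (le_trans ler01).
have m0 : 0 <= Num.min (G s F (u + z)) CH by rewrite le_min CH0 (ltW (tf_gt0 tfH _ _ _)).
apply: le_trans m0.
have hx : Gx s F u * z <= Cx * r ^+ 4.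
  apply: le_trans (ler_norm _) _; rewrite normrM ler_pM//.
have hxx : Gxx s F u / 2 * z ^+ 2 <= Cxx * r ^+ 4.
  apply: ler_pM; rewrite ?sqr_ge0//.
    by rewrite divr_ge0// (tf_xx_ge0 tfH).
  have := ler_norm (Gxx s F u); have := tf_xx_ge0 tfH F u s0.
  by move: hGxx; lra_only.
have hz : 0 <= eps1 * z ^+ 2 by rewrite mulr_ge0 ?sqr_ge0// ltW.
have hc : G s F u <= CH * r ^+ 4 by apply: le_trans Gu _; rewrite ler_peMr.
by move: hx hxx hz hc; lra_only.
Qed.

(** The martingale increment z has been made; the time, F and the drift then move by one step
    through [tf_step], started at u + z. Moving its coefficients back to (s, u) costs eps, and there
    [tf_drift] offsets the drift against the gain Gxx v^2 / 2. The part of D due to de has no such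
    gain and is kept as an error. *)
Lemma tfG_good_step (CH gam2 : R) : 0 <= gam2 ->
  (forall s F x : R, 0 <= s -> s <= T -> 0 <= F -> F <= N -> `|x| <= N + 2 ->
    G s F x <= CH) ->
  exists2 C : R, 0 <= C & forall eps : R, 0 < eps -> exists2 eta : R, 0 < eta &
  forall s s' F F' u z w D v de : R,
    0 <= s -> s <= s' -> s' <= T -> s' - s < eta -> 0 <= F -> F <= F' -> F <= N ->
    `|u| <= N + 1 -> `|z| < eta -> `|z| <= 1 -> 0 <= D -> 0 <= v -> 0 <= de ->
    u + z - (F' - F) - D <= w ->
    D <= (c0 * (1 + `|u|) + gam * v `^ alpha) * (s' - s) + gam2 * de ->
    G s F (u + z) - eps * ((s' - s) + D) - C * de <=
    Num.min (G s' F' w) CH + Gxx s F u / 2 * v ^+ 2 * (s' - s).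
Proof.
move=> g20 hCH.
have [Cx Cx0 hCx] := bnd (tf_cont_x tfH).
exists (Cx * gam2); first by rewrite mulr_ge0.
move=> eps e0.
have [d1 d10 hd1] := unif (tf_cont_s tfH) e0.
have [d2 d20 hd2] := unif (tf_cont_x tfH) e0.
exists (Num.min d1 d2); first by rewrite lt_min d10 d20.
move=> s s' F F' u z w D v de s0 ss' s'T ds F0 FF' FN uN zd z1 D0 v0 de0 hw hD.
move: ds zd; rewrite !lt_min => /andP[ds1 ds2] /andP[zd1 zd2].
have sT : s <= T by exact: le_trans s'T.
have uN2 : `|u| <= N + 2 by lra.
have hGx := hCx s F u s0 sT F0 FN uN2.
have DI := tf_drift tfH F u s0 v0.
have uuz : u - (u + z) = - z by rewrite opprD addrA subrr add0r.
have stp := tf_step tfH s0 ss' F0 FF' D0 hw.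
have hs : Gs s F u - eps <= Gs s F (u + z).
  have := hd1 s s F u (u + z) s0 sT F0 FN uN2.
  rewrite subrr normr0 uuz normrN => /(_ d10 zd1); rewrite ltr_norml => /andP[_].
  by lra_only.
have hx : Gx s' F (u + z) <= Gx s F u + eps.
  have := hd2 s s' F u (u + z) s0 sT F0 FN uN2.
  rewrite uuz normrN distrC ger0_norm ?subr_ge0// => /(_ ds2 zd2).
  rewrite ltr_norml => /andP[+ _].
  by lra_only.
have x0 : 0 <= Gx s F u by exact: (tf_x_ge0 tfH).
have h1 : (Gs s F u - eps) * (s' - s) <= Gs s F (u + z) * (s' - s).
  by rewrite ler_wpM2r// subr_ge0.
have h2 : Gx s' F (u + z) * D <= (Gx s F u + eps) * D by rewrite ler_wpM2r.
have h3 : Gx s F u * D <= Gx s F u * ((c0 * (1 + `|u|) + gam * v `^ alpha) * (s' - s) + gam2 * de).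
  by rewrite ler_wpM2l.
have h4 : Gx s F u * (c0 * (1 + `|u|) + gam * v `^ alpha) * (s' - s) <=
    (Gs s F u + Gxx s F u / 2 * v ^+ 2) * (s' - s).
  by rewrite ler_wpM2r// subr_ge0.
have h5 : Gx s F u * (gam2 * de) <= Cx * (gam2 * de).
  by rewrite ler_wpM2r ?mulr_ge0//; apply: le_trans (ler_norm _) hGx.
have Guz : G s F (u + z) <= CH.
  by apply: hCH => //; have := ler_normD u z; move: uN z1; lra_only.
have r0 : 0 <= eps * (s' - s + D) + Cx * gam2 * de.
  by rewrite addr_ge0 ?mulr_ge0// ?(ltW e0)// addr_ge0// subr_ge0.
have r1 : 0 <= Gxx s F u / 2 * v ^+ 2 * (s' - s).
  by rewrite !mulr_ge0 ?sqr_ge0 ?subr_ge0 ?invr_ge0// (tf_xx_ge0 tfH).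
rewrite -lerBlDr le_min; apply/andP; split.
  move: stp h1 h2 h3 h4 h5.
  by lra_only.
by move: Guz r0 r1; lra_only.
Qed.

(* Along the grid s: u_j is U_j with its martingale part M_j replaced by the
   simple integral x_j, J - F is the integrated bound on the drift of U in excess of
   F, v_j is the integrand of x and e the squared L2 distance between the two
   integrands. dsm_run j holds when no bad event occurs before step j; dsm_sum adds
   up the martingale parts of the Taylor expansions, less error terms, until then. *)
Section Sequences.
Variables (s F J A x M U e v : nat -> R) (eta gam2 : R).
Let u j := A j + x j.
Let z j := x j.+1 - x j.
Let D j := (J j.+1 - F j.+1) - (J j - F j).

Definition dsm_ok j :=
  [&& J j <= N, `|U j| <= N, 0 <= F j <= N & `|u j| <= N + 1].
Definition dsm_good j := [&& J j.+1 - J j <= eta, `|M j.+1 - M j| <= eta,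
  `|x j.+1 - M j.+1| <= eta, e j.+1 <= eta, A j - (J j.+1 - J j) <= A j.+1 &
  D j <= (c0 * (1 + `|u j|) + gam * v j `^ alpha) * (s j.+1 - s j)
         + gam2 * (e j.+1 - e j)].
Definition dsm_start := (`|x 0%N - M 0%N| <= eta) && (e 0%N <= eta).
Fixpoint dsm_run j : bool := match j with
  | 0%N => dsm_start && dsm_ok 0%N
  | S i => [&& dsm_run i, dsm_good i & dsm_ok (S i)] end.

Definition dsm_mart j := Gx (s j) (F j) (u j) * z j
  + Gxx (s j) (F j) (u j) / 2 * (z j ^+ 2 - v j ^+ 2 * (s j.+1 - s j)).

Definition dsm_sum (eps1 K4 : R) k :=
  (if dsm_run 0 then G (s 0%N) (F 0%N) (u 0%N) else 0) +
  \sum_(j < k) (if dsm_run j then dsm_mart j - eps1 * z j ^+ 2 - K4 * z j ^+ 4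
                else 0).

Record dsm_hyp m : Prop := {
  dsm_s0 : 0 <= s 0%N;
  dsm_sT : forall j, (j <= m)%N -> s j <= T;
  dsm_s : forall j, (j < m)%N -> s j <= s j.+1 < s j + eta;
  dsm_F0 : 0 <= F 0%N;
  dsm_F : forall j, (j < m)%N -> F j <= F j.+1;
  dsm_JF0 : F 0%N <= J 0%N;
  dsm_JF : forall j, (j < m)%N -> J j - F j <= J j.+1 - F j.+1;
  dsm_e0 : 0 <= e 0%N;
  dsm_e : forall j, (j < m)%N -> e j <= e j.+1;
  dsm_v : forall j, (j < m)%N -> 0 <= v j;
  dsm_U : forall j, (j <= m)%N -> U j = A j + M j }.

End Sequences.

(** The three bounds serve three kinds of paths: CH the exceptional ones, the terminal value of G
    those that stay in the box with good steps throughout, and Phi those with good steps that leave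
    the box, where the sum freezes at an unknown index. The shift by 1 in [U + 1] covers the
    distance from u to U. *)
Lemma dsm_bound (gam2 : R) : 0 <= gam2 ->
  exists CH eta : R, [/\ 0 <= CH, 0 < eta, eta <= 1 &
  forall eps1 : R, 0 < eps1 -> exists2 K4 : R, 0 <= K4 &
  forall (s F J A x M U e v : nat -> R) m, dsm_hyp s F J A M U e v eta m ->
  [/\ dsm_sum s F J A x M U e v eta gam2 eps1 K4 m <= 3 + CH,
      dsm_start x M e eta ->
      (forall j, (j < m)%N -> dsm_good s F J A x M e v eta gam2 j) ->
      (forall j, (j <= m)%N -> dsm_ok F J A x U j) ->
      dsm_sum s F J A x M U e v eta gam2 eps1 K4 m <= 3 + G (s m) (F m) (U m + 1) &
      dsm_start x M e eta ->
      (forall j, (j < m)%N -> dsm_good s F J A x M e v eta gam2 j) ->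
      forall Phi : R, (forall j, (j <= m)%N -> G (s j) (F j) (U j + 1) <= Phi) ->
      dsm_sum s F J A x M U e v eta gam2 eps1 K4 m <= 3 + Phi]].
Proof.
move=> g20.
have [CH CH0 hCH'] := bnd (tf_cont tfH).
have hCH (s F x : R) : 0 <= s -> s <= T -> 0 <= F -> F <= N -> `|x| <= N + 2 -> G s F x <= CH.
  by move=> *; apply: le_trans (ler_norm _) _; exact: hCH'.
have [C C0 hstep] := tfG_good_step g20 hCH.
(* The accumulated time and excess drift stay below T + N + 2 while the sum runs, so their share of
   the error is at most 1. *)
pose eps := (T + N + 2)^-1.
have ? := T0; have ? := N0.
have eps0 : 0 < eps by rewrite invr_gt0; lra.
have [eta1 eta10 hstep1] := hstep _ eps0.
(* The increment of x is within 3 eta, being the increment of M and two approximation errors; the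
   second entry makes [C * eta] and eta at most 1/4. *)
pose eta := Num.min (eta1 / 4) (4 * (C + 1))^-1.
have eta0 : 0 < eta by rewrite lt_min divr_gt0//= invr_gt0; lra.
have eta14 : 4 * eta <= eta1.
  by rewrite mulrC -ler_pdivlMr// /eta ge_min lexx.
have etaC : 4 * (C + 1) * eta <= 1.
  by rewrite mulrC -ler_pdivlMr ?mulr_gt0//; rewrite ?div1r /eta ?ge_min ?lexx ?orbT//; lra.
have eta4 : 4 * eta <= 1 by nra.
exists CH, eta; split => //; first by lra.
move=> eps1 e10; have [K4 K40 htay] := tfG_taylor_min hCH e10.
exists K4 => // s F J A x M U e v m hyp.
set u := fun j => A j + x j.
set z := fun j => x j.+1 - x j.
set S := dsm_sum s F J A x M U e v eta gam2 eps1 K4.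
set run := dsm_run s F J A x M U e v eta gam2.
set good := dsm_good s F J A x M e v eta gam2.
have runok j : run j -> (J j <= N) && (`|U j| <= N).
  by case: j => [|j] /=; [case/andP => _ /and4P[-> ->]|case/and3P => _ _ /and4P[-> ->]].
have runx j : run j -> `|x j - M j| <= eta.
  by case: j => [|j] /=; [case/andP => /andP[]|case/and3P => _ /and5P[_ _ + _ _]].
have sge k : (k <= m)%N -> 0 <= s k.
  elim: k => [|k IH] km; first exact: dsm_s0 hyp.
  by have /andP[h _] := dsm_s hyp km; apply: le_trans h; apply: IH; exact: ltnW.
have Fge k : (k <= m)%N -> 0 <= F k.
  elim: k => [|k IH] km; first exact: dsm_F0 hyp.
  by have h := dsm_F hyp km; apply: le_trans h; apply: IH; exact: ltnW.
have JFge k : (k <= m)%N -> 0 <= J k - F k.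
  elim: k => [|k IH] km; first by rewrite subr_ge0; exact: dsm_JF0 hyp.
  by have h := dsm_JF hyp km; apply: le_trans h; apply: IH; exact: ltnW.
have ege k : (k <= m)%N -> 0 <= e k.
  elim: k => [|k IH] km; first exact: dsm_e0 hyp.
  by have h := dsm_e hyp km; apply: le_trans h; apply: IH; exact: ltnW.
have uU j : (j <= m)%N -> `|x j - M j| <= eta -> `|u j - U j| <= eta.
  move=> jm; have -> : u j - U j = x j - M j by rewrite (dsm_U hyp jm) /u; lra.
  by [].
(* The errors of [tfG_good_step] are increments of s, of J - F and of e, so they telescope to this
   quantity. *)
pose err k := eps * (s k - s 0%N) + eps * (J k - F k) + C * e k.
have err3 k : (k <= m)%N -> J k <= N + eta -> e k <= eta -> err k <= 3.
  move=> km JN ee; rewrite /err.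
  have epsK : eps * (T + N + 2) = 1 by rewrite mulVf// gt_eqF//; lra.
  have := Fge k km; have := JFge k km; have := dsm_sT hyp km; have := dsm_s0 hyp.
  have h4 : C * e k <= C * eta by rewrite ler_wpM2l.
  move=> ? ? ? ?.
  have : eps * ((s k - s 0%N) + (J k - F k)) <= eps * (T + N + 2).
    by rewrite ler_pM2l//; lra.
  lra.
have S0E : S 0%N = if run 0%N then G (s 0%N) (F 0%N) (u 0%N) else 0.
  by rewrite /S /dsm_sum big_ord0 addr0.
have SS k : S k.+1 = S k + if run k then dsm_mart s F A x v k - eps1 * z k ^+ 2 - K4 * z k ^+ 4 else 0.
  by rewrite /S /dsm_sum big_ord_recr /= addrA.
(* The first clause is the invariant while the gate is open. The other two must also survive its
   closing: a step that is not good can close it only after the bound by CH is established, and one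
   that is good but leaves the box still satisfies the bound at its right endpoint. *)
have main k : (k <= m)%N -> [/\
  run k -> S k <= Num.min (G (s k) (F k) (u k)) CH + err k,
  S k <= 3 + CH &
  dsm_start x M e eta -> (forall j, (j < k)%N -> good j) ->
  forall Phi : R, (forall j, (j <= k)%N -> G (s j) (F j) (U j + 1) <= Phi) -> S k <= 3 + Phi].
  have errk j : (j <= m)%N -> run j -> e j <= eta -> err j <= 3.
    move=> jm rj; apply: err3 => //; have /runok/andP[JN _] := rj.
    by apply: le_trans JN _; rewrite lerDl ltW.
  have u1 j : (j <= m)%N -> run j -> `|u j| <= N + 1.
    move=> jm rj; have := uU _ jm (runx _ rj); have /runok/andP[_ UN] := rj.
    by have := ler_normD (u j - U j) (U j); rewrite subrK; lra.
  have FN j : (j <= m)%N -> run j -> F j <= N.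
    move=> jm rj; have /runok/andP[JN _] := rj.
    by have := JFge _ jm; lra.
  have GU j : (j <= m)%N -> `|x j - M j| <= eta -> G (s j) (F j) (u j) <= G (s j) (F j) (U j + 1).
    move=> jm /(uU _ jm) h; apply: (tf_le tfH) => //; first exact: (Fge j jm).
    by have := ler_norm (u j - U j); lra.
  elim: k => [|k IH] km.
    have r0 : run 0%N -> S 0%N <= Num.min (G (s 0%N) (F 0%N) (u 0%N)) CH.
      move=> r; rewrite S0E r le_min lexx/=; apply: hCH.
      - exact: sge.
      - exact: (dsm_sT hyp km).
      - exact: Fge.
      - exact: FN.
      - by have := u1 _ km r; lra.
    have err00 : 0 <= err 0%N.
      by rewrite /err subrr mulr0 add0r addr_ge0// mulr_ge0 ?JFge ?ege// ltW.
    split.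
    - by move=> /r0 h; apply: le_trans h _; rewrite lerDl.
    - have [/r0|] := boolP (run 0%N).
        by rewrite le_min => /andP[_ h]; apply: le_trans h _; rewrite lerDr.
      by rewrite S0E => /negbTE ->; rewrite addr_ge0.
    - move=> _ _ Phi /(_ 0%N isT) hPhi.
      have Phi0 : 0 <= Phi by apply: le_trans hPhi; exact: ltW (tf_gt0 tfH _ _ _).
      have [r|] := boolP (run 0%N).
        have := r0 r; rewrite le_min => /andP[h _].
        have := GU 0%N km (runx _ r); lra.
      by rewrite S0E => /negbTE ->; rewrite addr_ge0.
  have km' := ltnW km.
  have [IH1 IH2 IH3] := IH km'.
  have [rk|nrk] := boolP (run k); last first.
    have SE : S k.+1 = S k by rewrite SS (negbTE nrk) addr0.
    split; rewrite SE//.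
      by move=> /= /and3P[rk]; rewrite rk in nrk.
    move=> st gd Phi hPhi; apply: IH3 => // j jk; first by apply: gd; exact: ltnW.
    by apply: hPhi; exact: leqW.
  have uk := u1 k km' rk.
  have /andP[ss' s'eta] := dsm_s hyp km.
  have s'T : s k.+1 <= T by exact: (dsm_sT hyp km).
  have sT : s k <= T by exact: (dsm_sT hyp km').
  have tay := htay (s k) (F k) (u k) (z k) (sge k km') sT (Fge k km') (FN k km' rk) uk.
  set V := Gxx (s k) (F k) (u k) / 2 * v k ^+ 2 * (s k.+1 - s k) in tay *.
  have V0 : 0 <= V.
    rewrite /V mulr_ge0 ?subr_ge0// mulr_ge0 ?sqr_ge0// mulr_ge0 ?invr_ge0//.
    by apply: (tf_xx_ge0 tfH); exact: sge.
  have Sk1 : S k.+1 <= Num.min (G (s k) (F k) (u k + z k)) CH - V + err k.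
    rewrite SS rk /dsm_mart -/(u k) -/(z k).
    have := IH1 rk; have : Num.min (G (s k) (F k) (u k)) CH <= G (s k) (F k) (u k) by rewrite ge_min lexx.
    by move: tay; rewrite /V; lra_only.
  have ek : e k <= eta.
    by move: rk; case: (k) => [|j] /=; [case/andP => /andP[]|case/and3P => _ /and5P[_ _ _ + _]].
  have errk3 := errk k km' rk ek.
  have SCH : S k.+1 <= 3 + CH.
    have : Num.min (G (s k) (F k) (u k + z k)) CH <= CH by rewrite ge_min lexx orbT.
    by move: Sk1 V0 errk3; lra_only.
  have [gk|ngk] := boolP (good k); last first.
    split => //; first by move=> /and3P[_]; rewrite -/(good k) (negbTE ngk).
    by move=> _ /(_ k (ltnSn k)); rewrite (negbTE ngk).
  have /and5P[gJ gM gx ge /andP[gA gD]] := gk.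
  have zeta : `|z k| <= 3 * eta.
    have := runx _ rk => h.
    have -> : z k = (x k.+1 - M k.+1) + (M k.+1 - M k) - (x k - M k) by rewrite /z; ring.
    have := ler_normB (x k.+1 - M k.+1 + (M k.+1 - M k)) (x k - M k).
    have := ler_normD (x k.+1 - M k.+1) (M k.+1 - M k); move: h gM gx; lra_only.
  have stp := hstep1 (s k) (s k.+1) (F k) (F k.+1) (u k) (z k) (u k.+1)
    ((J k.+1 - F k.+1) - (J k - F k)) (v k) (e k.+1 - e k).
  have {stp}stp : G (s k) (F k) (u k + z k) - eps * (s k.+1 - s k + (J k.+1 - F k.+1 - (J k - F k)))
    - C * (e k.+1 - e k) <= Num.min (G (s k.+1) (F k.+1) (u k.+1)) CH + V.
    apply: stp => //.
    - exact: sge.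
    - by move: s'eta eta14 eta0; lra_only.
    - exact: Fge.
    - exact: (dsm_F hyp km).
    - exact: FN.
    - by apply: le_lt_trans zeta _; move: eta14 eta0; lra_only.
    - by apply: le_trans zeta _; move: eta4 eta0; lra_only.
    - by rewrite subr_ge0; exact: (dsm_JF hyp km).
    - exact: (dsm_v hyp km).
    - by rewrite subr_ge0; exact: (dsm_e hyp km).
    - by move: gA; rewrite /u /z; lra_only.
  have S1 : S k.+1 <= Num.min (G (s k.+1) (F k.+1) (u k.+1)) CH + err k.+1.
    have : Num.min (G (s k) (F k) (u k + z k)) CH <= G (s k) (F k) (u k + z k) by rewrite ge_min lexx.
    by move: stp Sk1; rewrite /err; lra_only.
  have err31 : err k.+1 <= 3.
    by apply: err3 => //; have /runok/andP[JN _] := rk; move: gJ JN; lra_only.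
  split => //.
  move=> _ _ Phi /(_ k.+1 (leqnn _)) hPhi.
  have := GU k.+1 km gx.
  have : Num.min (G (s k.+1) (F k.+1) (u k.+1)) CH <= G (s k.+1) (F k.+1) (u k.+1) by rewrite ge_min lexx.
  by move: hPhi S1 err31; lra_only.
have [m1 m2 m3] := main m (leqnn m).
split => //.
move=> st gd okj.
have rm k : (k <= m)%N -> run k.
  elim: k => [|k IH] km /=; first by rewrite st okj.
  by rewrite (IH (ltnW km)) okj// andbT; exact: gd.
have rmm := rm m (leqnn m); have := m1 rmm.
have h1 : Num.min (G (s m) (F m) (u m)) CH <= G (s m) (F m) (u m) by rewrite ge_min lexx.
have h2 : err m <= 3.
  apply: err3 => //; first by have /runok/andP[? _] := rmm; lra.
  by move: rmm; case: (m) => [|j] /=; [case/andP => /andP[]|case/and3P => _ /and5P[_ _ _ + _]].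
have h3 : G (s m) (F m) (u m) <= G (s m) (F m) (U m + 1).
  apply: (tf_le tfH) => //; first exact: Fge.
  by have := uU m (leqnn m) (runx m rmm); have := ler_norm (u m - U m); lra.
lra.
Qed.
End DiscreteSubmartingale.

(** * Brownian increments *)

Lemma measurable_set_le (R : realType) (d : measure_display) (Omega : measurableType d)
  (X Y : Omega -> R) : measurable_fun setT X -> measurable_fun setT Y ->
  measurable [set w | X w <= Y w].
Proof.
move=> mX mY; have := @measurable_fun_ler _ _ _ setT X Y mX mY.
by move=> /(_ measurableT [set true] I); rewrite setTI.
Qed.

(** * Expectations and independence *)

Section Expectation.
Context {R : realType} {d : measure_display} {Omega : measurableType d}.
Variable P : probability Omega R.
Implicit Types X Y : Omega -> R.

Definition rvL1 X := P.-integrable setT (EFin \o X).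
Definition rvE X : R := \int[P]_w X w.

Lemma rvL1_measurable X : rvL1 X -> measurable_fun setT X.
Proof. by move=> /measurable_int /measurable_EFinP. Qed.

Lemma rvL1_le X Y : measurable_fun setT X -> (forall w, `|X w| <= Y w) ->
  rvL1 Y -> rvL1 X.
Proof.
move=> mX XY; apply: le_integrable => //; first exact/measurable_EFinP.
by move=> w _ /=; rewrite lee_fin; apply: le_trans (XY w) (ler_norm _).
Qed.

Lemma rvL1_cst (c : R) : rvL1 (cst c).
Proof. exact: finite_measure_integrable_cst. Qed.

Lemma rvL1_bounded X (C : R) : measurable_fun setT X -> (forall w, `|X w| <= C) ->
  rvL1 X.
Proof. by move=> mX XC; apply: (rvL1_le mX XC); exact: rvL1_cst. Qed.

Lemma rvL1D X Y : rvL1 X -> rvL1 Y -> rvL1 (fun w => X w + Y w).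
Proof. by move=> hX hY; exact: (integrableD measurableT hX hY). Qed.

Lemma rvL1Z (c : R) X : rvL1 X -> rvL1 (fun w => c * X w).
Proof. by move=> hX; exact: (integrableZl measurableT c hX). Qed.

Lemma rvL1B X Y : rvL1 X -> rvL1 Y -> rvL1 (fun w => X w - Y w).
Proof. by move=> hX hY; exact: (integrableB measurableT hX hY). Qed.

Lemma rvL1_sum (I : Type) (s : seq I) (F : I -> Omega -> R) :
  (forall i, rvL1 (F i)) -> rvL1 (fun w => \sum_(i <- s) F i w).
Proof.
move=> hF; elim: s => [|i s IH].
  by rewrite (_ : (fun _ => _) = cst 0); [exact: rvL1_cst|apply/funext => w; rewrite big_nil].
rewrite (_ : (fun _ => _) = (fun w => F i w + \sum_(j <- s) F j w)); first exact: rvL1D.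
by apply/funext => w; rewrite big_cons.
Qed.

Lemma rvL1Mb X Y (C : R) : measurable_fun setT X -> (forall w, `|X w| <= C) ->
  rvL1 Y -> rvL1 (fun w => X w * Y w).
Proof.
move=> mX XC hY; have mY := rvL1_measurable hY.
apply: (@rvL1_le _ (fun w => C * `|Y w|)).
- exact: measurable_funM.
- by move=> w; rewrite normrM ler_wpM2r.
- by apply: rvL1Z; exact: (integrable_norm hY).
Qed.

Lemma rvED X Y : rvL1 X -> rvL1 Y -> rvE (fun w => X w + Y w) = rvE X + rvE Y.
Proof. by move=> hX hY; exact: RintegralD. Qed.

Lemma rvEB X Y : rvL1 X -> rvL1 Y -> rvE (fun w => X w - Y w) = rvE X - rvE Y.
Proof. by move=> hX hY; exact: RintegralB. Qed.

Lemma rvEZ (c : R) X : rvL1 X -> rvE (fun w => c * X w) = c * rvE X.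
Proof. by move=> hX; exact: RintegralZl. Qed.

Lemma rvE_cst (c : R) : rvE (cst c) = c.
Proof. by rewrite /rvE /Rintegral (integral_cst P measurableT c%:E)/= probability_setT mule1. Qed.

Lemma rvE_sum (I : Type) (s : seq I) (F : I -> Omega -> R) :
  (forall i, rvL1 (F i)) -> rvE (fun w => \sum_(i <- s) F i w) = \sum_(i <- s) rvE (F i).
Proof.
move=> hF; elim: s => [|i s IH].
  rewrite big_nil -[RHS](rvE_cst 0); congr rvE.
  by apply/funext => w; rewrite big_nil.
rewrite big_cons -IH -rvED//; last exact: rvL1_sum.
by congr rvE; apply/funext => w; rewrite big_cons.
Qed.

Lemma rvE_le X Y : rvL1 X -> rvL1 Y -> (forall w, X w <= Y w) -> rvE X <= rvE Y.
Proof. by move=> hX hY h; apply: le_Rintegral => // w _; exact: h. Qed.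

Lemma rvE_ge0 X : (forall w, 0 <= X w) -> 0 <= rvE X.
Proof. by move=> h; apply: Rintegral_ge0. Qed.

Lemma rvE_norm X : rvL1 X -> `|rvE X| <= rvE (fun w => `|X w|).
Proof. by move=> hX; apply: le_normr_Rintegral. Qed.

Lemma rvL1_indic (A : set Omega) : measurable A -> rvL1 (\1_A).
Proof. by move=> mA; exact: integrable_indic. Qed.

Lemma rvE_indic (A : set Omega) : measurable A -> rvE (\1_A) = fine (P A).
Proof. by move=> mA; rewrite /rvE /Rintegral integral_indic// setIT. Qed.

Lemma rvE_ae_le X Y : rvL1 X -> rvL1 Y -> {ae P, forall w, X w <= Y w} ->
  rvE X <= rvE Y.
Proof.
move=> hX hY h; rewrite -subr_ge0 -rvEB//.
apply: fine_ge0.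
rewrite (@ae_eq_integral _ _ _ P setT (fun w => `|Y w - X w|%:E))//.
- by apply: integral_ge0 => w _; rewrite lee_fin.
- by apply/measurable_EFinP/measurable_funB; exact: rvL1_measurable.
- apply/measurable_EFinP/measurableT_comp => //.
  by apply: measurable_funB; exact: rvL1_measurable.
- by apply: filterS h => w hw _; rewrite ger0_norm// subr_ge0.
Qed.

Definition rv_indep X Y := forall A C : set R, measurable A -> measurable C ->
  P (X @^-1` A `&` Y @^-1` C) = (P (X @^-1` A) * P (Y @^-1` C))%E.

(** The law of the pair agrees with the product of the laws on rectangles, hence everywhere. Tonelli
    for |xy| gives integrability first, and Fubini then factors the integral. *)
Lemma rvE_indepM X Y : rv_indep X Y -> rvL1 X -> rvL1 Y ->
  rvL1 (fun w => X w * Y w) /\ rvE (fun w => X w * Y w) = rvE X * rvE Y.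
Proof.
move=> XY hX hY.
have mX := rvL1_measurable hX; have mY := rvL1_measurable hY.
pose X' : {mfun Omega >-> R} := HB.pack X (isMeasurableFun.Build _ _ _ _ _ mX).
pose Y' : {mfun Omega >-> R} := HB.pack Y (isMeasurableFun.Build _ _ _ _ _ mY).
pose m1 := distribution P X'; pose m2 := distribution P Y'.
pose XYp w := (X w, Y w).
have mXY : measurable_fun setT XYp by exact: measurable_fun_pair.
pose f (z : R * R) := (z.1 * z.2)%:E.
have mf : measurable_fun setT f.
  by apply/measurable_EFinP; exact: measurable_funM.
have mnf : measurable_fun setT (fun z : R * R => `|z.1 * z.2|%:E).
  by apply/measurable_EFinP; apply: measurableT_comp => //; exact: measurable_funM.
have push (g : R * R -> \bar R) : measurable_fun setT g -> (forall z, (0 <= g z)%E) ->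
    (\int[P]_w g (XYp w) = \int[(m1 \x m2)%E]_z g z)%E.
  move=> mg g0.
  have := @ge0_integral_pushforward _ _ _ _ R _ mXY P setT g measurableT mg (fun z _ => g0 z).
  rewrite preimage_setT => <-.
  apply: eq_measure_integral => A mA _; apply/esym.
  apply: (@product_measure_unique _ _ _ _ R m1 m2 (pushforward P XYp)) => //.
have L1 : rvL1 (fun w => X w * Y w).
  apply/integrableP; split; first by apply/measurable_EFinP/measurable_funM.
  have := push _ mnf (fun z => normr_ge0 (z.1 * z.2)).
  rewrite /= => ->.
  rewrite (fubini_tonelli1 _ mnf)//.
  rewrite /fubini_F/=.
  have mn : measurable_fun setT (fun y : R => `|y|%:E).
    by apply/measurable_EFinP; exact: normr_measurable.
  have inner x : (\int[m2]_y `|x * y|%:E = `|x|%:E * \int[m2]_y `|y|%:E)%E.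
    rewrite -ge0_integralZl//.
    by apply: eq_integral => y _; rewrite normrM EFinM.
  rewrite (eq_integral (fun x : R => (`|x|%:E * \int[m2]_y `|y|%:E)%E)); last first.
    by move=> x _; exact: inner.
  rewrite ge0_integralZr//=; last by apply: integral_ge0.
  have aux (W : Omega -> R) (mW : measurable_fun setT W) (hW : rvL1 W) :
     (\int[pushforward P W]_x `|x|%:E < +oo)%E.
    rewrite (ge0_integral_pushforward mW)//.
    by have /integrableP[_] := hW.
  by apply: lte_mul_pinfty; rewrite ?ge0_fin_numE ?integral_ge0//; exact: aux.
split => //.
have If : (m1 \x m2)%E.-integrable setT f.
  apply/integrableP; split => //.
  have := push _ mnf (fun z => normr_ge0 (z.1 * z.2)).
  rewrite /= => <-.
  by have /integrableP[] := L1.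
rewrite /rvE /Rintegral.
have -> : (\int[P]_w (X w * Y w)%:E = \int[(m1 \x m2)%E]_z f z)%E.
  rewrite integralE [RHS]integralE; congr (_ - _)%E.
    etransitivity; last by apply: push => //; exact: measurable_funepos.
    by apply: eq_integral => w _; rewrite !funeposE.
  etransitivity; last by apply: push => //; exact: measurable_funeneg.
  by apply: eq_integral => w _; rewrite !funenegE.
rewrite -integral12_prod_meas1//.
have IX : m1.-integrable setT EFin.
  by apply: integrable_pushforward => //; exact: measurable_EFin.
have IY : m2.-integrable setT EFin.
  by apply: integrable_pushforward => //; exact: measurable_EFin.
have finY : (\int[m2]_y y%:E)%E \is a fin_num by exact: integrable_fin_num.
have finX : (\int[m1]_y y%:E)%E \is a fin_num by exact: integrable_fin_num.
have inner x : (\int[m2]_y f (x, y) = x%:E * (fine (\int[m2]_y y%:E))%:E)%E.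
  by rewrite fineK// -(integralZl measurableT IY).
rewrite (eq_integral (fun x : R => (x%:E * (fine (\int[m2]_y y%:E))%:E)%E)); last first.
  by move=> x _; exact: inner.
rewrite (integralZr measurableT IX) fineK// fineM//; congr (_ * _).
- by rewrite integral_pushforward//; exact: measurable_EFin.
- by rewrite integral_pushforward//; exact: measurable_EFin.
Qed.

End Expectation.

(** * Gaussian moments from the exponential moment *)

Section GaussianMoments.
Context {R : realType}.

(** The Gaussian density and the Radon-Nikodym derivative have the same integral over every
    measurable set, so they agree almost everywhere and the change of variables for the latter
    applies. *)
Lemma ge0_integral_normal (sigma : R) (f : R -> \bar R) :
  measurable_fun setT f -> (forall x, 0 <= f x)%E ->
  (\int[normal_prob 0 sigma]_x f x =
   \int[lebesgue_measure]_x (f x * (normal_pdf 0 sigma x)%:E))%E.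
Proof.
move=> mf f0.
have dom : normal_prob 0 sigma `<< (@lebesgue_measure R) by exact: normal_prob_dominates.
rewrite -(Radon_Nikodym_SigmaFinite.change_of_variables dom f0 measurableT mf).
apply: ae_eq_integral => //.
- apply: emeasurable_funM => //.
  exact: measurable_int (Radon_Nikodym_SigmaFinite.f_integrable dom).
- apply: emeasurable_funM => //.
  by apply/measurable_EFinP; exact: measurable_normal_pdf.
suff : ae_eq lebesgue_measure setT (Radon_Nikodym_SigmaFinite.f (normal_prob 0 sigma) lebesgue_measure)
    (fun x => (normal_pdf 0 sigma x)%:E).
  by apply: filterS => x h /h /= ->.
apply: integral_ae_eq => //.
- exact: Radon_Nikodym_SigmaFinite.f_integrable dom.
- by apply/measurable_EFinP; exact: measurable_normal_pdf.
- by move=> E _ mE; rewrite -(Radon_Nikodym_SigmaFinite.f_integral dom).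
Qed.

(** Completing the square turns the integrand into a multiple of the density with mean lam
    sigma^2. *)
Lemma normal_mgf (sigma lam : R) : 0 < sigma ->
  (\int[normal_prob 0 sigma]_x (expR (lam * x))%:E =
   (expR (lam ^+ 2 * sigma ^+ 2 / 2))%:E)%E.
Proof.
move=> s0; have sn0 : sigma != 0 by rewrite gt_eqF.
have mexp : measurable_fun setT (fun x : R => expR (lam * x)).
  by apply: measurableT_comp => //; exact: measurable_funM.
rewrite ge0_integral_normal; last 2 first.
- exact/measurable_EFinP.
- by move=> x; rewrite lee_fin expR_ge0.
have E (x : R) : expR (lam * x) * normal_pdf 0 sigma x =
    expR (lam ^+ 2 * sigma ^+ 2 / 2) * normal_pdf (lam * sigma ^+ 2) sigma x.
  rewrite /normal_pdf (negbTE sn0) /normal_fun mulrCA [RHS]mulrCA; congr (_ * _).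
  by rewrite -!expRD; congr expR; field.
under eq_integral do rewrite -EFinM E EFinM.
rewrite ge0_integralZl//.
- by rewrite integral_normal_pdf mule1.
- by apply/measurable_EFinP; exact: measurable_normal_pdf.
- by move=> x _; rewrite lee_fin normal_pdf_ge0.
Qed.

(** Between 0 and x the second derivative lies between [expR (- |x|)] and [expR |x|]; both differ
    from 1 by at most |x| [expR |x|]. *)
Lemma expR_taylor2 (x : R) : `|expR x - 1 - x - x ^+ 2 / 2| <= `|x| ^+ 3 * expR `|x|.
Proof.
have dexp (t : R) : is_derive t 1 (@expR R) (expR t) by exact: is_derive_expR.
have e1 (t : R) : - `|x| <= t -> expR (- `|x|) <= expR t by rewrite ler_expR.
have dexpN (t : R) : is_derive t 1 (fun y : R => - expR y) (- expR t).
  by apply: is_deriveN.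
have lo := @taylor2_lower R expR expR expR 0 x (expR (- `|x|))
  (fun t _ => dexp t) (fun t _ => dexp t).
have hi := @taylor2_lower R (fun y => - expR y) (fun y => - expR y)
  (fun y => - expR y) 0 x (- expR `|x|) (fun t _ => dexpN t) (fun t _ => dexpN t).
have xle := ler_norm x; have xge : - x <= `|x| by rewrite -normrN ler_norm.
have a0 : 0 <= `|x| by [].
have {}lo : expR 0 + expR 0 * (x - 0) + expR (- `|x|) / 2 * (x - 0) ^+ 2 <= expR x.
  by apply: lo => t tI; rewrite ler_expR; lra.
have {}hi : - expR 0 + - expR 0 * (x - 0) + - expR `|x| / 2 * (x - 0) ^+ 2 <= - expR x.
  by apply: hi => t tI; rewrite lerN2 ler_expR; lra.
move: lo hi; rewrite subr0 expR0 !mul1r.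
have x2 : x ^+ 2 = `|x| ^+ 2 by rewrite real_normK ?num_real.
rewrite x2; move: a0; set a := `|x| => a0.
have em := @expR_ge1Dx R (- a); have ep := @expR_ge1Dx R a.
have epm : expR a * expR (- a) = 1 by rewrite expRN mulfV// gt_eqF ?expR_gt0.
have e0 := expR_gt0 a.
have h : expR a - 1 <= a * expR a by nra.
have a2 : 0 <= a ^+ 2 by rewrite sqr_ge0.
have h2 : a ^+ 2 * (expR a - 1) <= a ^+ 2 * (a * expR a) by rewrite ler_wpM2l.
have h3 : a ^+ 2 * (1 - expR (- a)) <= a ^+ 2 * (a * expR a).
  by rewrite ler_wpM2l//; nra.
have h4 : 0 <= a ^+ 2 * (a * expR a) by rewrite mulr_ge0// mulr_ge0// ltW.
have -> : a ^+ 3 * expR a = a ^+ 2 * (a * expR a) by rewrite exprSr mulrA.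
move=> lo hi.
by rewrite ler_norml; apply/andP; split; lra.
Qed.

Lemma pow4_le_exp (x : R) : x ^+ 4 <= 256 * (expR x + expR (- x)).
Proof.
have -> : x ^+ 4 = `|x| ^+ 4 by rewrite -normrX ger0_norm// exprn_even_ge0.
apply: (@le_trans _ _ (256 * expR `|x|)); last first.
  apply: ler_wpM2l; first exact: ler0n.
  have := expR_gt0 x; have := expR_gt0 (- x).
  by have [x0|x0] := leP 0 x; [rewrite ger0_norm//|rewrite ltr0_norm//]; lra.
have -> : expR `|x| = expR (`|x| / 4) ^+ 4.
  by rewrite -expRM_natl; congr expR; field.
have -> : 256 * expR (`|x| / 4) ^+ 4 = (4 * expR (`|x| / 4)) ^+ 4 by rewrite exprMn; congr (_ * _); ring.
apply: lerXn2r; rewrite ?nnegrE ?mulr_ge0 ?expR_ge0//.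
by have := @expR_ge1Dx R (`|x| / 4); lra.
Qed.

Lemma le_small_eq0 (a K : R) : (forall l, 0 < l -> l <= 1 -> `|a| <= l * K) -> a = 0.
Proof.
move=> h; apply/eqP/contraT => an0; have a0 : 0 < `|a| by rewrite normr_gt0.
have K0 : 0 < K.
  by have := h 1 ltr01 (lexx 1); rewrite mul1r; apply: lt_le_trans.
have l0 : 0 < Num.min 1 (`|a| / (2 * K)) by rewrite lt_min ltr01 divr_gt0// mulr_gt0.
have := h _ l0; rewrite ge_min lexx => /(_ isT).
have : Num.min 1 (`|a| / (2 * K)) * K <= `|a| / (2 * K) * K.
  by rewrite ler_wpM2r ?ge_min ?lexx ?orbT// ltW.
have -> : `|a| / (2 * K) * K = `|a| / 2 by field; rewrite gt_eqF.
lra.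
Qed.

End GaussianMoments.

Section GaussianRV.
Context {R : realType} {d : measure_display} {Omega : measurableType d}.
Variable P : probability Omega R.
Variables (X : Omega -> R) (sigma : R).
Hypotheses (mX : measurable_fun setT X) (s0 : 0 < sigma)
  (lawX : forall U, measurable U -> P (X @^-1` U) = normal_prob 0 sigma U).
Local Notation L1 := (rvL1 P).
Local Notation E := (rvE P).

Lemma gauss_mgf (lam : R) : L1 (fun w => expR (lam * X w)) /\
  E (fun w => expR (lam * X w)) = expR (lam ^+ 2 * sigma ^+ 2 / 2).
Proof.
have mexp : measurable_fun setT (fun x : R => expR (lam * x)).
  by apply: measurableT_comp => //; exact: measurable_funM.
have I : (\int[P]_w (expR (lam * X w))%:E = (expR (lam ^+ 2 * sigma ^+ 2 / 2))%:E)%E.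
  rewrite -normal_mgf//.
  have mX' : measurable_fun setT (X : Omega -> measurableTypeR R) by exact: mX.
  have := @ge0_integral_pushforward _ _ _ _ R _ mX' P setT (fun x : R => (expR (lam * x))%:E) measurableT.
  rewrite preimage_setT => <-.
  - by apply: eq_measure_integral => A mA _; exact: lawX.
  - exact/measurable_EFinP.
  - by move=> x _; rewrite lee_fin expR_ge0.
split; last by rewrite /rvE /Rintegral I.
apply/integrableP; split.
  by apply/measurable_EFinP; exact: (measurableT_comp mexp mX).
by under eq_integral do rewrite /= ger0_norm ?expR_ge0//; rewrite I ltry.
Qed.

Let L1exp lam := (gauss_mgf lam).1.
Let Eexp lam := (gauss_mgf lam).2.

Lemma gauss_pow4 : L1 (fun w => X w ^+ 4) /\ E (fun w => X w ^+ 4) <= 1024 * sigma ^+ 4.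
Proof.
(* Rescaling X by sigma makes the bound homogeneous of degree 4. The two exponentials have mean
   e^(1/2), at most 2, whence 1024 = 256 * 2 * 2. *)
pose W w := (256 * sigma ^+ 4) * (expR (sigma^-1 * X w) + expR (- sigma^-1 * X w)).
have XW w : X w ^+ 4 <= W w.
  rewrite /W; have := pow4_le_exp (sigma^-1 * X w).
  rewrite exprMn exprVn mulNr => h.
  have s4 : 0 < sigma ^+ 4 by rewrite exprn_gt0.
  have -> : X w ^+ 4 = sigma ^+ 4 * (sigma ^- 4 * X w ^+ 4).
    by rewrite mulrA mulfV ?mul1r// gt_eqF.
  rewrite [X in _ <= X * _]mulrC -[leRHS]mulrA.
  by apply: ler_wpM2l => //; exact: ltW.
have LW : L1 W.
  by apply: rvL1Z; apply: rvL1D; exact: L1exp.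
have m4 : measurable_fun setT (fun w => X w ^+ 4) by exact: measurable_funX.
have L4 : L1 (fun w => X w ^+ 4).
  by apply: (rvL1_le m4 _ LW) => w; rewrite ger0_norm ?exprn_even_ge0.
split => //; apply: le_trans (rvE_le L4 LW XW) _.
rewrite /W rvEZ; last by apply: rvL1D; exact: L1exp.
rewrite rvED; [|exact: L1exp|exact: L1exp].
rewrite !Eexp sqrrN exprVn mulVf ?gt_eqF ?exprn_gt0// mul1r.
have e2 : expR (2^-1) <= 2 :> R.
  have := @expR_ge1Dx R (- 2^-1); rewrite expRN => h.
  have e0 := @expR_gt0 R 2^-1.
  have : expR 2^-1 * (1 + - 2^-1) <= expR 2^-1 * (expR (2^-1 : R))^-1 by rewrite ler_pM2l.
  by rewrite mulfV ?gt_eqF//; lra.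
have s4 : 0 < sigma ^+ 4 by rewrite exprn_gt0.
by have := ler_pM2l s4 (expR 2^-1) 2; nra.
Qed.

Lemma gauss_pow2 : L1 (fun w => X w ^+ 2).
Proof.
apply: (@rvL1_le _ _ _ _ _ (fun w => 1 + X w ^+ 4)).
- exact: measurable_funX.
- move=> w; rewrite ger0_norm ?sqr_ge0//.
  have -> : X w ^+ 4 = (X w ^+ 2) ^+ 2 by rewrite -exprM.
  by have := sqr_ge0 (X w ^+ 2 - 1); nra.
- by apply: rvL1D; [exact: rvL1_cst|exact: gauss_pow4.1].
Qed.

Lemma gauss_pow1 : L1 X.
Proof.
apply: (@rvL1_le _ _ _ _ _ (fun w => 1 + X w ^+ 2)) => //.
- by move=> w; rewrite ler_norml; apply/andP; split; nra.
- by apply: rvL1D; [exact: rvL1_cst|exact: gauss_pow2].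
Qed.

(** An integrable majorant of |X|^3 exp |X|, the random factor of the third order remainder. *)
Let W w := 600 * (expR (2 * X w) + expR (- 2 * X w)) + 600.

Let LW : L1 W.
Proof.
apply: rvL1D; last exact: rvL1_cst.
by apply: rvL1Z; apply: rvL1D; exact: L1exp.
Qed.

(** Taylor's formula under the expectation. Mean and variance are the coefficients of l and l^2 / 2,
    and letting l tend to 0 identifies them with those of the known generating function. *)
Let mgf_expand (l : R) : `|l| <= 1 ->
  `|expR (l ^+ 2 * sigma ^+ 2 / 2) - 1 - l * E X - l ^+ 2 / 2 * E (fun w => X w ^+ 2)|
   <= `|l| ^+ 3 * E W.
Proof.
move=> l1.
have L2 := gauss_pow2; have L1X := gauss_pow1.
rewrite -Eexp -(rvEZ l L1X) -(rvEZ (l ^+ 2 / 2) L2) -[X in _ - X - _ - _](rvE_cst P 1).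
have LA : L1 (fun w => expR (l * X w) - cst 1 w).
  by apply: rvL1B; [exact: L1exp|exact: rvL1_cst].
have LB : L1 (fun w => expR (l * X w) - cst 1 w - l * X w).
  by apply: rvL1B => //; exact: rvL1Z.
rewrite -rvEB; [|exact: L1exp|exact: rvL1_cst].
rewrite -rvEB//; last exact: rvL1Z.
rewrite -rvEB//; last exact: rvL1Z.
rewrite -(rvEZ _ LW).
have LC : L1 (fun w => expR (l * X w) - cst 1 w - l * X w - l ^+ 2 / 2 * X w ^+ 2).
  by apply: rvL1B => //; exact: rvL1Z.
apply: le_trans (rvE_norm LC) _.
apply: rvE_le; [exact: (integrable_norm LC)|exact: rvL1Z|] => w /=.
have -> : l ^+ 2 / 2 * X w ^+ 2 = (l * X w) ^+ 2 / 2 by rewrite exprMn; ring.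
apply: le_trans (expR_taylor2 _) _.
rewrite normrM exprMn -mulrA; apply: ler_wpM2l; first by rewrite exprn_ge0.
set a := `|X w|; have a0 : 0 <= a by rewrite /a.
have ee : expR (`|l| * a) <= expR a by rewrite ler_expR ler_piMl.
have e1 : expR a <= expR (X w) + expR (- X w).
  have := expR_gt0 (X w); have := expR_gt0 (- X w).
  by rewrite /a; have [x0|x0] := leP 0 (X w); [rewrite ger0_norm//|rewrite ltr0_norm//]; lra.
set p := expR (X w) in e1; set m := expR (- X w) in e1.
have p0 : 0 < p by exact: expR_gt0.
have m0 : 0 < m by exact: expR_gt0.
have a3 : a ^+ 3 <= 1 + 256 * (p + m).
  have h4 : a ^+ 4 <= 256 * (p + m).
    have -> : a ^+ 4 = X w ^+ 4 by rewrite /a -normrX ger0_norm// exprn_even_ge0.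
    exact: pow4_le_exp.
  have [a1|a1] := leP a 1.
    have : a ^+ 3 <= 1 by rewrite exprn_ile1.
    by lra.
  have : a ^+ 3 <= a ^+ 4 by apply: ler_weXn2l => //; exact: ltW.
  by lra.
have pp : expR (2 * X w) = p ^+ 2 by rewrite /p -expRM_natl.
have mm : expR (- 2 * X w) = m ^+ 2 by rewrite /m -expRM_natl mulNr mulrN.
rewrite /W pp mm.
apply: (@le_trans _ _ ((1 + 256 * (p + m)) * (p + m))).
  by apply: ler_pM => //; [rewrite exprn_ge0|exact: le_trans e1].
have := sqr_ge0 (p - m); have := sqr_ge0 (p - 1); have := sqr_ge0 (m - 1).
nra.
Qed.

(** The expansions at l and at -l differ only in the sign of the linear term, so subtracting them
    bounds [l * E X] by l^3 E W. *)
Lemma gauss_mean : E X = 0.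
Proof.
apply: (@le_small_eq0 _ _ (E W)) => l l0 l1.
have hp := mgf_expand (l := l); have hm := mgf_expand (l := - l).
move: hp hm; rewrite normrN sqrrN gtr0_norm// => /(_ l1) + /(_ l1).
set e := expR _; set v := E (fun w => X w ^+ 2); set m := E X; set K := E W.
rewrite !ler_norml => /andP[h1 h2] /andP[h3 h4].
have K0 : 0 <= K.
  apply: rvE_ge0 => w; apply: addr_ge0; last exact: ler0n.
  by apply: mulr_ge0; [exact: ler0n|rewrite addr_ge0 ?expR_ge0].
have h5 : l * m <= l ^+ 3 * K by lra.
have h6 : - (l ^+ 3 * K) <= l * m by lra.
have l2 : l ^+ 2 <= l by rewrite expr2 ler_piMl// ltW.
have {}h5 : m <= l ^+ 2 * K by rewrite -(ler_pM2l l0) mulrA -exprS.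
have {}h6 : - (l ^+ 2 * K) <= m by rewrite -(ler_pM2l l0) mulrN mulrA -exprS.
have h7 : l ^+ 2 * K <= l * K by rewrite ler_wpM2r.
by apply/andP; split; lra.
Qed.

Lemma gauss_var : E (fun w => X w ^+ 2) = sigma ^+ 2.
Proof.
apply/eqP; rewrite -subr_eq0; apply/eqP.
have K0 : 0 <= E W.
  apply: rvE_ge0 => w; apply: addr_ge0; last exact: ler0n.
  by apply: mulr_ge0; [exact: ler0n|rewrite addr_ge0 ?expR_ge0].
apply: (@le_small_eq0 _ _ (2 * E W + 2 * (sigma ^+ 6 * expR (sigma ^+ 2) + sigma ^+ 4))) => l l0 l1.
have := mgf_expand (l := l); rewrite gauss_mean mulr0 subr0 gtr0_norm// => /(_ l1).
set v := E (fun w => X w ^+ 2); set K := E W in K0 *; set h := _ / 2.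
have h0 : 0 <= h by rewrite /h divr_ge0// mulr_ge0 ?sqr_ge0.
have := expR_taylor2 h; rewrite (ger0_norm h0).
rewrite !ler_norml => /andP[h1 h2] /andP[h3 h4].
have l2 : l ^+ 2 <= l by rewrite expr2 ler_piMl// ltW.
have s2 : 0 <= sigma ^+ 2 by rewrite sqr_ge0.
have hs : h <= sigma ^+ 2.
  rewrite /h; have : l ^+ 2 * sigma ^+ 2 <= 1 * sigma ^+ 2 by rewrite ler_wpM2r//; lra.
  by lra.
have eh : expR h <= expR (sigma ^+ 2) by rewrite ler_expR.
have hl : h = l ^+ 2 * (sigma ^+ 2 / 2) by rewrite /h; ring.
have l20 : 0 < l ^+ 2 by rewrite exprn_gt0.
have E3 : h ^+ 3 * expR h <= l ^+ 2 * (l * (sigma ^+ 6 * expR (sigma ^+ 2))).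
  rewrite (mulrA l) (mulrA (l ^+ 2)); apply: ler_pM => //; [by rewrite exprn_ge0|].
  rewrite hl exprMn -exprM.
  have -> : (sigma ^+ 2 / 2) ^+ 3 = sigma ^+ 6 / 8 by rewrite expr_div_n -exprM; congr (_ / _); ring.
  have s6 : 0 <= sigma ^+ 6 by rewrite exprn_even_ge0.
  have l6 : l ^+ (2 * 3) <= l ^+ 3 by apply: ler_wiXn2l => //; exact: ltW.
  have : l ^+ (2 * 3) * (sigma ^+ 6 / 8) <= l ^+ 3 * (sigma ^+ 6 / 8) by rewrite ler_wpM2r// divr_ge0.
  have : 0 <= l ^+ 3 * sigma ^+ 6 by rewrite mulr_ge0// exprn_ge0// ltW.
  have -> : l ^+ 2 * (l * sigma ^+ 6) = l ^+ 3 * sigma ^+ 6 by ring.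
  by lra.
have E2 : h ^+ 2 <= l ^+ 2 * (l * sigma ^+ 4).
  rewrite hl exprMn -exprM.
  have -> : (sigma ^+ 2 / 2) ^+ 2 = sigma ^+ 4 / 4 by rewrite expr_div_n -exprM; congr (_ / _); ring.
  have s4 : 0 <= sigma ^+ 4 by rewrite exprn_even_ge0.
  have l4 : l ^+ (2 * 2) <= l ^+ 3 by apply: ler_wiXn2l => //; exact: ltW.
  have : l ^+ (2 * 2) * (sigma ^+ 4 / 4) <= l ^+ 3 * (sigma ^+ 4 / 4) by rewrite ler_wpM2r// divr_ge0.
  have : 0 <= l ^+ 3 * sigma ^+ 4 by rewrite mulr_ge0// exprn_ge0// ltW.
  have -> : l ^+ 2 * (l * sigma ^+ 4) = l ^+ 3 * sigma ^+ 4 by ring.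
  by lra.
have E1 : l ^+ 3 * K = l ^+ 2 * (l * K) by ring.
have h20 : 0 <= h ^+ 2 by rewrite sqr_ge0.
rewrite -(ler_pM2l l20) -[X in _ && X](ler_pM2l l20).
set A := sigma ^+ 6 * _ in E3 *; set B := sigma ^+ 4 in E2 *.
have -> : l ^+ 2 * - (l * (2 * K + 2 * (A + B))) = - (2 * (l ^+ 2 * (l * K)) + 2 * (l ^+ 2 * (l * A)) + 2 * (l ^+ 2 * (l * B))) by ring.
have -> : l ^+ 2 * (l * (2 * K + 2 * (A + B))) = 2 * (l ^+ 2 * (l * K)) + 2 * (l ^+ 2 * (l * A)) + 2 * (l ^+ 2 * (l * B)) by ring.
have -> : l ^+ 2 * (v - sigma ^+ 2) = l ^+ 2 * v - 2 * h by rewrite hl; field.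
rewrite E1 in h1 h2 h3 h4 *.
by apply/andP; split; lra.
Qed.

End GaussianRV.

(** * The augmented filtration and Brownian increments *)

Section BrownianFiltration.
Context {R : realType} {dO : measure_display} {Omega : measurableType dO}.
Context {d : nat}.
Variables (P : probability Omega R) (T : R) (B : Omega -> R -> 'rV[R]_d).
Hypotheses (Pcomplete : measure_is_complete P) (hB : is_brownian_motion P T B).
Local Notation Filt t := (filtration_gen P B t).

Lemma sub_filtration (s t : R) : s <= t -> <<s Filt s >> `<=` <<s Filt t >>.
Proof.
move=> st; apply: smallest_sub; first exact: smallest_sigma_algebra.
move=> A hA; apply: sub_gen_smallest; case: hA => [[r /= rs rA]|nA]; [left|by right].
exists r => //=; move: rs; rewrite /= !in_itv/= => /andP[-> rs].
exact: le_trans st.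
Qed.

Lemma adapted_le (s t : R) (f : Omega -> R) : s <= t ->
  adapted_at P B s f -> adapted_at P B t f.
Proof.
move=> st hf _ A mA; apply: (sub_filtration st).
exact: (hf measurableT A mA).
Qed.

Lemma past_measurable (t : R) : t <= T -> <<s past_gen B t >> `<=` measurable.
Proof.
move=> tT; apply: smallest_sub; first exact: sigma_algebra_measurable.
move=> A [r /= rt [i _]] [C mC <-]; apply: (bm_measurable hB) => //.
by move: rt; rewrite in_itv/= => /andP[-> rt]; exact: le_trans tT.
Qed.

Lemma filtration_measurable (t : R) : t <= T -> <<s Filt t >> `<=` measurable.
Proof.
move=> tT; apply: smallest_sub; first exact: sigma_algebra_measurable.
move=> A [pA|]; last exact: Pcomplete.
by apply: (past_measurable tT); exact: sub_gen_smallest.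
Qed.

Lemma adapted_measurable (t : R) (f : Omega -> R) : t <= T ->
  adapted_at P B t f -> measurable_fun setT f.
Proof.
by move=> tT hf _ A mA; apply: (filtration_measurable tT); exact: (hf measurableT A mA).
Qed.

(** The sets with such an approximation form a sigma-algebra that contains both the past and the
    negligible sets. Independence of increments, given for the raw past, is carried over to the
    augmented filtration this way. *)
Lemma filtration_past_approx (t : R) (A : set Omega) : <<s Filt t >> A ->
  exists2 A', <<s past_gen B t >> A' & P.-negligible ((A `\` A') `|` (A' `\` A)).
Proof.
have [sg0 sgC sgU] := smallest_sigma_algebra setT (past_gen B t).
move: A; apply: smallest_sub; last first.
  move=> A [pA|nA].
    exists A; first exact: sub_gen_smallest.
    by rewrite setDv setU0; exact: negligible_set0.
  exists set0; first exact: sg0.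
  by rewrite setD0 set0D setU0.
split.
- exists set0; first exact: sg0.
  by rewrite setDv setU0; exact: negligible_set0.
- move=> A [A' pA' nA]; exists (setT `\` A').
    exact: sgC.
  apply: negligibleS nA => w /=.
  by have [?|?] := pselect (A w); have [?|?] := pselect (A' w); tauto.
- move=> F hF; have /choice[F' hF'] : forall n, exists A', <<s past_gen B t >> A' /\
      P.-negligible ((F n `\` A') `|` (A' `\` F n)).
    by move=> n; have [A' h1 h2] := hF n; exists A'.
  exists (\bigcup_n F' n).
    apply: sgU => n.
    exact: (hF' n).1.
  have : P.-negligible (\bigcup_n ((F n `\` F' n) `|` (F' n `\` F n))).
    by apply: negligible_bigcup => n; exact: (hF' n).2.
  apply: negligibleS => w [[[n _ Fn] h]|[[n _ Fn] h]].
  - by exists n => //; left; split => // h'; apply: h; exists n.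
  - by exists n => //; right; split => // h'; apply: h; exists n.
Qed.

Lemma measure_symdiff_negligible (A A' : set Omega) : measurable A -> measurable A' ->
  P.-negligible ((A `\` A') `|` (A' `\` A)) -> P A = P A'.
Proof.
have key (C C' : set Omega) : measurable C -> measurable C' -> P.-negligible (C `\` C') ->
    (P C <= P C')%E.
  move=> mC mC' n; have mD := measurableD mC mC'.
  apply: (@le_trans _ _ (P (C' `|` (C `\` C')))).
    apply: le_measure; rewrite ?inE//; first exact: measurableU.
    by move=> w Cw; have [?|?] := pselect (C' w); [left|right].
  apply: le_trans (measureU2 _ _ _) _ => //.
  by rewrite (measure_negligible mD n) adde0.
move=> mA mA' n; apply/eqP; rewrite eq_le; apply/andP; split; apply: key => //.
- by apply: negligibleS n => w; left.
- by apply: negligibleS n => w; right.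
Qed.

Lemma increment_measurable (s t : R) : 0 <= s -> s <= t -> t <= T ->
  <<s increment_gen B s t >> `<=` measurable.
Proof.
move=> s0 st tT; apply: smallest_sub; first exact: sigma_algebra_measurable.
move=> A [i _] [C mC <-]; rewrite setTI.
have m1 : measurable_fun setT (fun w => (B w t - B w s) 0 i).
  rewrite (_ : (fun _ => _) = (fun w => B w t 0 i - B w s 0 i)); last first.
    by apply/funext => w; rewrite !mxE.
  apply: measurable_funB; apply: (bm_measurable hB).
    by rewrite (le_trans s0 st).
  by rewrite s0 (le_trans st tT).
by rewrite -[X in measurable X]setTI; exact: m1.
Qed.

Lemma filtration_indep_increment (s t : R) (A C : set Omega) : 0 <= s -> s < t -> t <= T ->
  <<s Filt s >> A -> <<s increment_gen B s t >> C -> P (A `&` C) = (P A * P C)%E.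
Proof.
move=> s0 st tT hA hC.
have sT : s <= T by apply: le_trans tT; exact: ltW.
have [A' pA' n] := filtration_past_approx hA.
have mA := filtration_measurable sT hA; have mA' := past_measurable sT pA'.
have mC := increment_measurable s0 (ltW st) tT hC.
rewrite (measure_symdiff_negligible mA mA' n) -(bm_independent hB s0 st tT pA' hC).
apply: measure_symdiff_negligible; [exact: measurableI|exact: measurableI|].
by apply: negligibleS n => w /=; tauto.
Qed.

Section Increment.
Variables (s t : R).
Hypotheses (s0 : 0 <= s) (st : s < t) (tT : t <= T).
Let D (i : 'I_d) (w : Omega) : R := (B w t - B w s) 0 i.

Lemma increment_rv_indep (X Y : Omega -> R) : adapted_at P B s X ->
  measurable_fun setT (Y : g_sigma_algebraType (increment_gen B s t) -> R) ->
  rv_indep P X Y.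
Proof.
move=> aX aY A C mA mC; apply: (filtration_indep_increment s0 st tT).
- by have := aX measurableT A mA; rewrite setTI.
- by have := aY measurableT C mC; rewrite setTI.
Qed.

Lemma increment_gen_measurable i :
  measurable_fun setT (D i : g_sigma_algebraType (increment_gen B s t) -> R).
Proof.
by move=> _ A mA; apply: sub_gen_smallest; exists i => //; exists A.
Qed.

Lemma increment_rv_measurable i : measurable_fun setT (D i).
Proof.
move=> _ A mA; apply: (increment_measurable s0 (ltW st) tT).
exact: (increment_gen_measurable i measurableT mA).
Qed.

Let sg : R := Num.sqrt (t - s).

Let sg0 : 0 < sg. Proof. by rewrite sqrtr_gt0 subr_gt0. Qed.

Lemma increment_law i U : measurable U -> P (D i @^-1` U) = normal_prob 0 sg U.
Proof.
move=> mU; pose V j := if j == i then U else setT.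
have := bm_gaussian hB (U := V) s0 st tT; rewrite -/sg.
have -> : [set w | forall j, V j ((B w t - B w s) 0 j)] = D i @^-1` U.
  apply/seteqP; split => w /=; first by move=> /(_ i); rewrite /V eqxx.
  by move=> h j; rewrite /V; case: eqP => // ->.
move=> ->; last by move=> j; rewrite /V; case: eqP.
rewrite (bigD1 i)//= big1; last first.
  move=> j ji; rewrite /V (negbTE ji).
  by rewrite (_ : normal_prob 0 sg setT = 1%E) ?probability_setT.
rewrite mulr1 /V eqxx fineK//.
by apply: (fin_num_measure (normal_prob 0 sg)).
Qed.

Lemma increment_cross_indep i l : i != l -> rv_indep P (D i) (D l).
Proof.
move=> il A C mA mC; pose V j := if j == i then A else if j == l then C else setT.
have := bm_gaussian hB (U := V) s0 st tT; rewrite -/sg.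
have -> : [set w | forall j, V j ((B w t - B w s) 0 j)] = D i @^-1` A `&` D l @^-1` C.
  apply/seteqP; split => w /=.
    move=> h; split; first by have := h i; rewrite /V eqxx.
    by have := h l; rewrite /V eq_sym (negbTE il) eqxx.
  by move=> [hi hl] j; rewrite /V; case: eqP => [->//|_]; case: eqP => [->//|].
move=> ->; last by move=> j; rewrite /V; case: eqP => // _; case: eqP.
rewrite (bigD1 i)//= (bigD1 l)/=; last by rewrite eq_sym.
rewrite big1; last first.
  move=> j /andP[ji jl]; rewrite /V (negbTE ji) (negbTE jl).
  by rewrite (_ : normal_prob 0 sg setT = 1%E) ?probability_setT.
rewrite mulr1 /V eqxx eq_sym (negbTE il) eqxx !increment_law// EFinM !fineK//.
- by apply: (fin_num_measure (normal_prob 0 sg)).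
- by apply: (fin_num_measure (normal_prob 0 sg)).
Qed.

Local Notation L1 := (rvL1 P).
Local Notation E := (rvE P).

Let mD := increment_rv_measurable.
Let sg2 : sg ^+ 2 = t - s. Proof. by rewrite sqr_sqrtr// subr_ge0 ltW. Qed.

Lemma increment_L1 i : L1 (D i).
Proof. exact: gauss_pow1 (mD i) sg0 (fun U mU => increment_law i mU). Qed.

Lemma increment_prod_L1 i l : L1 (fun w => D i w * D l w).
Proof.
have [->|il] := eqVneq i l.
  rewrite (_ : (fun _ => _) = (fun w => D l w ^+ 2)); last by apply/funext => w; rewrite expr2.
  exact: gauss_pow2 (mD l) sg0 (fun U mU => increment_law l mU).
by have [] := rvE_indepM (increment_cross_indep il) (increment_L1 i) (increment_L1 l).
Qed.

Lemma increment_mean i : E (D i) = 0.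
Proof. exact: gauss_mean (mD i) sg0 (fun U mU => increment_law i mU). Qed.

Lemma increment_cov i l : E (fun w => D i w * D l w) = (i == l)%:R * (t - s).
Proof.
have [->|il] := eqVneq i l.
  rewrite (_ : (fun _ => _) = (fun w => D l w ^+ 2)); last by apply/funext => w; rewrite expr2.
  by rewrite (gauss_var (mD l) sg0 (fun U mU => increment_law l mU)) sg2 mul1r.
have [_ ->] := rvE_indepM (increment_cross_indep il) (increment_L1 i) (increment_L1 l).
by rewrite increment_mean !mul0r.
Qed.

Lemma increment_pow4 i : L1 (fun w => D i w ^+ 4) /\
  E (fun w => D i w ^+ 4) <= 1024 * (t - s) ^+ 2.
Proof.
have [h1 h2] := gauss_pow4 (mD i) sg0 (fun U mU => increment_law i mU).
by split => //; move: h2; rewrite (_ : sg ^+ 4 = (t - s) ^+ 2)// -sg2 -exprM.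
Qed.

Variables (a : Omega -> R) (c : Omega -> 'rV[R]_d) (Ca Cc : R).
Hypotheses (aa : adapted_at P B s a) (ac : forall i, adapted_at P B s (fun w => c w 0 i))
  (aC : forall w, `|a w| <= Ca) (cC : forall w i, `|c w 0 i| <= Cc).
Let z w := dotrv (c w) (B w t - B w s).

Let ma : measurable_fun setT a.
Proof. by apply: adapted_measurable aa; apply: le_trans tT; exact: ltW. Qed.

Let mc i : measurable_fun setT (fun w => c w 0 i).
Proof. by apply: adapted_measurable (ac i); apply: le_trans tT; exact: ltW. Qed.

Lemma increment_adapted_mul (X Y : Omega -> R) (C : R) : adapted_at P B s X ->
  (forall w, `|X w| <= C) ->
  measurable_fun setT (Y : g_sigma_algebraType (increment_gen B s t) -> R) ->
  L1 Y -> L1 (fun w => X w * Y w) /\ E (fun w => X w * Y w) = E X * E Y.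
Proof.
move=> aX XC aY LY; apply: rvE_indepM => //; first exact: increment_rv_indep.
apply: (rvL1_bounded P _ XC); apply: adapted_measurable aX.
by apply: le_trans tT; exact: ltW.
Qed.

Lemma increment_mart1 : L1 (fun w => a w * z w) /\ E (fun w => a w * z w) = 0.
Proof.
have term i : L1 (fun w => (a w * c w 0 i) * D i w) /\
    E (fun w => (a w * c w 0 i) * D i w) = 0.
  have [] := @increment_adapted_mul (fun w => a w * c w 0 i) (D i) (Ca * Cc).
  - by apply: measurable_funM; [exact: aa|exact: ac].
  - by move=> w; rewrite normrM ler_pM.
  - exact: increment_gen_measurable.
  - exact: increment_L1.
  - by rewrite increment_mean mulr0.
have -> : (fun w => a w * z w) = (fun w => \sum_(i < d) (a w * c w 0 i) * D i w).
  by apply/funext => w; rewrite /z /dotrv mulr_sumr; apply: eq_bigr => i _; rewrite mulrA.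
split; first by apply: rvL1_sum => i; exact: (term i).1.
by rewrite rvE_sum => [|i]; [rewrite big1// => i _; exact: (term i).2|exact: (term i).1].
Qed.

(** Expanded over pairs of coordinates, each summand is a bounded variable known at time s times the
    centred product D_i D_l minus its mean, which is independent of it. *)
Lemma increment_mart2 : L1 (fun w => a w * (z w ^+ 2 - enorm (c w) ^+ 2 * (t - s))) /\
  E (fun w => a w * (z w ^+ 2 - enorm (c w) ^+ 2 * (t - s))) = 0.
Proof.
have aac i l : adapted_at P B s (fun w => a w * c w 0 i * c w 0 l).
  by apply: measurable_funM; [apply: measurable_funM; [exact: aa|exact: ac]|exact: ac].
have bac i l w : `|a w * c w 0 i * c w 0 l| <= Ca * Cc * Cc.
  by rewrite !normrM !ler_pM// mulr_ge0.
have Lac i l : L1 (fun w => a w * c w 0 i * c w 0 l).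
  apply: (rvL1_bounded P _ (bac i l)).
  by apply: measurable_funM => //; exact: measurable_funM.
have term i l : L1 (fun w => (a w * c w 0 i * c w 0 l) * (D i w * D l w - (i == l)%:R * (t - s))) /\
    E (fun w => (a w * c w 0 i * c w 0 l) * (D i w * D l w - (i == l)%:R * (t - s))) = 0.
  have [] := @increment_adapted_mul (fun w => a w * c w 0 i * c w 0 l)
    (fun w => D i w * D l w - (i == l)%:R * (t - s)) (Ca * Cc * Cc).
  - exact: aac.
  - exact: bac.
  - apply: measurable_funB; last exact: measurable_cst.
    by apply: measurable_funM; exact: increment_gen_measurable.
  - by apply: rvL1B; [exact: increment_prod_L1|exact: rvL1_cst].
  - move=> h ->; split => //.
    rewrite rvEB; [|exact: increment_prod_L1|exact: rvL1_cst].
    by rewrite increment_cov rvE_cst subrr mulr0.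
have -> : (fun w => a w * (z w ^+ 2 - enorm (c w) ^+ 2 * (t - s))) =
  (fun w => \sum_(i < d) \sum_(l < d)
     (a w * c w 0 i * c w 0 l) * (D i w * D l w - (i == l)%:R * (t - s))).
  apply/funext => w.
  have -> : enorm (c w) ^+ 2 = \sum_(i < d) \sum_(l < d) c w 0 i * c w 0 l * (i == l)%:R.
    rewrite /enorm sqr_sqrtr; last by apply: sumr_ge0 => i _; rewrite -expr2 sqr_ge0.
    apply: eq_bigr => i _; rewrite (bigD1 i)//= eqxx mulr1 big1 ?addr0// => l li.
    by rewrite eq_sym (negbTE li) mulr0.
  have -> : z w ^+ 2 = \sum_(i < d) \sum_(l < d) (c w 0 i * D i w) * (c w 0 l * D l w).
    by rewrite expr2 /z /dotrv mulr_suml; apply: eq_bigr => i _; rewrite mulr_sumr.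
  rewrite mulr_suml -sumrB mulr_sumr; apply: eq_bigr => i _.
  rewrite mulr_suml -sumrB mulr_sumr; apply: eq_bigr => l _.
  by ring.
have Lin i : L1 (fun w => \sum_(l < d)
     (a w * c w 0 i * c w 0 l) * (D i w * D l w - (i == l)%:R * (t - s))).
  by apply: rvL1_sum => l; exact: (term i l).1.
split; first exact: rvL1_sum.
rewrite rvE_sum// big1// => i _; rewrite rvE_sum => [|l]; last exact: (term i l).1.
by rewrite big1// => l _; exact: (term i l).2.
Qed.

Let mz : measurable_fun setT z.
Proof.
have -> : z = (fun w => \sum_(i < d) c w 0 i * D i w) by [].
by apply: measurable_sum => i; apply: measurable_funM; [exact: mc|exact: mD].
Qed.

Lemma increment_moments : [/\ L1 (fun w => z w ^+ 2), L1 (fun w => z w ^+ 4),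
  E (fun w => z w ^+ 2) <= (d%:R * Cc) ^+ 2 * (t - s) &
  E (fun w => z w ^+ 4) <= 1024 * (d%:R * Cc) ^+ 4 * (t - s) ^+ 2].
Proof.
(* Cauchy-Schwarz, used once for z^2 and once more, on the squares, for z^4; hence the powers d and
   d^3. *)
have sqle (x : 'I_d -> R) : (\sum_(i < d) x i) ^+ 2 <= d%:R * \sum_(i < d) x i ^+ 2.
  rewrite expr2 mulr_suml.
  apply: (@le_trans _ _ (\sum_(i < d) \sum_(j < d) (x i ^+ 2 + x j ^+ 2) / 2)).
    apply: ler_sum => i _; rewrite mulr_sumr; apply: ler_sum => j _.
    by have := sqr_ge0 (x i - x j); nra.
  rewrite (eq_bigr (fun i => d%:R * (x i ^+ 2 / 2) + (\sum_(j < d) x j ^+ 2) / 2)); last first.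
    move=> i _; rewrite (eq_bigr (fun j => x i ^+ 2 / 2 + x j ^+ 2 / 2)); last first.
      by move=> j _; rewrite mulrDl.
    by rewrite big_split/= sumr_const card_ord -mulr_suml mulr_natl.
  rewrite big_split/= sumr_const card_ord -mulr_sumr -mulr_suml -[X in _ + X]mulr_natl.
  by lra.
have Cc2 w i : c w 0 i ^+ 2 <= Cc ^+ 2.
  by rewrite -(real_normK (num_real (c w 0 i))) lerXn2r ?nnegrE// (le_trans _ (cC w i)).
have z2 w : z w ^+ 2 <= d%:R * Cc ^+ 2 * \sum_(i < d) D i w ^+ 2.
  apply: le_trans (sqle _) _; rewrite -mulrA ler_wpM2l// mulr_sumr.
  by apply: ler_sum => i _; rewrite exprMn ler_wpM2r// sqr_ge0.
have z4 w : z w ^+ 4 <= d%:R ^+ 3 * Cc ^+ 4 * \sum_(i < d) D i w ^+ 4.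
  have -> : z w ^+ 4 = (z w ^+ 2) ^+ 2 by rewrite -exprM.
  apply: (@le_trans _ _ ((d%:R * Cc ^+ 2 * \sum_(i < d) D i w ^+ 2) ^+ 2)).
    rewrite lerXn2r ?nnegrE ?sqr_ge0//.
    by apply: mulr_ge0; [rewrite mulr_ge0 ?sqr_ge0|apply: sumr_ge0 => i _; rewrite sqr_ge0].
  rewrite exprMn.
  have := sqle (fun i => D i w ^+ 2).
  have -> : \sum_(i < d) D i w ^+ 2 ^+ 2 = \sum_(i < d) D i w ^+ 4.
    by apply: eq_bigr => i _; rewrite -exprM.
  move=> h.
  apply: (@le_trans _ _ ((d%:R * Cc ^+ 2) ^+ 2 * (d%:R * \sum_(i < d) D i w ^+ 4))).
    by rewrite ler_wpM2l// sqr_ge0.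
  rewrite [leLHS](_ : _ = d%:R ^+ 3 * Cc ^+ 4 * \sum_(i < d) D i w ^+ 4)//.
  by ring.
have LS2 : L1 (fun w => \sum_(i < d) D i w ^+ 2).
  by apply: rvL1_sum => i; under eq_fun do rewrite expr2; exact: increment_prod_L1.
have LS4 : L1 (fun w => \sum_(i < d) D i w ^+ 4).
  by apply: rvL1_sum => i; exact: (increment_pow4 i).1.
have L2 : L1 (fun w => z w ^+ 2).
  apply: (rvL1_le _ _ (rvL1Z (d%:R * Cc ^+ 2) LS2)); first exact: measurable_funX.
  by move=> w; rewrite ger0_norm ?sqr_ge0.
have L4 : L1 (fun w => z w ^+ 4).
  apply: (rvL1_le _ _ (rvL1Z (d%:R ^+ 3 * Cc ^+ 4) LS4)); first exact: measurable_funX.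
  by move=> w; rewrite ger0_norm ?exprn_even_ge0.
split => //.
- apply: le_trans (rvE_le L2 (rvL1Z _ LS2) z2) _.
  rewrite rvEZ// rvE_sum => [|i]; last by under eq_fun do rewrite expr2; exact: increment_prod_L1.
  rewrite (eq_bigr (fun=> t - s)); last first.
    move=> i _; rewrite (_ : (fun _ => _) = (fun w => D i w * D i w)); last first.
      by apply/funext => w; rewrite expr2.
    by rewrite increment_cov eqxx mul1r.
  rewrite sumr_const card_ord -[X in _ * X]mulr_natl.
  suff -> : d%:R * Cc ^+ 2 * (d%:R * (t - s)) = (d%:R * Cc) ^+ 2 * (t - s) by [].
  by ring.
- apply: le_trans (rvE_le L4 (rvL1Z _ LS4) z4) _.
  rewrite rvEZ// rvE_sum => [|i]; last exact: (increment_pow4 i).1.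
  apply: (@le_trans _ _ (d%:R ^+ 3 * Cc ^+ 4 * \sum_(i < d) 1024 * (t - s) ^+ 2)).
    apply: ler_wpM2l; first by apply: mulr_ge0; [exact: exprn_ge0|exact: exprn_even_ge0].
    by apply: ler_sum => i _; exact: (increment_pow4 i).2.
  rewrite sumr_const card_ord -[X in _ * X]mulr_natl.
  suff -> : d%:R ^+ 3 * Cc ^+ 4 * (d%:R * (1024 * (t - s) ^+ 2)) =
    1024 * (d%:R * Cc) ^+ 4 * (t - s) ^+ 2 by [].
  by move: (1024 : R) => k; ring.
Qed.

End Increment.
End BrownianFiltration.

(** * Adapted processes and simple processes *)

Section Adapted.
Context {R : realType} {dO : measure_display} {Omega : measurableType dO}.
Context {d : nat}.
Variables (P : probability Omega R) (T : R) (B : Omega -> R -> 'rV[R]_d).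
Hypotheses (Pcomplete : measure_is_complete P) (hB : is_brownian_motion P T B).
Local Notation Filt t := (filtration_gen P B t).
Local Notation adapted := (adapted_at P B).

Lemma ae_eq_measurable (d' : measure_display) (Z : measurableType d') (f g : Omega -> Z) :
  {ae P, forall w, f w = g w} -> measurable_fun setT f -> measurable_fun setT g.
Proof.
move=> fg mf _ A mA; rewrite setTI.
have n : P.-negligible [set w | f w <> g w] by exact: fg.
have fA : measurable (f @^-1` A) by have := mf measurableT A mA; rewrite setTI.
have -> : g @^-1` A = (f @^-1` A `&` (setT `\` [set w | f w <> g w])) `|`
    (g @^-1` A `&` [set w | f w <> g w]).
  apply/seteqP; split => w /=.
    by have [E|E] := pselect (f w = g w); [left; split=> //; [rewrite E|split=> //]|right].
  by move=> [[fw [_ /contrapT <-]]|[]].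
apply: measurableU; first by apply: measurableI => //; apply: measurableD => //; exact: Pcomplete.
by apply: Pcomplete; apply: negligibleS n => w [].
Qed.

Lemma progressive_adapted (X : Omega -> R -> R) (t : R) : progressive P T B X ->
  0 <= t <= T -> adapted t (X^~ t).
Proof.
move=> pX tT _ A mA.
have /andP[t0 _] := tT.
have mS : measurable (setT `*` `[0, t] : set (g_sigma_algebraType (Filt t) * R)%type).
  exact: measurableX.
have h := pX t tT mS A mA.
have := measurable_ysection t h; congr (measurable _).
apply/seteqP; split => w /=; rewrite /ysection/= inE/=.
- by move=> [[_ _] hA]; split.
- by move=> [_ hA]; split => //; split => //=; rewrite in_itv/= t0 lexx.
Qed.

(** Tonelli's theorem with [Filt t] itself as the sigma-algebra on the first factor. *)
Lemma progressive_integral_adapted (X : Omega -> R -> R) (t : R) :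
  progressive P T B X -> (forall w s, 0 <= X w s) -> 0 <= t <= T ->
  measurable_fun setT ((fun w => \int[lebesgue_measure]_(s in `[0%R, t]) (X w s)%:E)%E :
     g_sigma_algebraType (Filt t) -> \bar R).
Proof.
move=> pX X0 tT.
have mS : measurable (setT `*` `[0, t] : set (g_sigma_algebraType (Filt t) * R)%type).
  exact: measurableX.
pose f (x : g_sigma_algebraType (Filt t) * measurableTypeR R) : \bar R :=
  ((fun x => (X x.1 x.2)%:E) \_ (setT `*` `[0, t])) x.
have mf : measurable_fun setT f.
  by apply/(measurable_restrictT _ mS); apply/measurable_EFinP; exact: pX.
have f0 x : (0 <= f x)%E by rewrite /f patchE; case: ifP => // _; rewrite lee_fin.
have := @measurable_fun_fubini_tonelli_F _ _ (g_sigma_algebraType (Filt t)) (measurableTypeR R) R lebesgue_measure f mf f0.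
congr (measurable_fun _ _); apply/funext => w; rewrite /fubini_F [RHS]integral_mkcond.
apply: eq_integral => s _; rewrite /f !patchE.
have [h|h] := boolP (s \in `[0, t]%classic).
  by rewrite ifT//; move: h; rewrite !inE/=.
by rewrite ifF//; apply/negbTE; move: h; rewrite !notin_setE/= => h [_].
Qed.

End Adapted.

(** * Continuous paths and a countable dense set of times *)

Section Paths.
Context {R : realType}.
Variable T : R.
Hypothesis T0 : 0 < T.
Implicit Types f : R -> R.

Lemma within_unif_continuous f : {within `[0, T], continuous f} ->
  forall eps : R, 0 < eps -> exists2 eta : R, 0 < eta & forall s t : R,
    0 <= s <= T -> 0 <= t <= T -> `|s - t| < eta -> `|f s - f t| < eps.
Proof.
move=> /subspace_continuousP cf eps e0.
have /compact_near_coveringP/(_ _ (0^'+ : set_system R)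
  (fun i s => 0 <= s <= T -> forall t : R, 0 <= t <= T -> `|s - t| < i -> `|f s - f t| < eps)) := @segment_compact R 0 T.
case.
  move=> s sT.
  have /cvgrPdist_lt/(_ (eps / 2)) := cf s sT.
  rewrite divr_gt0// => /(_ isT).
  rewrite near_withinE => /nbhs_ballP[r /= r0 hr].
  have r20 : 0 < r / 2 by rewrite divr_gt0.
  have hr' (v : R) : 0 <= v <= T -> `|s - v| < r -> `|f s - f v| < eps / 2.
    by move=> vT sv; apply: hr => //; rewrite /= in_itv.
  exists (ball s (r / 2), [set i | i < r / 2]).
    split; first exact: nbhsx_ballx.
    by near=> i; near: i; exact: nbhs_right_lt.
  move=> [v i] /= [sv ir] vT t tT vt.
  have sv' : `|s - v| < r / 2 by [].
  have h1 : `|f s - f v| < eps / 2 by apply: hr' => //; lra.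
  have h2 : `|f s - f t| < eps / 2.
    apply: hr' => //; rewrite -(subrKA v).
    by apply: le_lt_trans (ler_normD _ _) _; lra.
  rewrite (splitr eps) -(subrKA (f s)).
  by rewrite (le_lt_trans (ler_normD _ _))// ltrD// distrC.
move=> e /= e0' he.
exists (e / 2); first by rewrite divr_gt0.
move=> s t sT tT st.
have e20 : 0 < e / 2 by rewrite divr_gt0.
apply: (he (e / 2)) => //=.
by rewrite sub0r normrN gtr0_norm// ltr_pdivrMr// ltr_pMr// ltrDl.
Unshelve. all: by end_near. Qed.

(** The rationals, clamped to [0, T]; an index that codes no rational gets 0, so every index gives
    an admissible time. *)
Definition dense_time (n : nat) : R :=
  Num.max 0 (Num.min T (ratr (odflt 0 (@unpickle rat n)))).

Lemma dense_time_itv n : 0 <= dense_time n <= T.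
Proof. by rewrite /dense_time le_max lexx /= ge_max (ltW T0) ge_min lexx. Qed.

Lemma dense_time_dense (t eta : R) : 0 <= t <= T -> 0 < eta ->
  exists n, `|t - dense_time n| < eta.
Proof.
move=> /andP[t0 tT] e0.
have /rat_in_itvoo[r] : t - eta < t + eta by lra.
rewrite in_itv/= => /andP[r1 r2].
exists (pickle r); rewrite /dense_time pickleK/=.
have T0' := T0.
rewrite ltr_norml maxEle minEle; case: (leP T (ratr r)) => h1.
  by case: (leP 0 T) => h2; apply/andP; split; lra.
by case: (leP 0 (ratr r)) => h2; apply/andP; split; lra.
Qed.

Lemma sup_dense f : {within `[0, T], continuous f} ->
  ereal_sup [set (f t)%:E | t in `[0, T]%classic] =
  ereal_sup [set (f (dense_time n))%:E | n in setT].
Proof.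
move=> cf; apply/eqP; rewrite eq_le; apply/andP; split.
  apply: ge_ereal_sup => _ /= [t tT <-].
  rewrite in_itv/= in tT.
  apply/lee_addgt0Pr => e e0.
  have [eta eta0 h] := within_unif_continuous cf e0.
  have [n tn] := dense_time_dense tT eta0.
  have := h _ _ tT (dense_time_itv n) tn.
  rewrite ltr_norml => /andP[_ hn].
  apply: (@le_trans _ _ ((f (dense_time n))%:E + e%:E)%E).
    by rewrite -EFinD lee_fin; lra.
  by rewrite leeD2r//; apply: ereal_sup_ubound; exists n.
apply: ge_ereal_sup => _ /= [n _ <-].
apply: ereal_sup_ubound; exists (dense_time n) => //=.
by rewrite in_itv/= dense_time_itv.
Qed.

End Paths.

(** Almost surely the supremum is one over countably many times; completeness of P extends
    measurability across the exceptional null set. *)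
Lemma measurable_path_sup (R : realType) (T : R) (dO : measure_display)
  (Omega : measurableType dO) (P : probability Omega R) (X : Omega -> R -> R) :
  measure_is_complete P -> 0 < T ->
  (forall t, 0 <= t <= T -> measurable_fun setT (X^~ t)) ->
  {ae P, forall w, {within `[0, T], continuous (X w)}} ->
  measurable_fun setT (fun w => ereal_sup [set (X w t)%:E | t in `[0, T]%classic]).
Proof.
move=> Pc T0 mX cX.
apply: (ae_eq_measurable (P := P) Pc (f := fun w => esups (fun n => (X w (dense_time T n))%:E) 0)).
  apply: filterS cX => w cw; rewrite (sup_dense T0 cw) /esups/= /sdrop; congr ereal_sup.
  by apply/seteqP; split => _ [n _ <-]; exists n.
apply: measurable_fun_esups => n; apply/measurable_EFinP.
by apply: mX; exact: dense_time_itv.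
Qed.

(** * Fine grids containing prescribed points *)

Section Partition.
Context {R : realType}.

(** The points of L are sorted together with a mesh of width delta / 2. Repetitions are kept, so a
    cell may be degenerate; later uses treat that case apart. *)
Lemma exists_partition (L : seq R) (a b delta : R) : a <= b -> 0 < delta ->
  exists m (s : nat -> R), [/\ s 0%N = a, s m = b,
    forall j, (j <= m)%N -> a <= s j <= b,
    forall j, (j < m)%N -> s j <= s j.+1 < s j + delta &
    forall j x, (j < m)%N -> x \in L -> ~~ (s j < x < s j.+1)].
Proof.
move=> ab d0.
have d20 : 0 < delta / 2 by rewrite divr_gt0.
pose k := Num.bound ((b - a) / (delta / 2)).
have hk : b < a + delta / 2 * k%:R.
  have : (b - a) / (delta / 2) < k%:R by apply: archi_boundP; rewrite divr_ge0 ?subr_ge0// ltW.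
  by rewrite ltr_pdivrMr//; lra.
pose U := [seq a + (delta / 2) * i%:R | i <- iota 0 k.+1].
pose l := sort <=%R [seq x <- L ++ U | a < x < b].
have sl : sorted <=%R l by apply: sort_sorted; exact: le_total.
have ml x : (x \in l) = (a < x < b) && (x \in L ++ U) by rewrite mem_sort mem_filter.
pose p := a :: rcons l b.
have sp : sorted <=%R p.
  rewrite /p /= rcons_path; apply/andP; split.
    rewrite path_sortedE; last exact: le_trans.
    by rewrite sl andbT; apply/allP => x; rewrite ml => /andP[/andP[/ltW]].
  case: (lastP l) ml => [|l' y] ml //=; rewrite last_rcons.
  by have := ml y; rewrite mem_rcons inE eqxx => /esym/andP[/andP[_ /ltW]].
pose m := (size l).+1.
have szp : size p = m.+1 by rewrite /p /= size_rcons.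
pose s := nth b p.
have s0 : s 0%N = a by [].
have sm : s m = b by rewrite /s /p /m /= nth_rcons ltnn eqxx.
have mono i j : (i <= j)%N -> (j <= m)%N -> s i <= s j.
  move=> ij jm; apply: (sorted_leq_nth le_trans lexx b sp) => //; rewrite inE szp ltnS//.
  exact: leq_trans jm.
have gap j x : (j < m)%N -> x \in l -> ~~ (s j < x < s j.+1).
  move=> jm xl; apply/negP => /andP[jx xj].
  have xp : x \in p by rewrite /p inE mem_rcons inE xl !orbT.
  have ip : (index x p < m.+1)%N by rewrite -szp index_mem.
  have E : s (index x p) = x by rewrite /s nth_index.
  have [h|h] := leqP (index x p) j.
    by have := mono _ _ h (ltnW jm); rewrite E leNgt jx.
  by have := mono _ _ h ip; rewrite E leNgt xj.
exists m, s; split => //.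
- by move=> j jm; rewrite -{1}s0 -{1}sm !mono.
- move=> j jm; rewrite mono//=.
  rewrite ltNge; apply/negP => big.
  have as1 : a <= s j by rewrite -s0 mono// ltnW.
  have sb : s j.+1 <= b by rewrite -sm mono.
  have hex : exists i, s j < a + delta / 2 * i%:R.
    by exists k; apply: le_lt_trans hk; rewrite -sm mono// ltnW.
  (* The first mesh point beyond [s j] is within delta / 2 of it, hence would lie strictly inside a
     cell of length at least delta. *)
  case: (ex_minnP hex) => -[|i] hi imin.
    by move: hi; rewrite mulr0 addr0 ltNge as1.
  have hi' : a + delta / 2 * i%:R <= s j.
    by rewrite leNgt; apply/negP => /imin; rewrite ltnn.
  have ik : (i.+1 <= k)%N.
    by apply: imin; apply: le_lt_trans hk; rewrite -sm mono// ltnW.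
  pose x := a + delta / 2 * i.+1%:R.
  have x1 : s j < x < s j.+1.
    by rewrite /x hi/=; move: hi'; rewrite -[i.+1%:R]natr1; lra.
  have xab : a < x < b.
    by move/andP : x1 => [x1 x2]; rewrite (le_lt_trans as1 x1) (lt_le_trans x2 sb).
  have xl : x \in l.
    rewrite ml xab mem_cat; apply/orP; right; apply/mapP; exists i.+1 => //.
    by rewrite mem_iota add0n ltnS.
  by move: (gap j x jm xl); rewrite x1.
- move=> j x jm xL; apply/negP => /andP[jx xj].
  have := gap j x jm; rewrite ml mem_cat xL andbT jx xj => h.
  have: a < x < b.
    rewrite (le_lt_trans _ jx)/=; last by rewrite -s0 mono// ltnW.
    by rewrite (lt_le_trans xj)// -sm mono.
  by move=> h'; move: (h h').
Qed.

End Partition.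

(** * Simple processes on cells without interior jumps *)

Section SimpleProcesses.
Context {R : realType} {dO : measure_display} {Omega : measurableType dO}.
Context {d : nat}.
Variables (P : probability Omega R) (T : R) (B : Omega -> R -> 'rV[R]_d).
Hypotheses (Pcomplete : measure_is_complete P) (hB : is_brownian_motion P T B).
Local Notation Filt t := (filtration_gen P B t).
Local Notation adapted := (adapted_at P B).
Variable H : @step_process R dO Omega d.
Hypothesis hH : is_simple_process P T B H.
Let n := sp_size H.
Let tm := sp_time H.

Lemma dotrvDl (u v x : 'rV[R]_d) : dotrv (u + v) x = dotrv u x + dotrv v x.
Proof. by rewrite /dotrv -big_split; apply: eq_bigr => i _; rewrite mxE mulrDl. Qed.

Lemma dotrv0l (x : 'rV[R]_d) : dotrv 0 x = 0.
Proof. by rewrite /dotrv big1// => i _; rewrite mxE mul0r. Qed.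

Lemma dotrv0r (x : 'rV[R]_d) : dotrv x 0 = 0.
Proof. by rewrite /dotrv big1// => i _; rewrite mxE mulr0. Qed.

Lemma dotrv_suml (I : Type) (r : seq I) (F : I -> 'rV[R]_d) (x : 'rV[R]_d) :
  dotrv (\sum_(k <- r) F k) x = \sum_(k <- r) dotrv (F k) x.
Proof.
by elim: r => [|k r IH]; rewrite ?big_nil ?dotrv0l// !big_cons dotrvDl IH.
Qed.

Lemma dotrvBr (u x y : 'rV[R]_d) : dotrv u (x - y) = dotrv u x - dotrv u y.
Proof. by rewrite /dotrv -sumrB; apply: eq_bigr => i _; rewrite !mxE mulrBr. Qed.

Lemma sp_time_mono i j : (i <= j)%N -> (j <= n)%N -> tm i <= tm j.
Proof.
move=> ij; elim: j ij => [|j IH]; first by rewrite leqn0 => /eqP ->.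
rewrite leq_eqVlt => /predU1P[->//|ij jn].
by apply: le_trans (IH ij (ltnW jn)) _; exact: sp_time_le hH _ jn.
Qed.

Lemma sp_time_itv k : (k <= n)%N -> 0 <= tm k <= T.
Proof.
move=> kn; rewrite (le_trans (sp_time_ge0 hH)) ?sp_time_mono//=.
by apply: le_trans (sp_time_leT hH); exact: sp_time_mono.
Qed.

Definition sp_jumps : seq R := [seq tm k | k <- iota 0 n.+1].

Lemma sp_jumpsP k : (k <= n)%N -> tm k \in sp_jumps.
Proof. by move=> kn; apply: map_f; rewrite mem_iota. Qed.

(** With no jump time strictly between s and s', each interval of the simple process contains the
    half-open cell or misses it, so being active does not depend on r. *)
Lemma sp_active (s s' r : R) k : s <= s' ->
  (forall x, x \in sp_jumps -> ~~ (s < x < s')) -> (k < n)%N ->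
  s < r <= s' -> (tm k < r <= tm k.+1) = (tm k <= s) && (s' <= tm k.+1).
Proof.
move=> ss' nj kn /andP[sr rs'].
have j1 := nj _ (sp_jumpsP (ltnW kn)); have j2 := nj _ (sp_jumpsP kn).
apply/idP/idP => /andP[h1 h2].
- apply/andP; split.
    rewrite leNgt; apply/negP => h; case/negP : j1; rewrite h/=.
    exact: lt_le_trans h1 rs'.
  rewrite leNgt; apply/negP => h; case/negP : j2; rewrite h andbT.
  exact: lt_le_trans sr h2.
- by rewrite (le_lt_trans h1 sr) (le_trans rs' h2).
Qed.

Lemma sp_value_cell (s s' r : R) w : s < s' ->
  (forall x, x \in sp_jumps -> ~~ (s < x < s')) -> s < r <= s' ->
  sp_value H w r = sp_value H w s'.
Proof.
move=> ss' nj rs; apply: eq_bigr => k _.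
by rewrite (sp_active (ltW ss') nj (ltn_ord k) rs)
  (sp_active (r := s') (ltW ss') nj (ltn_ord k))// ss' lexx.
Qed.

Lemma sp_integral_cell (s s' : R) w : s < s' ->
  (forall x, x \in sp_jumps -> ~~ (s < x < s')) ->
  sp_integral B H w s' - sp_integral B H w s =
  dotrv (sp_value H w s') (B w s' - B w s).
Proof.
move=> ss' nj; rewrite /sp_value dotrv_suml -sumrB; apply: eq_bigr => k _.
have s's' : s < s' <= s' by rewrite ss' lexx.
rewrite (sp_active (ltW ss') nj (ltn_ord k) s's').
have kn := ltn_ord k.
have j1 := nj _ (sp_jumpsP (ltnW kn)); have j2 := nj _ (sp_jumpsP kn).
have tt' : tm k <= tm k.+1 := sp_time_le hH kn.
rewrite -dotrvBr; case: ifPn => [/andP[h1 h2]|].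
  rewrite -/tm (min_idPr h2) (min_idPl (le_trans h1 (ltW ss'))) (min_idPl h1).
  rewrite (min_idPr (le_trans (ltW ss') h2)); congr dotrv.
  by rewrite opprB addrA subrK.
rewrite negb_and -!ltNge => /orP h.
rewrite dotrv0l -[RHS](dotrv0r (sp_coef H k w)); congr dotrv; apply/eqP.
rewrite subr_eq0; apply/eqP.
have [h1|] := boolP (tm k.+1 <= s); last rewrite -ltNge => h1.
  rewrite -/tm !(min_idPl h1) (min_idPl (le_trans tt' h1)).
  by rewrite (min_idPl (le_trans h1 (ltW ss'))) (min_idPl (le_trans tt' (le_trans h1 (ltW ss')))).
have h2 : s' <= tm k.
  case: h => h.
    by rewrite leNgt; apply/negP => h'; case/negP: j1; rewrite h h'.
  by case/negP: j2; rewrite h1 h.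
rewrite -/tm (min_idPr h2) (min_idPr (le_trans h2 tt')).
by rewrite (min_idPr (le_trans (ltW ss') h2)) (min_idPr (le_trans (ltW ss') (le_trans h2 tt'))) !subrr.
Qed.

(** Although taken at the right endpoint, the value involves only coefficients whose times satisfy
    [tm k <= s]. *)
Lemma sp_value_cell_adapted (s s' : R) i : s < s' ->
  (forall x, x \in sp_jumps -> ~~ (s < x < s')) ->
  adapted s (fun w => sp_value H w s' 0 i).
Proof.
move=> ss' nj; have s's' : s < s' <= s' by rewrite ss' lexx.
rewrite (_ : (fun _ => _) = (fun w => \sum_(k < n) (if (tm k <= s) && (s' <= tm k.+1)
    then sp_coef H k w 0 i else 0))); last first.
  apply/funext => w; rewrite /sp_value summxE; apply: eq_bigr => k _.
  by rewrite (sp_active (ltW ss') nj (ltn_ord k) s's'); case: ifP => // _; rewrite mxE.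
apply: measurable_sum => k.
have [/andP[h1 h2]|h] := boolP ((tm k <= s) && (s' <= tm k.+1)); last exact: measurable_cst.
exact: adapted_le h1 (sp_adapted hH i (ltn_ord k)).
Qed.

Lemma enorm_ge (x : 'rV[R]_d) i : `|x 0 i| <= enorm x.
Proof.
rewrite /enorm /dotrv -sqrtr_sqr; apply: ler_wsqrtr.
by rewrite (bigD1 i)//= expr2 lerDl sumr_ge0// => j _; rewrite -expr2 sqr_ge0.
Qed.

Lemma sp_value_bounded : exists2 C : R, 0 <= C & forall w t i, `|sp_value H w t 0 i| <= C.
Proof.
have /choice[C hC] : forall k : 'I_n, exists C : R, forall w, enorm (sp_coef H k w) <= C.
  by move=> k; exact: (sp_bounded hH (ltn_ord k)).
exists (\sum_(k < n) `|C k|); first by apply: sumr_ge0.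
move=> w t i; rewrite /sp_value summxE.
apply: le_trans (ler_norm_sum _ _ _) _; apply: ler_sum => k _.
case: ifP => _; last by rewrite mxE normr0.
by apply: le_trans (enorm_ge _ i) _; apply: le_trans (hC k w) (ler_norm _).
Qed.

Lemma sp_value_progressive i : progressive P T B (fun w t => sp_value H w t 0 i).
Proof.
move=> t tT.
rewrite (_ : (fun _ => _) = (fun x : g_sigma_algebraType (Filt t) * R =>
   \sum_(k < n) (if (tm k < x.2) && (x.2 <= tm k.+1) then sp_coef H k x.1 0 i else 0))); last first.
  by apply/funext => x; rewrite /sp_value summxE; apply: eq_bigr => k _; case: ifP => // _; rewrite mxE.
apply: measurable_sum => k.
(* Up to time [tm k] the summand vanishes; beyond it, its coefficient is already
   [Filt t]-measurable. *)
have [h|] := boolP (t <= tm k); last rewrite -ltNge => h.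
  apply: (eq_measurable_fun (cst 0 : g_sigma_algebraType (Filt t) * R -> R)); last exact: measurable_cst.
  move=> x; rewrite inE => -[_ /=]; rewrite in_itv/= => /andP[_ xt].
  by rewrite ifF//; apply/negbTE; rewrite negb_and -leNgt (le_trans xt h).
apply: measurable_funTS.
have mi : measurable_fun setT (fun x : g_sigma_algebraType (Filt t) * R => (tm k < x.2) && (x.2 <= tm k.+1)).
  by apply: measurable_and; [apply: measurable_fun_ltr|apply: measurable_fun_ler].
apply: measurable_fun_ifT => //.
have := adapted_le (ltW h) (sp_adapted hH i (ltn_ord k)).
move=> ha; apply: (@measurableT_comp _ _ _ _ _ _ (fun w : g_sigma_algebraType (Filt t) => sp_coef H k w 0 i) _ fst) => //.
Qed.

Lemma brownian_adapted (s t : R) i : 0 <= s -> s <= t -> adapted t (fun w => B w s 0 i).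
Proof.
move=> s0 st _ A mA; apply: sub_gen_smallest; left.
by exists s; [rewrite /= in_itv/= s0|exists i => //; exists A].
Qed.

Lemma sp_integral_adapted (t : R) : 0 <= t -> t <= T -> adapted t (fun w => sp_integral B H w t).
Proof.
move=> t0 tT; apply: measurable_sum => k.
have tk1 := sp_time_itv (ltnW (ltn_ord k)); have tk2 := sp_time_itv (ltn_ord k).
have [h|] := boolP (t <= tm k); last rewrite -ltNge => h.
  rewrite (_ : (fun _ => _) = cst 0); first exact: measurable_cst.
  apply/funext => w; rewrite -/tm (min_idPr h) (min_idPr (le_trans h (sp_time_le hH (ltn_ord k)))).
  by rewrite subrr dotrv0r.
rewrite /dotrv; apply: measurable_sum => i; apply: measurable_funM.
  exact: adapted_le (ltW h) (sp_adapted hH i (ltn_ord k)).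
rewrite (_ : (fun _ => _) = (fun w => B w (Num.min (sp_time H k.+1) t) 0 i - B w (Num.min (sp_time H k) t) 0 i)).
  apply: measurable_funB; apply: brownian_adapted; rewrite ?ge_min ?lexx ?orbT//.
    by rewrite le_min t0 andbT; case/andP: tk2.
  by rewrite le_min t0 andbT; case/andP: tk1.
by apply/funext => w; rewrite !mxE.
Qed.

Lemma sp_integral_continuous w : {within `[0, T], continuous (B w)} ->
  {within `[0, T], continuous (sp_integral B H w)}.
Proof.
move=> cB.
have cBi i : {within `[0, T], continuous (fun t => B w t 0 i)}.
  move=> x; apply: (@continuous_comp (subspace `[0, T]) _ _ (B w) (fun M : 'rV[R]_d => M 0 i)).
    exact: cB.
  exact: coord_continuous.
have cmin i (a : R) : 0 <= a <= T -> {within `[0, T], continuous (fun t => B w (Num.min a t) 0 i)}.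
  move=> aT; apply/subspace_continuousP => t; rewrite /= in_itv/= => tT.
  apply/cvgrPdist_lt => e e0.
  have [eta eta0 h] := within_unif_continuous (cBi i) e0.
  rewrite near_withinE; exists eta => //= x tx; rewrite in_itv/= => xT.
  apply: h.
  - by rewrite le_min ge_min; lra.
  - by rewrite le_min ge_min; lra.
  - apply: le_lt_trans tx; rewrite !minEle.
    by case: (leP a t) => ?; case: (leP a x) => ?; rewrite ?subrr ?normr0// ler_norml; have := ler_norm (t - x); have := ler_norm (- (t - x)); rewrite normrN => ? ?; apply/andP; split; lra.
have csum (I : Type) (r : seq I) (F : I -> R -> R) :
    (forall k, {within `[0, T], continuous (F k)}) ->
    {within `[0, T], continuous (fun t => \sum_(k <- r) F k t)}.
  move=> cF; elim: r => [|k r IH] x.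
    by rewrite (_ : (fun _ => _) = cst 0); [exact: cvg_cst|apply/funext => t; rewrite big_nil].
  rewrite (_ : (fun _ => _) = (fun t => F k t + \sum_(j <- r) F j t)).
    by apply: cvgD; [exact: cF|exact: IH].
  by apply/funext => t; rewrite big_cons.
rewrite /sp_integral; apply: (csum _ _ (fun k : 'I_(sp_size H) => _)) => k.
rewrite /dotrv; apply: csum => i.
rewrite (_ : (fun _ => _) = (fun t => sp_coef H k w 0 i *
  (B w (Num.min (sp_time H k.+1) t) 0 i - B w (Num.min (sp_time H k) t) 0 i))).
  move=> x; apply: cvgM; first exact: cvg_cst.
  by apply: cvgB; apply: cmin; [exact: (sp_time_itv (ltn_ord k))|exact: (sp_time_itv (ltnW (ltn_ord k)))].
by apply/funext => t; rewrite !mxE.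
Qed.

End SimpleProcesses.

(** * Approximation of stochastic integrals *)

Section Elementary.
Context {R : realType} {dO : measure_display} {Omega : measurableType dO}.
Context {d : nat}.
Variables (P : probability Omega R) (T : R) (B : Omega -> R -> 'rV[R]_d).
Hypotheses (Pcomplete : measure_is_complete P) (hB : is_brownian_motion P T B)
  (T0 : 0 < T).
Local Notation Filt t := (filtration_gen P B t).
Local Notation adapted := (adapted_at P B).

(* The part of the theory of simple processes that survives linear combinations
   of simple processes with different grids; L contains the jump times. *)
Record elementary (x : Omega -> R -> R) (v : Omega -> R -> 'rV[R]_d) (L : seq R)
    : Prop := {
  el_adapted : forall t, 0 <= t <= T -> adapted t (x^~ t);
  el_cell : forall s s', 0 <= s -> s < s' -> s' <= T ->
    (forall y, y \in L -> ~~ (s < y < s')) ->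
    [/\ forall w, x w s' - x w s = dotrv (v w s') (B w s' - B w s),
        forall w r, s < r <= s' -> v w r = v w s' &
        forall i, adapted s (fun w => v w s' 0 i)];
  el_bounded : exists2 C : R, 0 <= C & forall w t i, `|v w t 0 i| <= C;
  el_progressive : progressive_rv P T B v }.

Lemma simple_elementary H : is_simple_process P T B H ->
  elementary (sp_integral B H) (sp_value H) (sp_jumps H).
Proof.
move=> hH; split.
- by move=> t /andP[t0 tT]; exact: (sp_integral_adapted hH t0 tT).
- move=> s s' s0 ss' s'T nj; split.
  + by move=> w; exact: (sp_integral_cell hH).
  + by move=> w r rs; exact: sp_value_cell ss' nj rs.
  + by move=> i; exact: (sp_value_cell_adapted hH).
- exact: (sp_value_bounded hH).
- by move=> i; exact: sp_value_progressive.
Qed.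

Lemma progressiveD (X Y : Omega -> R -> R) : progressive P T B X ->
  progressive P T B Y -> progressive P T B (fun w t => X w t + Y w t).
Proof. by move=> pX pY t tT; apply: measurable_funD; [exact: pX|exact: pY]. Qed.

Lemma progressiveZ (a : R) (X : Omega -> R -> R) : progressive P T B X ->
  progressive P T B (fun w t => a * X w t).
Proof. by move=> pX t tT; apply: measurable_funM => //; exact: pX. Qed.

Lemma progressive_comp (f : R -> R) (X : Omega -> R -> R) : measurable_fun setT f ->
  progressive P T B X -> progressive P T B (fun w t => f (X w t)).
Proof. by move=> mf pX t tT; apply: measurableT_comp => //; exact: pX. Qed.

Lemma progressive_comb (a b : R) (X Y : Omega -> R -> R) : progressive P T B X ->
  progressive P T B Y -> progressive P T B (fun w t => a * X w t - b * Y w t).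
Proof.
by move=> pX pY t tT; apply: measurable_funB; apply: measurable_funM => //; [exact: pX|exact: pY].
Qed.

Lemma progressive_rv_comb (a b : R) (X Y : Omega -> R -> 'rV[R]_d) :
  progressive_rv P T B X -> progressive_rv P T B Y ->
  progressive_rv P T B (fun w t => a *: X w t - b *: Y w t).
Proof.
move=> pX pY i.
rewrite (_ : (fun _ => _) = (fun w t => a * X w t 0 i - b * Y w t 0 i)).
  by apply: progressive_comb; [exact: pX|exact: pY].
by apply/funext => w; apply/funext => t; rewrite !mxE.
Qed.

Lemma progressive_enorm (X : Omega -> R -> 'rV[R]_d) : progressive_rv P T B X ->
  progressive P T B (fun w t => enorm (X w t)).
Proof.
move=> pX; apply: (progressive_comp (f := Num.sqrt)).
  by apply: continuous_measurable_fun; exact: sqrt_continuous.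
move=> t tT; apply: measurable_sum => i.
by apply: measurable_funM; exact: pX.
Qed.

Lemma adapted_comb (a b : R) (t : R) (X Y : Omega -> R) : adapted t X ->
  adapted t Y -> adapted t (fun w => a * X w - b * Y w).
Proof.
by move=> pX pY; apply: measurable_funB; apply: measurable_funM.
Qed.

Lemma elementary_comb (a b : R) x v L x' v' L' : elementary x v L -> elementary x' v' L' ->
  elementary (fun w t => a * x w t - b * x' w t) (fun w t => a *: v w t - b *: v' w t) (L ++ L').
Proof.
move=> h h'; split.
- by move=> t tT; apply: adapted_comb; [exact: el_adapted h _ tT|exact: el_adapted h' _ tT].
- move=> s s' s0 ss' s'T nj.
  have [|e1 e2 e3] := el_cell h s0 ss' s'T.
    by move=> y yL; apply: nj; rewrite mem_cat yL.
  have [|e1' e2' e3'] := el_cell h' s0 ss' s'T.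
    by move=> y yL; apply: nj; rewrite mem_cat yL orbT.
  split.
  + move=> w; rewrite /dotrv.
    transitivity (a * (x w s' - x w s) - b * (x' w s' - x' w s)); first by ring.
    rewrite e1 e1' /dotrv !mulr_sumr -sumrB; apply: eq_bigr => i _.
    by rewrite !mxE; ring.
  + by move=> w r rs; rewrite e2// e2'.
  + move=> i; rewrite (_ : (fun _ => _) = (fun w => a * v w s' 0 i - b * v' w s' 0 i)).
      by apply: adapted_comb.
    by apply/funext => w; rewrite !mxE.
- have [C C0 hC] := el_bounded h; have [C' C'0 hC'] := el_bounded h'.
  exists (`|a| * C + `|b| * C'); first by rewrite addr_ge0 ?mulr_ge0.
  move=> w t i; rewrite !mxE; apply: le_trans (ler_normB _ _) _.
  by rewrite !normrM lerD// ler_wpM2l.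
- by apply: progressive_rv_comb; [exact: el_progressive h|exact: el_progressive h'].
Qed.

(* "With probability close to 1", phrased with a measurable exceptional set. *)
Definition almost_prob (Q : Omega -> Prop) (rho : R) : Prop :=
  exists Bad : set Omega, [/\ measurable Bad, (P Bad <= rho%:E)%E & forall w, ~ Bad w -> Q w].

Lemma almost_prob_sub (Q Q' : Omega -> Prop) rho : (forall w, Q w -> Q' w) ->
  almost_prob Q rho -> almost_prob Q' rho.
Proof. by move=> QQ' [Bad [h1 h2 h3]]; exists Bad; split => // w /h3 /QQ'. Qed.

Lemma almost_prob_and (Q Q' : Omega -> Prop) r r' : almost_prob Q r -> almost_prob Q' r' ->
  almost_prob (fun w => Q w /\ Q' w) (r + r').
Proof.
move=> [A [mA PA hA]] [C [mC PC hC]]; exists (A `|` C); split.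
- exact: measurableU.
- by apply: le_trans (measureU2 _ mA mC) _; rewrite EFinD; exact: leeD.
- by move=> w /not_orP[/hA ? /hC].
Qed.

Lemma cvg0_in_probability_almost (X : nat -> Omega -> \bar R) (eps rho : R) :
  0 < eps -> 0 < rho -> (forall n, measurable_fun setT (X n)) ->
  cvg0_in_probability P X ->
  \forall n \near \oo, almost_prob (fun w => (X n w < eps%:E)%E) rho.
Proof.
move=> e0 r0 mX /(_ eps e0) h.
have : \forall n \near \oo, (P [set w | (eps%:E <= X n w)%E] < rho%:E)%E.
  have := h; move/fine_cvgP => [hfin /cvgrPdist_lt/(_ rho r0)].
  move=> hc; near=> n.
  have f : P [set w | (eps%:E <= X n w)%E] \is a fin_num by near: n.
  rewrite -(fineK f) lte_fin.
  have : `|0 - fine (P [set w | (eps%:E <= X n w)%E])| < rho by near: n.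
  by rewrite sub0r normrN; apply: le_lt_trans; exact: ler_norm.
apply: filterS => n hn; exists [set w | (eps%:E <= X n w)%E]; split.
- rewrite -[X in measurable X]setTI.
  by apply: emeasurable_fun_c_infty.
- exact: ltW.
- by move=> w /negP; rewrite -ltNge.
Unshelve. all: by end_near. Qed.

Lemma progressive_integral_measurable (X : Omega -> R -> R) :
  progressive P T B X -> (forall w s, 0 <= X w s) ->
  measurable_fun setT (fun w => \int[lebesgue_measure]_(s in `[0%R, T]) (X w s)%:E)%E.
Proof.
move=> pX X0 _ A mA; apply: (filtration_measurable Pcomplete hB (lexx T)).
have TT : 0 <= T <= T by rewrite lexx ltW.
exact: (progressive_integral_adapted pX X0 TT measurableT mA).
Qed.

Lemma ito_elementary (Z : Omega -> R -> 'rV[R]_d) (M : Omega -> R -> R) (eta rho : R) :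
  progressive_rv P T B Z -> is_ito_integral P T B Z M -> 0 < eta -> 0 < rho ->
  exists x v L, elementary x v L /\ almost_prob (fun w =>
    (forall t, 0 <= t <= T -> `|x w t - M w t| <= eta) /\
    (\int[lebesgue_measure]_(t in `[0%R, T]) (enorm (v w t - Z w t) ^+ 2)%:E <= eta%:E)%E) rho.
Proof.
move=> pZ [aM cM [H [hH h1 h2]]] e0 r0.
have r20 : 0 < rho / 2 by rewrite divr_gt0.
have m1 n : measurable_fun setT (fun w => \int[lebesgue_measure]_(t in `[0%R, T])
             (enorm (sp_value (H n) w t - Z w t) ^+ 2)%:E)%E.
  apply: progressive_integral_measurable => [|w s]; last by rewrite sqr_ge0.
  apply: (progressive_comp (f := fun y => y ^+ 2)); first exact: measurable_funX.
  apply: progressive_enorm.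
  have -> : (fun w t => sp_value (H n) w t - Z w t) =
      (fun w t => 1 *: sp_value (H n) w t - 1 *: Z w t).
    by apply/funext => w; apply/funext => t; rewrite !scale1r.
  by apply: progressive_rv_comb => //; exact: el_progressive (simple_elementary (hH n)).
have m2 n : measurable_fun setT (fun w => ereal_sup [set `|sp_integral B (H n) w t - M w t|%:E
                    | t in `[0%R, T]%classic]).
  apply: (measurable_path_sup (P := P) (X := fun w t => `|sp_integral B (H n) w t - M w t|)) => //.
    move=> t /andP[t0 tT]; apply: measurableT_comp => //.
    apply: measurable_funB; apply: (adapted_measurable Pcomplete hB tT).
      exact: sp_integral_adapted.
    by apply: aM; rewrite t0.
  have := bm_continuous hB; apply: filterS2 cM => w cMw cBw x.
  have c1 := @sp_integral_continuous _ _ _ _ _ _ _ _ (hH n) w cBw x.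
  by apply: cvg_norm; apply: cvgB; [exact: c1|exact: cMw].
have n1 := cvg0_in_probability_almost e0 r20 m1 h1.
have n2 := cvg0_in_probability_almost e0 r20 m2 h2.
near \oo => n.
have a1 : almost_prob (fun w => (\int[lebesgue_measure]_(t in `[0%R, T])
             (enorm (sp_value (H n) w t - Z w t) ^+ 2)%:E < eta%:E)%E) (rho / 2) by near: n.
have a2 : almost_prob (fun w => (ereal_sup [set `|sp_integral B (H n) w t - M w t|%:E
                    | t in `[0%R, T]%classic] < eta%:E)%E) (rho / 2) by near: n.
exists (sp_integral B (H n)), (sp_value (H n)), (sp_jumps (H n)); split.
  exact: simple_elementary.
rewrite (splitr rho); apply: almost_prob_sub (almost_prob_and a1 a2) => w [hw1 hw2].
split; last exact: ltW.
move=> t tT; rewrite -lee_fin; apply: le_trans (ltW hw2).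
by apply: ereal_sup_ubound; exists t => //=; rewrite in_itv.
Unshelve. all: by end_near. Qed.

End Elementary.

Section Oscillation.
Context {R : realType} {dO : measure_display} {Omega : measurableType dO}.
Variables (P : probability Omega R) (T : R).
Hypothesis T0 : 0 < T.

(** The events that the oscillation over dense times within 1/(k+1) exceeds eta / 2 decrease to a
    null set, by uniform continuity of almost every path, so their probabilities tend to 0. The
    remaining half of eta pays for the passage from dense to arbitrary times. *)
Lemma almost_osc (X : Omega -> R -> R) (eta rho : R) :
  (forall t, 0 <= t <= T -> measurable_fun setT (X^~ t)) ->
  {ae P, forall w, {within `[0, T], continuous (X w)}} -> 0 < eta -> 0 < rho ->
  exists2 delta : R, 0 < delta & almost_prob P (fun w => forall s t,
    0 <= s <= T -> 0 <= t <= T -> `|s - t| < delta -> `|X w s - X w t| <= eta) rho.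
Proof.
move=> mX [N [mN PN hN]] e0 r0.
pose r := dense_time T.
have rT n : 0 <= r n <= T by exact: dense_time_itv.
pose D k := \bigcup_i \bigcup_j [set w | (`|r i - r j| < k.+1%:R^-1) && (eta / 2 < `|X w (r i) - X w (r j)|)].
have mD k : measurable (D k).
  apply: bigcup_measurable => i _; apply: bigcup_measurable => j _.
  have [h|h] := boolP (`|r i - r j| < k.+1%:R^-1); last first.
    by rewrite (_ : [set w | _] = set0)//; apply/seteqP; split.
  rewrite /= -[X in measurable X]setTI.
  have : measurable_fun setT (fun w => eta / 2 < `|X w (r i) - X w (r j)|).
    apply: measurable_fun_ltr; first exact: measurable_cst.
    by apply: measurableT_comp => //; apply: measurable_funB; exact: mX.
  by move=> /(_ measurableT [set true] I).
have ndD : nonincreasing_seq D.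
  move=> k l kl; apply/subsetPset => w [i _ [j _ /= /andP[h1 h2]]].
  exists i => //; exists j => //=; rewrite h2 andbT (lt_le_trans h1)//.
  by rewrite lef_pV2 ?posrE// ler_nat ltnS.
have capN : \bigcap_k D k `<=` N.
  move=> w hw; apply: hN => /= cw.
  have e20 : 0 < eta / 2 by rewrite divr_gt0.
  have [dl dl0 hdl] := within_unif_continuous cw e20.
  have [k hk] : exists k : nat, k.+1%:R^-1 < dl.
    exists (Num.bound dl^-1).
    rewrite invf_plt ?posrE//.
    have h : dl^-1 < (Num.bound dl^-1)%:R by apply: archi_boundP; rewrite invr_ge0 ltW.
    by apply: lt_trans h _; rewrite ltr_nat.
  have [i _ [j _ /= /andP[h1 h2]]] := hw k I.
  have := hdl _ _ (rT i) (rT j) (lt_trans h1 hk).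
  by move=> h3; have := lt_trans h2 h3; rewrite ltxx.
have PD : P (D k) @[k --> \oo] --> (0 : \bar R).
  have <- : P (\bigcap_k D k) = 0%E.
    apply: (subset_measure0 (B := N)) => //.
    by apply: bigcapT_measurable.
  apply: nonincreasing_cvg_mu => //.
  - by rewrite (le_lt_trans (probability_le1 P (mD 0%N)))// ltry.
  - by apply: bigcapT_measurable.
have [k hk] : exists k, (P (D k) < rho%:E)%E.
  have : \forall k \near \oo, (P (D k) < rho%:E)%E.
    move/fine_cvgP : PD => [hfin /cvgrPdist_lt/(_ rho r0)] hc.
    near=> k.
    have f : P (D k) \is a fin_num by near: k.
    rewrite -(fineK f) lte_fin.
    have : `|0 - fine (P (D k))| < rho by near: k.
    by rewrite sub0r normrN; apply: le_lt_trans; exact: ler_norm.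
  by move=> [k _ /(_ k (leqnn k))]; exists k.
exists (k.+1%:R^-1); first by rewrite invr_gt0.
exists (D k `|` N); split.
- exact: measurableU.
- have PN0 : (P N <= 0)%E by rewrite PN.
  apply: le_trans (measureU2 P (mD k) mN) _.
  by rewrite -[leRHS]adde0; exact: leeD (ltW hk) PN0.
move=> w /not_orP[nD nN] s t sT tT st.
have cw : {within `[0, T], continuous (X w)}.
  by apply: contrapT => nc; apply: nN; apply: hN.
have e40 : 0 < eta / 4 by rewrite divr_gt0.
have [dl dl0 hdl] := within_unif_continuous cw e40.
(* The strict inequality between s and t leaves room: dense times within g of them are still less
   than 1/(k+1) apart. *)
pose g := Num.min dl ((k.+1%:R^-1 - `|s - t|) / 2).
have g0 : 0 < g by rewrite lt_min dl0 divr_gt0// subr_gt0.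
have gd : g <= dl by rewrite ge_min lexx.
have gk : g <= (k.+1%:R^-1 - `|s - t|) / 2 by rewrite ge_min lexx orbT.
have [i si] := dense_time_dense T0 sT g0.
have [j tj] := dense_time_dense T0 tT g0.
rewrite -/(r i) in si; rewrite -/(r j) in tj.
have h1 := hdl _ _ sT (rT i) (lt_le_trans si gd).
have h2 := hdl _ _ tT (rT j) (lt_le_trans tj gd).
have rij : `|r i - r j| < k.+1%:R^-1.
  have -> : r i - r j = (s - t) - (s - r i) + (t - r j) by ring.
  apply: le_lt_trans (ler_normD _ _) _.
  have := ler_normB (s - t) (s - r i); move: gk si tj; clear.
  by move: (k.+1%:R^-1) g (`|s - t|) (`|s - r i|) (`|t - r j|) => *; lra.
have h3 : `|X w (r i) - X w (r j)| <= eta / 2.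
  rewrite leNgt; apply/negP => h; apply: nD; exists i => //; exists j => //=.
  by rewrite rij h.
have -> : X w s - X w t = (X w s - X w (r i)) + (X w (r i) - X w (r j)) - (X w t - X w (r j)) by ring.
apply: le_trans (ler_normB _ _) _.
by have := ler_normD (X w s - X w (r i)) (X w (r i) - X w (r j)); lra.
Unshelve. all: by end_near. Qed.

End Oscillation.

Section AdaptedBool.
Context {R : realType} {dO : measure_display} {Omega : measurableType dO}.
Context {d : nat}.
Variables (P : probability Omega R) (B : Omega -> R -> 'rV[R]_d).
Local Notation Filt t := (filtration_gen P B t).

Definition adaptedb (t : R) (b : Omega -> bool) : Prop :=
  measurable_fun setT (b : g_sigma_algebraType (Filt t) -> bool).

Lemma adaptedb_le (s t : R) b : s <= t -> adaptedb s b -> adaptedb t b.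
Proof.
move=> st hb _ A mA; apply: (sub_filtration st); exact: (hb measurableT A mA).
Qed.

Lemma adaptedb_and (t : R) b c : adaptedb t b -> adaptedb t c ->
  adaptedb t (fun w => b w && c w).
Proof. by move=> hb hc; exact: measurable_and. Qed.

Lemma adaptedb_ler (t : R) (X Y : Omega -> R) : adapted_at P B t X ->
  adapted_at P B t Y -> adaptedb t (fun w => X w <= Y w).
Proof. by move=> hX hY; exact: measurable_fun_ler. Qed.

Lemma adapted_if (t : R) (b : Omega -> bool) (X : Omega -> R) : adaptedb t b ->
  adapted_at P B t X -> adapted_at P B t (fun w => if b w then X w else 0).
Proof. by move=> hb hX; apply: measurable_fun_ifT => //; exact: measurable_cst. Qed.

End AdaptedBool.

(** * Passage from the discrete inequality to processes *)


Section CellMartingale.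
Context {R : realType} {dO : measure_display} {Omega : measurableType dO}.
Context {d : nat}.
Variables (P : probability Omega R) (T : R) (B : Omega -> R -> 'rV[R]_d).
Hypotheses (Pcomplete : measure_is_complete P) (hB : is_brownian_motion P T B).

(** On a cell the integrand is known at the left endpoint, so the linear and the compensated
    quadratic terms have mean zero; what remains is bounded by the second and fourth moments of the
    increment. *)
Lemma cell_expectation (x : Omega -> R -> R) (v : Omega -> R -> 'rV[R]_d) (L : seq R)
  (s t C Ca eps1 K4 : R) (a1 a2 : Omega -> R) :
  elementary P T B x v L -> 0 <= s -> s <= t -> t <= T ->
  (forall y, y \in L -> ~~ (s < y < t)) -> (forall w r i, `|v w r 0 i| <= C) ->
  adapted_at P B s a1 -> adapted_at P B s a2 ->
  (forall w, `|a1 w| <= Ca) -> (forall w, `|a2 w| <= Ca) -> 0 <= eps1 -> 0 <= K4 ->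
  let z w := x w t - x w s in
  let c w := if s < t then v w t else 0 in
  let X w := a1 w * z w + a2 w * (z w ^+ 2 - enorm (c w) ^+ 2 * (t - s))
             - (eps1 * z w ^+ 2 + K4 * z w ^+ 4) in
  rvL1 P X /\ - (eps1 * (d%:R * C) ^+ 2 * (t - s)
                 + K4 * (1024 * (d%:R * C) ^+ 4 * (t - s) ^+ 2)) <= rvE P X.
Proof.
move=> el s0 st tT nj vC aa1 aa2 a1C a2C e0 K0 z c X.
(* On a degenerate cell the value of v at t comes from the interval before s, to which [el_cell]
   does not apply; but there all terms vanish. *)
have [st'|] := boolP (s < t); last first.
  rewrite -leNgt => ts; have ss : t = s by apply/eqP; rewrite eq_le st ts.
  have -> : X = cst 0.
    by apply/funext => w; rewrite /X /z ss /cst/=; ring.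
  split; first exact: rvL1_cst.
  by rewrite rvE_cst ss subrr expr0n/= !mulr0 addr0 oppr0.
have [zE _ ac] := el_cell el s0 st' tT nj.
have cE w : c w = v w t by rewrite /c st'.
have zE' : z = (fun w => dotrv (v w t) (B w t - B w s)) by apply/funext => w; exact: zE.
have cC w i : `|v w t 0 i| <= C by exact: vC.
have [l1 e1] := increment_mart1 Pcomplete hB s0 st' tT aa1 ac a1C cC.
have [l2 e2] := increment_mart2 Pcomplete hB s0 st' tT aa2 ac a2C cC.
have [l3 l4 e3 e4] := increment_moments Pcomplete hB s0 st' tT ac cC.
move: l1 e1 l2 e2 l3 l4 e3 e4.
have -> : X = fun w => a1 w * z w + a2 w * (z w ^+ 2 - enorm (v w t) ^+ 2 * (t - s))
             - (eps1 * z w ^+ 2 + K4 * z w ^+ 4) by apply/funext => w; rewrite /X cE.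
rewrite zE' => l1 e1 l2 e2 l3 l4 e3 e4.
have l12 := rvL1D l1 l2.
have l34 := rvL1D (rvL1Z eps1 l3) (rvL1Z K4 l4).
split; first exact: (rvL1B l12 l34).
rewrite (rvEB l12 l34) (rvED l1 l2) e1 e2 addr0 sub0r lerN2.
rewrite (rvED (rvL1Z eps1 l3) (rvL1Z K4 l4)) (rvEZ _ l3) (rvEZ _ l4).
by apply: lerD; [rewrite -mulrA|]; exact: ler_wpM2l.
Qed.

End CellMartingale.

Section RunAdapted.
Context {R : realType} {dO : measure_display} {Omega : measurableType dO}.
Context {d : nat}.
Variables (P : probability Omega R) (B : Omega -> R -> 'rV[R]_d).
Local Notation adapted := (adapted_at P B).
Variables (alpha gam c0 N eta gam2 : R) (m : nat) (s : nat -> R).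
Hypothesis ss : forall j, (j < m)%N -> s j <= s j.+1.
Variables (F J A x M U e v : Omega -> nat -> R).
Hypotheses (aF : forall j, (j <= m)%N -> adapted (s j) (F^~ j))
  (aJ : forall j, (j <= m)%N -> adapted (s j) (J^~ j))
  (aA : forall j, (j <= m)%N -> adapted (s j) (A^~ j))
  (ax : forall j, (j <= m)%N -> adapted (s j) (x^~ j))
  (aM : forall j, (j <= m)%N -> adapted (s j) (M^~ j))
  (aU : forall j, (j <= m)%N -> adapted (s j) (U^~ j))
  (ae : forall j, (j <= m)%N -> adapted (s j) (e^~ j))
  (av : forall j, (j < m)%N -> adapted (s j) (v^~ j)).

Let cstA (t c : R) : adapted t (fun=> c).
Proof. exact: measurable_cst. Qed.

Let addA t X Y : adapted t X -> adapted t Y -> adapted t (fun w => X w + Y w).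
Proof. by move=> hX hY; exact: measurable_funD. Qed.

Let subA t X Y : adapted t X -> adapted t Y -> adapted t (fun w => X w - Y w).
Proof. by move=> hX hY; exact: measurable_funB. Qed.

Let mulA t X Y : adapted t X -> adapted t Y -> adapted t (fun w => X w * Y w).
Proof. by move=> hX hY; exact: measurable_funM. Qed.

Let normA t X : adapted t X -> adapted t (fun w => `|X w|).
Proof. by move=> hX; apply: measurableT_comp hX; exact: normr_measurable. Qed.

Lemma dsm_ok_adapted j : (j <= m)%N ->
  adaptedb P B (s j) (fun w => dsm_ok N (F w) (J w) (A w) (x w) (U w) j).
Proof.
move=> jm; have hF := aF jm; have hJ := aJ jm; have hA := aA jm; have hx := ax jm.
have hU := aU jm.
apply: adaptedb_and; first exact: adaptedb_ler.
apply: adaptedb_and; first by apply: adaptedb_ler => //; exact: normA.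
apply: adaptedb_and; first by apply: adaptedb_and; exact: adaptedb_ler.
by apply: adaptedb_ler => //; apply: normA; exact: addA.
Qed.

Lemma dsm_good_adapted j : (j < m)%N ->
  adaptedb P B (s j.+1) (fun w => dsm_good alpha gam c0 s (F w) (J w) (A w) (x w) (M w) (e w)
    (v w) eta gam2 j).
Proof.
move=> jm; have jm' := ltnW jm; have sj := ss jm.
have hF := adapted_le sj (aF jm'); have hJ := adapted_le sj (aJ jm').
have hA := adapted_le sj (aA jm'); have hx := adapted_le sj (ax jm').
have hM := adapted_le sj (aM jm'); have he := adapted_le sj (ae jm').
have hv := adapted_le sj (av jm).
have hF' := aF jm; have hJ' := aJ jm; have hA' := aA jm; have hx' := ax jm.
have hM' := aM jm; have he' := ae jm.
apply: adaptedb_and; first by apply: adaptedb_ler => //; exact: subA.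
apply: adaptedb_and; first by apply: adaptedb_ler => //; apply: normA; exact: subA.
apply: adaptedb_and; first by apply: adaptedb_ler => //; apply: normA; exact: subA.
apply: adaptedb_and; first exact: adaptedb_ler.
apply: adaptedb_and; first by apply: adaptedb_ler => //; apply: subA => //; exact: subA.
apply: adaptedb_ler; first by apply: subA; exact: subA.
apply: addA; apply: mulA => //; last exact: subA.
apply: addA; first by apply: mulA => //; apply: addA => //; apply: normA; exact: addA.
apply: mulA => //.
by have := measurableT_comp (measurable_powR alpha) hv.
Qed.

(** The gate of step j depends on the data up to the left endpoint only, since the quality of that
    step is tested in the gate of the next one. The gated terms thus remain martingale
    increments. *)
Lemma dsm_run_adapted j : (j <= m)%N ->
  adaptedb P B (s j) (fun w => dsm_run alpha gam c0 N s (F w) (J w) (A w) (x w) (M w) (U w)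
    (e w) (v w) eta gam2 j).
Proof.
elim: j => [|j IH] jm.
  apply: adaptedb_and; last exact: dsm_ok_adapted.
  apply: adaptedb_and; apply: adaptedb_ler => //; last exact: ae.
  by apply: normA; apply: subA; [exact: ax|exact: aM].
apply: adaptedb_and; first by apply: adaptedb_le (ss jm) (IH (ltnW jm)).
by apply: adaptedb_and; [exact: dsm_good_adapted|exact: dsm_ok_adapted].
Qed.

End RunAdapted.


(** * The discrete hypotheses along a single path *)

Section SchemePath.
Context {R : realType}.
Variables (alpha beta gamma T t0 N eta : R) (U M F J x e : R -> R) (v s : nat -> R) (m : nat).
Hypotheses (t00 : 0 <= t0) (t0T : t0 <= T) (beta0 : 0 <= beta) (gamma0 : 0 <= gamma)
  (eta0 : 0 < eta) (eta1 : eta <= 1).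
Hypotheses
  (hF : forall a b, 0 <= a -> a <= b -> b <= T ->
    [/\ 0 <= F a, F a <= F b, F a <= J a & J a - F a <= J b - F b])
  (he : forall a b, 0 <= a -> a <= b -> b <= T -> 0 <= e a <= e b)
  (sj : forall j, (j <= m)%N -> t0 <= s j <= T)
  (ss : forall j, (j < m)%N -> s j <= s j.+1 < s j + eta)
  (v0 : forall j, 0 <= v j).

Let A j := U (s j) - M (s j).
Let Fs j := F (s j).
Let Js j := J (s j).
Let Ms j := M (s j).
Let Us j := U (s j).
Let xs j := x (s j).
Let es j := e (s j).

Let s0 j : (j <= m)%N -> 0 <= s j <= T.
Proof. by move=> /sj/andP[h1 h2]; rewrite h2 (le_trans t00 h1). Qed.

Lemma scheme_dsm_hyp : dsm_hyp T s Fs Js A Ms Us es v eta m.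
Proof.
have /andP[a0 b0] := s0 (leq0n m).
have step j : (j < m)%N -> [/\ 0 <= s j, s j <= s j.+1 & s j.+1 <= T].
  move=> jm; have /andP[? _] := s0 (ltnW jm); have /andP[_ ?] := s0 jm.
  by have /andP[? _] := ss jm.
split.
- by [].
- by move=> j /s0/andP[].
- exact: ss.
- by have [] := hF a0 (lexx _) b0.
- by move=> j /step[h1 h2 h3]; have [] := hF h1 h2 h3.
- by have [] := hF a0 (lexx _) b0.
- by move=> j /step[h1 h2 h3]; have [] := hF h1 h2 h3.
- by have /andP[] := he a0 (lexx _) b0.
- by move=> j /step[h1 h2 h3]; have /andP[] := he h1 h2 h3.
- by move=> j _; exact: v0.
- by move=> j _; rewrite /A /Us /Ms subrK.
Qed.

Hypotheses
  (xM : forall t, 0 <= t <= T -> `|x t - M t| <= eta)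
  (eT : e T <= eta)
  (oU : forall j r, (j < m)%N -> s j <= r <= s j.+1 -> `|U r - U (s j)| <= 1)
  (oM : forall j, (j < m)%N -> `|M (s j.+1) - M (s j)| <= eta)
  (oJ : forall j, (j < m)%N -> `|J (s j.+1) - J (s j)| <= eta)
  (hA : forall a b, 0 <= a -> a <= b -> b <= T ->
    (U a - M a) - (J b - J a) <= U b - M b)
  (hD : forall j K, (j < m)%N -> (forall r, s j <= r <= s j.+1 -> `|U r| <= K) ->
    (J (s j.+1) - F (s j.+1)) - (J (s j) - F (s j)) <=
    (beta * K + 2 * gamma * v j `^ alpha + 2 * gamma) * (s j.+1 - s j)
    + 2 * gamma * (e (s j.+1) - e (s j))).

Lemma scheme_start : dsm_start xs Ms es eta.
Proof.
have h := s0 (leq0n m); have /andP[a0 b0] := h.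
rewrite /dsm_start xM//=; apply: le_trans eT.
by have /andP[] := he a0 b0 (lexx _).
Qed.

Let uU j : (j <= m)%N -> `|A j + xs j - Us j| <= eta.
Proof.
move=> /s0 h; rewrite (_ : _ - _ = x (s j) - M (s j)); first exact: xM.
by rewrite /A /xs /Us; ring.
Qed.

Lemma scheme_good j : (j < m)%N ->
  dsm_good alpha (2 * gamma) (2 * beta + 2 * gamma) s Fs Js A xs Ms es v eta (2 * gamma) j.
Proof.
move=> jm; have /andP[a0 _] := s0 (ltnW jm); have /andP[_ bT] := s0 jm.
have /andP[ab _] := ss jm.
apply/and5P; split; last (apply/andP; split).
- by apply: le_trans (ler_norm _) (oJ jm).
- exact: oM.
- by apply: xM; exact: s0.
- by apply: le_trans eT; have /andP[] := he (le_trans a0 ab) bT (lexx _).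
- exact: hA.
- have ? := eta1; have ? := beta0; have ? := gamma0.
  have uj := uU (ltnW jm).
  have h : `|Us j| <= `|A j + xs j| + 1.
    have -> : Us j = A j + xs j - (A j + xs j - Us j) by ring.
    by have := ler_normB (A j + xs j) (A j + xs j - Us j); lra.
  (* One unit covers the distance from u to U at the grid point, the other the oscillation of U on
     the cell. Since beta (|u| + 2) is at most 2 beta (1 + |u|), this explains the constant 2 beta +
     2 gamma. *)
  apply: le_trans (hD (K := `|A j + xs j| + 2) jm _) _.
    move=> r rj; have our := oU jm rj.
    have -> : U r = Us j + (U r - U (s j)) by rewrite /Us; ring.
    by have := ler_normD (Us j) (U r - U (s j)); lra.
  rewrite lerD2r; apply: ler_wpM2r; first by rewrite subr_ge0.
  have b1 : 0 <= beta * `|A j + xs j| by rewrite mulr_ge0.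
  have b2 : 0 <= gamma * `|A j + xs j| by rewrite mulr_ge0.
  by move: b1 b2; move: (`|A j + xs j|) (v j `^ alpha) => a b *; nra.
Qed.

Lemma scheme_ok : (forall t, 0 <= t <= T -> (J t <= N) && (`|U t| <= N)) ->
  forall j, (j <= m)%N -> dsm_ok N Fs Js A xs Us j.
Proof.
move=> h j jm; have sjT := s0 jm; have /andP[a0 bT] := sjT.
have /andP[h1 h2] := h _ sjT; have [f1 _ f2 _] := hF a0 (lexx _) bT.
have uj := uU jm; have ? := eta1.
apply/and4P; split => //; first by rewrite f1 (le_trans f2 h1).
have -> : A j + xs j = Us j + (A j + xs j - Us j) by ring.
by have := ler_normD (Us j) (A j + xs j - Us j); rewrite /Us in uj *; lra.
Qed.

End SchemePath.


(** * The bound for processes satisfying a one-sided drift estimate *)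

Section Scheme.
Context {R : realType} {dO : measure_display} {Omega : measurableType dO}.
Context {d : nat}.
Variables (P : probability Omega R) (T : R) (B : Omega -> R -> 'rV[R]_d).
Hypotheses (Pcomplete : measure_is_complete P) (hB : is_brownian_motion P T B)
  (T0 : 0 < T).
Variables (alpha beta gamma : R).
Hypotheses (beta0 : 0 <= beta) (gamma0 : 0 < gamma).

Definition l2dist (v V : Omega -> R -> 'rV[R]_d) (w : Omega) (t : R) : R :=
  fine (\int[lebesgue_measure]_(s in `[0%R, t]) (enorm (v w s - V w s) ^+ 2)%:E)%E.

(** Isolates what the limit argument uses about U. By [sc_A], U - M falls by no more than J rises.
    By [sc_D], J - F is controlled on a cell where the approximating integrand has a constant value
    c; the error is an increment of the squared L2 distance, so it telescopes. *)
Record scheme_hyp (U M F J : Omega -> R -> R) (V : Omega -> R -> 'rV[R]_d) : Prop := {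
  sc_adapted : forall t, 0 <= t <= T -> [/\ adapted_at P B t (U^~ t),
    adapted_at P B t (M^~ t), adapted_at P B t (F^~ t) & adapted_at P B t (J^~ t)];
  sc_U : {ae P, forall w, {within `[0, T], continuous (U w)}};
  sc_M : {ae P, forall w, {within `[0, T], continuous (M w)}};
  sc_J : {ae P, forall w, {within `[0, T], continuous (J w)}};
  sc_F : {ae P, forall w, forall a b, 0 <= a -> a <= b -> b <= T ->
    [/\ 0 <= F w a, F w a <= F w b, F w a <= J w a & J w a - F w a <= J w b - F w b]};
  sc_A : {ae P, forall w, forall a b, 0 <= a -> a <= b -> b <= T ->
    (U w a - M w a) - (J w b - J w a) <= U w b - M w b};
  sc_V : progressive_rv P T B V;
  sc_approx : forall eta rho : R, 0 < eta -> 0 < rho ->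
    exists x v L, elementary P T B x v L /\ almost_prob P (fun w =>
    (forall t, 0 <= t <= T -> `|x w t - M w t| <= eta) /\
    (\int[lebesgue_measure]_(t in `[0%R, T]) (enorm (v w t - V w t) ^+ 2)%:E <= eta%:E)%E) rho;
  sc_D : forall x v L, elementary P T B x v L ->
    {ae P, forall w, forall a b, 0 <= a -> a <= b -> b <= T ->
      0 <= l2dist v V w a <= l2dist v V w b /\
      forall c K, (forall r, a <= r <= b -> `|U w r| <= K) ->
        (forall r, a < r <= b -> v w r = c) ->
        (J w b - F w b) - (J w a - F w a) <=
        (beta * K + 2 * gamma * enorm c `^ alpha + 2 * gamma) * (b - a)
        + 2 * gamma * (l2dist v V w b - l2dist v V w a)} }.

Variables (G Gs Gx Gxx : R -> R -> R -> R).
Hypothesis tfH : is_test_function alpha (2 * gamma) (2 * beta + 2 * gamma) G Gs Gx Gxx.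

Lemma l2dist_adapted v V t : progressive_rv P T B v -> progressive_rv P T B V ->
  0 <= t <= T -> adapted_at P B t (fun w => l2dist v V w t).
Proof.
move=> pv pV tT; rewrite /adapted_at /l2dist.
have h := @progressive_integral_adapted _ _ _ _ P T B (fun w s => enorm (v w s - V w s) ^+ 2) t.
apply: (measurableT_comp (f := fine)); first exact: fine_measurable.
apply: h => // [|w s]; last exact: sqr_ge0.
apply: (progressive_comp (f := fun y => y ^+ 2)); first exact: measurable_funX.
apply: progressive_enorm.
have -> : (fun w t => v w t - V w t) = (fun w t => 1 *: v w t - 1 *: V w t).
  by apply/funext => w; apply/funext => r; rewrite !scale1r.
exact: progressive_rv_comb.
Qed.

Lemma test_coef_bounded (g : R -> R -> R -> R) (N : R) :
  continuous (fun v : R * R * R => g v.1.1 v.1.2 v.2) -> exists2 C : R, 0 <= C &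
  forall s F x : R, 0 <= s <= T -> 0 <= F <= N -> `|x| <= N + 1 -> `|g s F x| <= C.
Proof.
move=> cg; have [C hC] := cube_bounded (T + `|N| + 1) cg.
exists `|C| => // s F x /andP[s0 sT] /andP[F0 FN] xN.
apply: le_trans (ler_norm C); have ? := T0; have ? := ler_norm N.
by apply: (hC s F x); rewrite ?(ger0_norm s0) ?(ger0_norm F0); lra.
Qed.

Let arith (a a' b b' c c' p q : R) : a <= a' + b -> c <= c' -> c' + b <= 1 ->
  a' + b' <= 3 + c + p + q -> -1 <= b' -> a <= 5 + p + q.
Proof. by move=> *; lra. Qed.

(** The expectation of the discrete sum is bounded below by its initial value up to the small moment
    terms, and above by the three bounds of [dsm_bound]. The 5 consists of 3 from [dsm_bound], 1
    from the moment terms and 1 from the exceptional event. *)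
Lemma scheme_bound (U M F J : Omega -> R -> R) (V : Omega -> R -> 'rV[R]_d) (N t0 y : R)
  (Om : set Omega) (Phi1 Phi2 : Omega -> R) :
  scheme_hyp U M F J V -> 0 <= N -> 0 <= t0 <= T -> measurable Om ->
  {ae P, forall w, Om w -> forall t, 0 <= t <= T -> (J w t <= N) && (`|U w t| <= N)} ->
  rvL1 P Phi1 -> rvL1 P Phi2 -> (forall w, 0 <= Phi1 w) -> (forall w, 0 <= Phi2 w) ->
  {ae P, forall w, G T (F w T) (U w T + 1) <= Phi1 w} ->
  {ae P, forall w, forall t, 0 <= t <= T -> G t (F w t) (U w t + 1) <= Phi2 w} ->
  G 0 0 (y - 1) * fine (P ([set w | y <= U w t0] `&` Om)) <=
  5 + rvE P Phi1 + rvE P (fun w => \1_(~` Om) w * Phi2 w).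
Proof.
move=> H N0 /andP[t00 t0T] mOm hOm L1 L2 P10 P20 hP1 hP2.
set g := G 0 0 (y - 1).
have g0 : 0 < g by exact: (tf_gt0 tfH).
have gam20 : 0 <= 2 * gamma by rewrite mulr_ge0// ltW.
have [CH [eta [CH0 e0 e1 hb]]] := dsm_bound (ltW T0) N0 tfH gam20.
(* The exceptional event costs CH in the upper bound and g in the lower one, so
   [(CH + g) * rho <= 1] is needed. It is shared by four events: the approximation, and the
   oscillations of U, M and J. *)
pose rho := (CH + g + 1)^-1.
have cg0 : 0 < CH + g + 1 by lra.
have r40 : 0 < rho / 4 by rewrite divr_gt0 ?invr_gt0.
have [x [v [L [el ap]]]] := sc_approx H e0 r40.
have meas t X : 0 <= t <= T -> adapted_at P B t X -> measurable_fun setT X.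
  by move=> /andP[_ tT]; exact: (adapted_measurable Pcomplete hB tT).
have mU t : 0 <= t <= T -> measurable_fun setT (U^~ t).
  by move=> tT; have [h _ _ _] := sc_adapted H tT; exact: meas tT h.
have mM t : 0 <= t <= T -> measurable_fun setT (M^~ t).
  by move=> tT; have [_ h _ _] := sc_adapted H tT; exact: meas tT h.
have mJ t : 0 <= t <= T -> measurable_fun setT (J^~ t).
  by move=> tT; have [_ _ _ h] := sc_adapted H tT; exact: meas tT h.
have [dU dU0 aU] := almost_osc T0 mU (sc_U H) ltr01 r40.
have [dM dM0 aM] := almost_osc T0 mM (sc_M H) e0 r40.
have [dJ dJ0 aJ] := almost_osc T0 mJ (sc_J H) e0 r40.
have [Bad [mBad PBad hBad]] := almost_prob_and (almost_prob_and ap aU) (almost_prob_and aM aJ).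
have [C C0 vC] := el_bounded el.
pose Q := (d%:R * C) ^+ 2.
have Q0 : 0 <= Q by exact: sqr_ge0.
(* The order of choices matters: the approximant fixes Q, then eps1 fixes K4, and the mesh delta
   comes last. Summed over the grid the quadratic errors are at most eps1 Q T and the quartic ones
   at most Q4 delta T, each at most 1/2. *)
pose eps1 := (2 * (Q * T + 1))^-1.
have QT0 : 0 < 2 * (Q * T + 1) by rewrite mulr_gt0// ltr_pwDr// mulr_ge0// ltW.
have eps10 : 0 < eps1 by rewrite invr_gt0.
have [K4 K40 hb'] := hb eps1 eps10.
pose Q4 := K4 * (1024 * (d%:R * C) ^+ 4).
have Q40 : 0 <= Q4.
  by apply: mulr_ge0; [exact: K40|apply: mulr_ge0; [exact: ler0n|exact: exprn_even_ge0]].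
have Q4T0 : 0 < 2 * (Q4 * T + 1) by rewrite mulr_gt0// ltr_pwDr// mulr_ge0// ltW.
pose delta := Num.min (Num.min (Num.min dU dM) (Num.min dJ eta)) (2 * (Q4 * T + 1))^-1.
have delta0 : 0 < delta by rewrite !lt_min dU0 dM0 dJ0 e0 invr_gt0.
have [dlU dlM dlJ dle dlQ] : [/\ delta <= dU, delta <= dM, delta <= dJ, delta <= eta &
    delta <= (2 * (Q4 * T + 1))^-1].
  have h1 : delta <= Num.min (Num.min dU dM) (Num.min dJ eta) by rewrite ge_min lexx.
  have h2 : Num.min (Num.min dU dM) (Num.min dJ eta) <= Num.min dU dM by rewrite ge_min lexx.
  have h3 : Num.min (Num.min dU dM) (Num.min dJ eta) <= Num.min dJ eta.
    by rewrite ge_min lexx orbT.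
  split; first by apply: le_trans h1 _; apply: le_trans h2 _; rewrite ge_min lexx.
  - by apply: le_trans h1 _; apply: le_trans h2 _; rewrite ge_min lexx orbT.
  - by apply: le_trans h1 _; apply: le_trans h3 _; rewrite ge_min lexx.
  - by apply: le_trans h1 _; apply: le_trans h3 _; rewrite ge_min lexx orbT.
  - by rewrite ge_min lexx orbT.
have [m [s [s0 sm sI ss sL]]] := exists_partition L t0T delta0.
have sT j : (j <= m)%N -> 0 <= s j <= T.
  by move=> /sI/andP[h1 h2]; rewrite h2 (le_trans t00 h1).
have ss1 j : (j < m)%N -> s j <= s j.+1 by move=> /ss/andP[].
pose c (j : nat) (w : Omega) := if s j < s j.+1 then v w (s j.+1) else 0.
pose sF w j := F w (s j).
pose sJ w j := J w (s j).
pose sA w j := U w (s j) - M w (s j).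
pose sx w j := x w (s j).
pose sM w j := M w (s j).
pose sU w j := U w (s j).
pose se w j := l2dist v V w (s j).
pose sv w j := enorm (c j w).
pose run j w := dsm_run alpha (2 * gamma) (2 * beta + 2 * gamma) N s (sF w) (sJ w) (sA w)
  (sx w) (sM w) (sU w) (se w) (sv w) eta (2 * gamma) j.
pose a1 j w := if run j w then Gx (s j) (sF w j) (sA w j + sx w j) else 0.
pose a2 j w := if run j w then Gxx (s j) (sF w j) (sA w j + sx w j) / 2 else 0.
pose z j w := x w (s j.+1) - x w (s j).
pose X j w := a1 j w * z j w + a2 j w * (z j w ^+ 2 - enorm (c j w) ^+ 2 * (s j.+1 - s j))
             - (eps1 * z j w ^+ 2 + K4 * z j w ^+ 4).
have aF j : (j <= m)%N -> adapted_at P B (s j) (sF^~ j).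
  by move=> /sT h; have [] := sc_adapted H h.
have aJ' j : (j <= m)%N -> adapted_at P B (s j) (sJ^~ j).
  by move=> /sT h; have [] := sc_adapted H h.
have aU' j : (j <= m)%N -> adapted_at P B (s j) (sU^~ j).
  by move=> /sT h; have [] := sc_adapted H h.
have aM' j : (j <= m)%N -> adapted_at P B (s j) (sM^~ j).
  by move=> /sT h; have [] := sc_adapted H h.
have aA j : (j <= m)%N -> adapted_at P B (s j) (sA^~ j).
  by move=> jm; apply: measurable_funB; [exact: aU'|exact: aM'].
have ax j : (j <= m)%N -> adapted_at P B (s j) (sx^~ j).
  by move=> /sT h; exact: (el_adapted el h).
have ae j : (j <= m)%N -> adapted_at P B (s j) (se^~ j).
  by move=> /sT h; apply: l2dist_adapted h; [exact: el_progressive el|exact: sc_V H].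
have jL j : (j < m)%N -> forall r, r \in L -> ~~ (s j < r < s j.+1).
  by move=> jm r; exact: sL.
have ac j i : (j < m)%N -> adapted_at P B (s j) (fun w => c j w 0 i).
  move=> jm; rewrite /c; have [h|_] := boolP (s j < s j.+1); last first.
    rewrite (_ : (fun _ => _) = cst 0); first exact: measurable_cst.
    by apply/funext => w; rewrite mxE.
  have /andP[h1 _] := sT _ (ltnW jm); have /andP[_ h2] := sT _ jm.
  by have [_ _] := el_cell el h1 h h2 (jL j jm); apply.
have av j : (j < m)%N -> adapted_at P B (s j) (sv^~ j).
  move=> jm; apply: (measurableT_comp (f := @Num.sqrt R)).
    by apply: continuous_measurable_fun; exact: sqrt_continuous.
  by apply: measurable_sum => i; apply: measurable_funM; exact: ac.
have arun j : (j <= m)%N -> adaptedb P B (s j) (run j).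
  by move=> jm; exact: (dsm_run_adapted _ _ _ _ _ _ ss1 aF aJ' aA ax aM' aU' ae av jm).
have [C1 C10 hC1] := test_coef_bounded N (tf_cont_x tfH).
have [C2 C20 hC2] := test_coef_bounded N (tf_cont_xx tfH).
have runok j w : run j w -> dsm_ok N (sF w) (sJ w) (sA w) (sx w) (sU w) j.
  by case: j => [|j] /=; [move=> /andP[]|move=> /and3P[]].
have hX j : (j < m)%N -> rvL1 P (X j) /\
    - (eps1 * Q * (s j.+1 - s j) + Q4 * delta * (s j.+1 - s j)) <= rvE P (X j).
  move=> jm; have jT := sT _ (ltnW jm).
  have /andP[h1 _] := jT; have /andP[_ h2] := sT _ jm.
  have aAx : adapted_at P B (s j) (fun w => sA w j + sx w j).
    by apply: measurable_funD; [exact: aA (ltnW jm)|exact: ax (ltnW jm)].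
  have [] := @cell_expectation _ _ _ _ P T B Pcomplete hB x v L (s j) (s j.+1) C
    (C1 + C2) eps1 K4 (a1 j) (a2 j) el h1 (ss1 _ jm) h2 (jL j jm) vC.
  - apply: adapted_if; first exact: arun (ltnW jm).
    by apply: (tf_meas_x tfH) => //; exact: aF (ltnW jm).
  - apply: adapted_if; first exact: arun (ltnW jm).
    apply: measurable_funM => //.
    by apply: (tf_meas_xx tfH) => //; exact: aF (ltnW jm).
  - move=> w; rewrite /a1; case: ifP => [|_]; last by rewrite normr0 addr_ge0.
    move=> /runok/and4P[_ _ h3 h4].
    by apply: le_trans (hC1 _ _ _ jT h3 h4) _; rewrite lerDl.
  - move=> w; rewrite /a2; case: ifP => [|_]; last by rewrite normr0 addr_ge0.
    move=> /runok/and4P[_ _ h3 h4].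
    rewrite normrM (@ger0_norm _ 2^-1)// ler_pdivrMr//.
    apply: le_trans (hC2 _ _ _ jT h3 h4) _.
    have -> : (C1 + C2) * 2 = C2 + (C1 + C1 + C2) by ring.
    by rewrite lerDl !addr_ge0.
  - exact: ltW.
  - exact: K40.
  move=> l1 l2; split; first exact: l1.
  apply: le_trans l2; rewrite lerN2 lerD// mulrA -/Q4 -mulrA ler_wpM2l//.
  have /andP[h3 h4] := ss _ jm.
  by rewrite expr2 ler_wpM2r ?subr_ge0// lerBlDl ltW.
have tele : \sum_(j < m) (s j.+1 - s j) = T - t0.
  by rewrite -(big_mkord xpredT (fun j => s j.+1 - s j)) telescope_sumr// s0 sm.
have EX : -1 <= rvE P (fun w => \sum_(j < m) X j w).
  rewrite rvE_sum; last by move=> j; have [] := hX j (ltn_ord j).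
  have : \sum_(j < m) - (eps1 * Q * (s j.+1 - s j) + Q4 * delta * (s j.+1 - s j)) <=
      \sum_(j < m) rvE P (X j).
    by apply: ler_sum => j _; have [] := hX j (ltn_ord j).
  rewrite sumrN big_split/= -!mulr_sumr tele; apply: le_trans; rewrite lerN2.
  have h1 : eps1 * Q * (T - t0) <= 1 / 2.
    have : eps1 * Q * (T - t0) <= eps1 * (Q * T + 1).
      rewrite -mulrA; apply: ler_wpM2l; first exact: ltW.
      have h : 0 <= Q * t0 by exact: mulr_ge0.
      by rewrite mulrBr lerBlDr -addrA lerDl addr_ge0.
    move/le_trans; apply; rewrite /eps1 invfM -mulrA mulVf ?mulr1 ?mul1r//.
    by move: QT0; rewrite pmulr_rgt0// => /lt0r_neq0.
  have h2 : Q4 * delta * (T - t0) <= 1 / 2.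
    have : Q4 * delta * (T - t0) <= (2 * (Q4 * T + 1))^-1 * (Q4 * T + 1).
      have h3 : Q4 * delta * (T - t0) <= delta * (Q4 * T + 1).
        rewrite mulrAC mulrC; apply: ler_wpM2l; first exact: ltW.
        have h : 0 <= Q4 * t0 by exact: mulr_ge0.
        by rewrite mulrBr lerBlDr -addrA lerDl addr_ge0.
      apply: le_trans h3 _; apply: ler_wpM2r => //.
      by move: Q4T0; rewrite pmulr_rgt0// => /ltW.
    move/le_trans; apply; rewrite invfM -mulrA mulVf ?mulr1 ?mul1r//.
    by move: Q4T0; rewrite pmulr_rgt0// => /lt0r_neq0.
  by rewrite [leRHS]splitr; exact: lerD.
pose E1 := [set w | y <= U w t0] `&` Om.
have mE1 : measurable E1.
  apply: measurableI => //.
  by apply: measurable_set_le; [exact: measurable_cst|apply: mU; rewrite t00].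
pose E0 := E1 `\` Bad.
have mE0 : measurable E0 by exact: measurableD.
have key : {ae P, forall w, g * \1_E0 w + \sum_(j < m) X j w <=
    3 + CH * \1_Bad w + Phi1 w + \1_(~` Om) w * Phi2 w}.
  apply: (filterS _ (filterI (sc_F H) (filterI (sc_A H) (filterI (sc_D H el)
    (filterI hOm (filterI hP1 hP2)))))).
  move=> w [hF [hA [hD [hOmw [hP1w hP2w]]]]].
  have he a b : 0 <= a -> a <= b -> b <= T -> 0 <= l2dist v V w a <= l2dist v V w b.
    by move=> h1 h2 h3; have [] := hD a b h1 h2 h3.
  have sse j : (j < m)%N -> s j <= s j.+1 < s j + eta.
    move=> /ss/andP[h1 h2]; rewrite h1 (lt_le_trans h2)//.
    by apply: lerD; [exact: lexx|exact: dle].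
  have v0 j : 0 <= sv w j by exact: sqrtr_ge0.
  have hyp := scheme_dsm_hyp (U w) (M w) t00 hF he sI sse v0.
  have [b1 b2 b3] := hb' _ _ _ _ (sx w) _ _ _ _ _ hyp.
  (* [X j] subtracts the quadratic and quartic errors on every step, while [dsm_sum] does so only
     while the gate is open, so the ungated version is smaller. *)
  have low (b : R) : (run 0%N w -> b <= G (s 0%N) (sF w 0%N) (sA w 0%N + sx w 0%N)) ->
      (~~ run 0%N w -> b <= 0) -> b + \sum_(j < m) X j w <=
      dsm_sum alpha (2 * gamma) (2 * beta + 2 * gamma) N G Gx Gxx s (sF w) (sJ w) (sA w) (sx w)
        (sM w) (sU w) (se w) (sv w) eta (2 * gamma) eps1 K4 m.
    move=> r1 r2; rewrite /dsm_sum; apply: lerD.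
      by rewrite -/(run 0%N w); case: ifP r1 r2 => [_ h _|_ _ h]; exact: h.
    apply: ler_sum => j _; rewrite -/(run j w) /X /a1 /a2.
    case: ifP => _; first by rewrite /dsm_mart opprD addrA.
    rewrite !mul0r addr0 sub0r oppr_le0.
    by apply: addr_ge0; apply: mulr_ge0; [exact: ltW|exact: sqr_ge0|exact: K40|exact: exprn_even_ge0].
  have ind A : 0 <= \1_A w :> R by rewrite indicE.
  have hB0 : 0 <= CH * \1_Bad w by exact: mulr_ge0.
  have hO0 : 0 <= \1_(~` Om) w * Phi2 w by exact: mulr_ge0.
  have [wB|wB] := pselect (Bad w).
    have h : g * \1_E0 w + \sum_(j < m) X j w <= 3 + CH.
      apply: le_trans b1; apply: low; rewrite indicE memNset ?mulr0//.
      - by move=> _; exact: ltW (tf_gt0 tfH _ _ _).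
      - by move=> [].
      - by move=> [].
    apply: le_trans h _; rewrite indicE mem_set//= mulr1 -[leRHS]addrA.
    by rewrite lerDl addr_ge0.
  have [[[xM hint] oU] [oM oJ]] := hBad w wB.
  have eT : l2dist v V w T <= eta.
    have i0 : (0 <= \int[lebesgue_measure]_(t in `[0%R, T])
        (enorm (v w t - V w t) ^+ 2)%:E)%E.
      by apply: integral_ge0 => t _; rewrite lee_fin sqr_ge0.
    by rewrite /l2dist -lee_fin fineK// ge0_fin_numE// (le_lt_trans hint)// ltry.
  have st := scheme_start t00 he sI xM eT.
  have dist j r : (j < m)%N -> s j <= r <= s j.+1 -> 0 <= r <= T /\ `|r - s j| < delta.
    move=> jm /andP[r1 r2]; have /andP[u1 u2] := sT _ (ltnW jm).
    have /andP[u3 u4] := sT _ jm; have /andP[u5 u6] := ss _ jm.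
    rewrite (le_trans u1 r1) (le_trans r2 u4); split => //.
    by rewrite ger0_norm ?subr_ge0// ltrBlDl (le_lt_trans r2).
  have dist1 j : (j < m)%N -> 0 <= s j.+1 <= T /\ `|s j.+1 - s j| < delta.
    by move=> jm; apply: dist (jm) _; rewrite (ss1 _ jm) lexx.
  have gd j : (j < m)%N -> dsm_good alpha (2 * gamma) (2 * beta + 2 * gamma) s (sF w) (sJ w) (sA w)
      (sx w) (sM w) (se w) (sv w) eta (2 * gamma) j.
    move=> jm; apply: (scheme_good t00 beta0 (ltW gamma0) e1 he sI sse xM eT) => //.
    - move=> i r im ir; have [u1 u2] := dist _ _ im ir.
      by apply: oU => //; [exact: sT (ltnW im)|exact: lt_le_trans dlU].
    - move=> i im; have [u1 u2] := dist1 _ im.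
      by apply: oM => //; [exact: sT (ltnW im)|exact: lt_le_trans dlM].
    - move=> i im; have [u1 u2] := dist1 _ im.
      by apply: oJ => //; [exact: sT (ltnW im)|exact: lt_le_trans dlJ].
    - move=> i K im hK; have /andP[u1 _] := sT _ (ltnW im); have /andP[_ u2] := sT _ im.
      have [_ hd] := hD _ _ u1 (ss1 _ im) u2; apply: hd => // r ir.
      have /andP[i1 i2] := ir; have lti := lt_le_trans i1 i2.
      rewrite /c lti; have [_ hc _] := el_cell el u1 lti u2 (jL i im).
      exact: hc.
  have low' : g * \1_E0 w + \sum_(j < m) X j w <=
      dsm_sum alpha (2 * gamma) (2 * beta + 2 * gamma) N G Gx Gxx s (sF w) (sJ w) (sA w) (sx w)
        (sM w) (sU w) (se w) (sv w) eta (2 * gamma) eps1 K4 m.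
    (* On [E0] the gate is open at the start and u is at least [U - eta], hence at least [y - 1];
       elsewhere the indicator vanishes and positivity of G suffices. *)
    have [wE|wE] := pselect (E0 w); last first.
      apply: low; rewrite indicE memNset ?mulr0// => _.
      exact: ltW (tf_gt0 tfH _ _ _).
    have [[yU wO] _] := wE.
    have ok0 := scheme_ok t00 e1 hF sI xM (hOmw wO) (leq0n m).
    apply: low; last by rewrite /run/= st ok0.
    move=> _; rewrite indicE mem_set//= mulr1.
    have /andP[u1 u2] := sT _ (leq0n m).
    have [f0 _ _ _] := hF _ _ u1 (lexx _) u2.
    apply: (tf_le tfH) => //.
    have := xM _ (sT _ (leq0n m)); rewrite ler_norml => /andP[+ _].
    rewrite /= in yU; rewrite /sA /sx s0 => q1.
    have -> : U w t0 - M w t0 + x w t0 = U w t0 + (x w t0 - M w t0) by ring.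
    by apply: lerD => //; apply: le_trans q1; rewrite lerN2.
  apply: (le_trans low'); rewrite [in leRHS]indicE memNset// mulr0 addr0.
  (* On [Om] the path stays in the box and the sum runs to T, where the terminal bound [Phi1]
     applies. Off [Om] it may freeze at any grid point, so [Phi2] must dominate along the whole
     path. *)
  have [wO|wO] := pselect (Om w).
    have ok j : (j <= m)%N -> dsm_ok N (sF w) (sJ w) (sA w) (sx w) (sU w) j.
      by move=> jm; exact: scheme_ok t00 e1 hF sI xM (hOmw wO) _ jm.
    apply: le_trans (b2 st gd ok) _; rewrite -[leRHS]addrA lerD2l.
    apply: (@le_trans _ _ (Phi1 w)); last by rewrite lerDl.
    by move: hP1w; rewrite /sF /sU sm.
  apply: le_trans (b3 st gd (Phi2 w) _) _; last first.
    by rewrite -[leRHS]addrA lerD2l indicE mem_set//= mul1r lerDr.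
  by move=> j jm; apply: hP2w; exact: sT.
have LX : rvL1 P (fun w => \sum_(j < m) X j w).
  by apply: rvL1_sum => j; have [] := hX j (ltn_ord j).
have L0 := rvL1Z g (rvL1_indic P mE0).
have LB := rvL1Z CH (rvL1_indic P mBad).
have L2' : rvL1 P (fun w => \1_(~` Om) w * Phi2 w).
  apply: (@rvL1Mb _ _ _ _ _ _ 1) => //.
  - by apply/measurable_indicP; exact: measurableC.
  - by move=> w; rewrite indicE; case: (_ \in _); rewrite ?normr0 ?normr1.
have L3B := rvL1D (rvL1_cst P 3) LB.
have := rvE_ae_le (rvL1D L0 LX) (rvL1D (rvL1D L3B L1) L2') key.
rewrite (rvED L0 LX) (rvED (rvL1D L3B L1) L2') (rvED L3B L1) (rvED (rvL1_cst P 3) LB).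
rewrite !rvEZ; [|exact: rvL1_indic|exact: rvL1_indic].
rewrite !rvE_indic// rvE_cst => fin.
have PB : fine (P Bad) <= rho.
  rewrite -lee_fin fineK ?fin_num_measure//; apply: le_trans PBad _.
  by have -> : rho / 4 + rho / 4 + (rho / 4 + rho / 4) = rho by field.
have PE : fine (P E1) <= fine (P E0) + fine (P Bad).
  rewrite -fineD ?fin_num_measure//; apply: fine_le; rewrite ?fin_num_measure//.
    by rewrite fin_numD !fin_num_measure.
  have sub : E1 `<=` E0 `|` Bad.
    by move=> w h; have [?|?] := pselect (Bad w); [right|left].
  apply: le_trans (measureU2 P mE0 mBad); apply: le_measure => //; rewrite inE//.
  exact: measurableU.
have h1 : g * fine (P E1) <= g * fine (P E0) + g * rho.
  rewrite -mulrDr; apply: ler_wpM2l; first exact: ltW.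
  by apply: le_trans PE _; rewrite lerD2l.
have h2 : CH * fine (P Bad) <= CH * rho by exact: ler_wpM2l.
have h3 : (CH + g) * rho <= 1.
  rewrite ler_pdivrMr// mul1r lerDl; exact: ler01.
move: h3; rewrite mulrDl -/E1 => h3.
exact: arith h1 h2 h3 fin EX.
Qed.

End Scheme.

(** * Differences of solutions *)


Section PathIntegral.
Context {R : realType}.
Variable T : R.
Local Notation mu := (@lebesgue_measure R).
Local Notation itg f := (mu.-integrable `[0, T] (EFin \o f)).
Implicit Types f g : R -> R.

Lemma itv_integrable f (D : set R) : measurable D -> D `<=` `[0, T] -> itg f ->
  mu.-integrable D (EFin \o f).
Proof. by move=> mD DT; apply: integrableS. Qed.

Let sub_oc (a b : R) : 0 <= a -> b <= T -> `]a, b] `<=` `[0, T].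
Proof.
move=> a0 bT r /=; rewrite !in_itv/= => /andP[h1 h2].
by rewrite (le_trans a0 (ltW h1)) (le_trans h2 bT).
Qed.

Let sub_cc (a b : R) : 0 <= a -> b <= T -> `[a, b] `<=` `[0, T].
Proof.
move=> a0 bT r /=; rewrite !in_itv/= => /andP[h1 h2].
by rewrite (le_trans a0 h1) (le_trans h2 bT).
Qed.

Lemma itg_oc f a b : 0 <= a -> b <= T -> itg f -> mu.-integrable `]a, b] (EFin \o f).
Proof. by move=> a0 bT; apply: itv_integrable => //; exact: sub_oc. Qed.

Lemma itg_cc f a b : 0 <= a -> b <= T -> itg f -> mu.-integrable `[a, b] (EFin \o f).
Proof. by move=> a0 bT; apply: itv_integrable => //; exact: sub_cc. Qed.

Lemma Rintegral_sub_start f a b : itg f -> 0 <= a -> a <= b -> b <= T ->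
  \int[mu]_(t in `[0, b]) f t - \int[mu]_(t in `[0, a]) f t = \int[mu]_(t in `]a, b]) f t.
Proof.
move=> hf a0 ab bT; apply: Rintegral_itvB; last 2 first.
- by rewrite bnd_simp.
- by rewrite bnd_simp.
exact: (itg_cc (lexx _) bT hf).
Qed.

Lemma Rintegral_sub_end f a b : itg f -> 0 <= a -> a <= b -> b <= T ->
  \int[mu]_(t in `[a, T]) f t - \int[mu]_(t in `[b, T]) f t = \int[mu]_(t in `]a, b]) f t.
Proof.
move=> hf a0 ab bT.
have h : \int[mu]_(t in `[a, T]) f t - \int[mu]_(t in `[a, b]) f t = \int[mu]_(t in `]b, T]) f t.
  apply: Rintegral_itvB; [exact: (itg_cc a0 (lexx _) hf)| |]; by rewrite bnd_simp.
rewrite -(@Rintegral_itv_obnd_cbnd _ b); last first.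
  by apply: (itg_oc _ (lexx _) hf); exact: le_trans ab.
rewrite -h opprB addrC subrK (@Rintegral_itv_obnd_cbnd _ a)//.
exact: (itg_oc a0 bT hf).
Qed.

Lemma Rintegral_ae_le (D : set R) f g : measurable D -> mu.-integrable D (EFin \o f) ->
  mu.-integrable D (EFin \o g) -> {ae mu, forall t, D t -> f t <= g t} ->
  \int[mu]_(t in D) f t <= \int[mu]_(t in D) g t.
Proof.
move=> mD hf hg fg; rewrite -subr_ge0 -RintegralB//.
have mf : measurable_fun D f by apply/measurable_EFinP; exact: (measurable_int mu hf).
have mg : measurable_fun D g by apply/measurable_EFinP; exact: (measurable_int mu hg).
have mgf : measurable_fun D (fun t : measurableTypeR R => g t - f t) by exact: measurable_funB.
apply: fine_ge0; rewrite (@ae_eq_integral _ _ _ mu D (fun t => `|g t - f t|%:E))//.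
- by apply: integral_ge0 => w _; rewrite lee_fin.
- by apply/measurable_EFinP.
- by apply/measurable_EFinP/measurableT_comp.
- move: fg => [N [mN N0 hN]]; exists N; split => // t /= nt; apply: hN => /= h.
  by apply: nt => Dt; rewrite ger0_norm// subr_ge0 h.
Qed.

Lemma Rintegral_continuous f : 0 <= T -> itg f ->
  {within `[0, T], continuous (fun t => \int[mu]_(s in `[0, t]) f s)}.
Proof. by move=> T0 hf; exact: parameterized_integral_continuous. Qed.

Lemma Rintegral_itv_cst (a b c : R) : a <= b -> \int[mu]_(t in `]a, b]) c = c * (b - a).
Proof.
move=> ab; rewrite Rintegral_cst//; congr (_ * _).
have := @lebesgue_measure_itv R `]a, b]; rewrite /= lte_fin => ->.
by move: ab; rewrite le_eqVlt => /predU1P[->|->] //; rewrite ltxx subrr.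
Qed.

End PathIntegral.

Section EuclideanNorm.
Context {R : realType} {d : nat}.
Implicit Types u v : 'rV[R]_d.

Lemma enorm_sqr u : enorm u ^+ 2 = dotrv u u.
Proof. by rewrite sqr_sqrtr// sumr_ge0// => i _; rewrite -expr2 sqr_ge0. Qed.

Lemma enorm_ge0 u : 0 <= enorm u.
Proof. exact: sqrtr_ge0. Qed.

Lemma enorm_comb_sqr (a b : R) u v :
  enorm (a *: u - b *: v) ^+ 2 <= 2 * a ^+ 2 * enorm u ^+ 2 + 2 * b ^+ 2 * enorm v ^+ 2.
Proof.
rewrite !enorm_sqr /dotrv !mulr_sumr -big_split/=; apply: ler_sum => i _.
rewrite !mxE -subr_ge0.
have -> : 2 * a ^+ 2 * (u 0 i * u 0 i) + 2 * b ^+ 2 * (v 0 i * v 0 i) -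
  (a * u 0 i - b * v 0 i) * (a * u 0 i - b * v 0 i) = (a * u 0 i + b * v 0 i) ^+ 2 by ring.
exact: sqr_ge0.
Qed.

Lemma enorm_sqr_bound u (C : R) : (forall i, `|u 0 i| <= C) -> enorm u ^+ 2 <= d%:R * C ^+ 2.
Proof.
move=> h; rewrite enorm_sqr /dotrv.
have -> : d%:R * C ^+ 2 = \sum_(i < d) C ^+ 2 by rewrite sumr_const card_ord mulr_natl.
apply: ler_sum => i _; rewrite -expr2 -[leLHS]real_normK ?num_real//.
by rewrite ler_sqr ?nnegrE// (le_trans _ (h i)).
Qed.

(** The power alpha of the norm is the power alpha / 2, below 1, of its square: the bound |u|^2 <=
    2|v|^2 + 2|v - u|^2 survives by subadditivity, and t^(alpha/2) is at most 1 + t. The error is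
    then quadratic in v - u, which the L2 approximation controls. *)
Lemma enorm_powR_le (alpha : R) u v : 1 < alpha -> alpha < 2 ->
  enorm u `^ alpha <= 2 * enorm v `^ alpha + 1 + 2 * enorm (v - u) ^+ 2.
Proof.
move=> a1 a2.
have a0 : 0 < alpha / 2 by rewrite divr_gt0//; lra.
have al : alpha / 2 < 1 by rewrite ltr_pdivrMr//; lra.
have E (y : R) : 0 <= y -> y `^ alpha = (y ^+ 2) `^ (alpha / 2).
  move=> y0; rewrite -powR_mulrn// -powRrM; congr powR.
  by rewrite mulrCA divff// mulr1.
rewrite E ?enorm_ge0// [in leRHS]E ?enorm_ge0//.
have h : enorm u ^+ 2 <= 2 * enorm v ^+ 2 + 2 * enorm (v - u) ^+ 2.
  have := enorm_comb_sqr 1 1 v (v - u); rewrite !scale1r subKr => /le_trans; apply.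
  by rewrite expr1n !mulr1.
have n0 (w : 'rV[R]_d) : 0 <= 2 * enorm w ^+ 2 by rewrite mulr_ge0// sqr_ge0.
apply: (@le_trans _ _ ((2 * enorm v ^+ 2 + 2 * enorm (v - u) ^+ 2) `^ (alpha / 2))).
  by apply: ge0_ler_powR => //; rewrite ?nnegrE ?sqr_ge0 ?addr_ge0 ?n0 ?(ltW a0).
apply: le_trans (powR_subadd _ _ _ _) _ => //.
rewrite -addrA; apply: lerD.
  rewrite powRM ?sqr_ge0//; apply: ler_wpM2r; first exact: powR_ge0.
  by rewrite -[leRHS]powRr1//; apply: ler_powR; [lra|exact: ltW].
have [hx|hx] := leP (2 * enorm (v - u) ^+ 2) 1.
  apply: (@le_trans _ _ 1); last by rewrite lerDl.
  apply: (@le_trans _ _ (1 `^ (alpha / 2))); last by rewrite powR1.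
  by apply: ge0_ler_powR; rewrite ?nnegrE ?(ltW a0).
apply: (@le_trans _ _ (2 * enorm (v - u) ^+ 2)); last by rewrite lerDr.
by rewrite -[leRHS]powRr1//; apply: ler_powR; exact: ltW.
Qed.

End EuclideanNorm.

Section Fubini.
Context {R : realType} {dO : measure_display} {Omega : measurableType dO}.
Context {d : nat}.
Variables (P : probability Omega R) (T : R) (B : Omega -> R -> 'rV[R]_d).

(** The measures of the sections of a null set integrate to 0, so almost all of them vanish. *)
Lemma ae_dPdt_path (Q : Omega -> R -> Prop) : ae_dPdt P T Q ->
  {ae P, forall w, {ae @lebesgue_measure R, forall t, 0 <= t <= T -> Q w t}}.
Proof.
move=> [N [mN N0 hN]].
have mx : measurable_fun setT (fun w => lebesgue_measure (xsection N w)).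
  exact: measurable_fun_xsection.
have : (\int[P]_w `|lebesgue_measure (xsection N w)| = 0)%E.
  rewrite -N0 /product_measure1/=; apply: eq_integral => w _.
  by rewrite gee0_abs.
move/(ae_eq_integral_abs P measurableT mx); apply: filterS => w /(_ I) hw.
exists (xsection N w); split => //; first exact: measurable_xsection.
by move=> t /= ht; apply/xsectionP; apply: hN.
Qed.

Lemma progressive_path (X : Omega -> R -> R) w : 0 <= T -> progressive P T B X ->
  measurable_fun `[0, T] (X w).
Proof.
move=> T0 pX _ A mA.
have TT : 0 <= T <= T by rewrite lexx T0.
have mS : measurable (setT `*` `[0, T] :
   set (g_sigma_algebraType (filtration_gen P B T) * R)%type) by exact: measurableX.
have := @measurable_xsection _ _ (g_sigma_algebraType (filtration_gen P B T)) R _ w (pX T TT mS A mA); congr (measurable _).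
apply/seteqP; split => t /=; rewrite /xsection/= inE/=.
- by move=> [[_ ?] ?].
- by move=> [? ?].
Qed.

End Fubini.


Section PathIntegrable.
Context {R : realType}.
Variable D : set R.
Hypothesis mD : measurable (D : set (measurableTypeR R)).
Local Notation mu := (@lebesgue_measure R).
Definition path_int (f : R -> R) := mu.-integrable D (EFin \o f).

Lemma path_intD f g : path_int f -> path_int g -> path_int (fun t => f t + g t).
Proof. by move=> hf hg; exact: (integrableD mD hf hg). Qed.

Lemma path_intB f g : path_int f -> path_int g -> path_int (fun t => f t - g t).
Proof. by move=> hf hg; exact: (integrableB mD hf hg). Qed.

Lemma path_intZ (c : R) f : path_int f -> path_int (fun t => c * f t).
Proof. by move=> hf; exact: (integrableZl mD c hf). Qed.

Lemma path_int_le (f g : R -> R) : measurable_fun D f -> (forall t, D t -> `|f t| <= g t) ->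
  path_int g -> path_int f.
Proof.
move=> mf fg hg; apply: (le_integrable mD _ _ hg); first exact/measurable_EFinP.
by move=> t Dt /=; rewrite lee_fin; apply: le_trans (fg t Dt) (ler_norm _).
Qed.

End PathIntegrable.

(** * The weighted difference of two solutions *)

Section ThetaDifference.
Context {R : realType} {dO : measure_display} {Omega : measurableType dO}.
Context {d : nat}.
Variables (P : probability Omega R) (T : R) (B : Omega -> R -> 'rV[R]_d).
Hypotheses (Pcomplete : measure_is_complete P) (hB : is_brownian_motion P T B)
  (T0 : 0 < T).
Variables (alpha beta gamma : R).
Hypotheses (alpha1 : 1 < alpha) (alpha2 : alpha < 2) (beta0 : 0 <= beta) (gamma0 : 0 < gamma).
Variables (xi xi' : Omega -> R) (g g' : Omega -> R -> R -> 'rV[R]_d -> R)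
  (Y Y' M M' : Omega -> R -> R) (Z Z' : Omega -> R -> 'rV[R]_d).
Hypotheses (hYZ : bsde_solution P T B xi g Y Z) (hYZ' : bsde_solution P T B xi' g' Y' Z')
  (hM : is_ito_integral P T B Z M) (hM' : is_ito_integral P T B Z' M')
  (eqY : {ae P, forall w, forall t, 0 <= t <= T ->
      Y w t = xi w + \int[lebesgue_measure]_(s in `[t, T]) g w s (Y w s) (Z w s)
              - (M w T - M w t)})
  (eqY' : {ae P, forall w, forall t, 0 <= t <= T ->
      Y' w t = xi' w + \int[lebesgue_measure]_(s in `[t, T]) g' w s (Y' w s) (Z' w s)
              - (M' w T - M' w t)}).
Variable f : Omega -> R -> R.
Hypotheses (pf : progressive P T B f) (f0 : forall w t, 0 <= f w t)
  (intf : {ae P, forall w, path_int `[0, T] (f w)}).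
Variables a a' : R.

Definition td_U (w : Omega) (t : R) : R := a * Y w t - a' * Y' w t.
Definition td_V (w : Omega) (t : R) : 'rV[R]_d := a *: Z w t - a' *: Z' w t.
Definition td_M (w : Omega) (t : R) : R := a * M w t - a' * M' w t.
Definition td_k (w : Omega) (t : R) : R :=
  f w t + (beta * `|td_U w t| + gamma * enorm (td_V w t) `^ alpha).
Definition td_F (w : Omega) (t : R) : R := \int[lebesgue_measure]_(s in `[0, t]) f w s.
Definition td_J (w : Omega) (t : R) : R := \int[lebesgue_measure]_(s in `[0, t]) td_k w s.

Hypothesis key : {ae P, forall w, {ae @lebesgue_measure R, forall t, 0 <= t <= T ->
  a * g w t (Y w t) (Z w t) - a' * g' w t (Y' w t) (Z' w t) <= td_k w t}}.

Lemma Rintegral_adapted (X : Omega -> R -> R) t : progressive P T B X ->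
  (forall w s, 0 <= X w s) -> 0 <= t <= T ->
  adapted_at P B t (fun w => \int[lebesgue_measure]_(s in `[0, t]) X w s).
Proof.
move=> pX X0 tT; apply: (measurableT_comp (f := fine)); first exact: fine_measurable.
exact: (progressive_integral_adapted pX X0 tT).
Qed.

Let k0 w t : 0 <= td_k w t.
Proof. by rewrite addr_ge0// addr_ge0// mulr_ge0 ?powR_ge0// ltW. Qed.

Let pU : progressive P T B td_U.
Proof. by apply: progressive_comb; [exact: sol_Y_progressive hYZ|exact: sol_Y_progressive hYZ']. Qed.

Let pV : progressive_rv P T B td_V.
Proof.
by apply: progressive_rv_comb; [exact: sol_Z_progressive hYZ|exact: sol_Z_progressive hYZ'].
Qed.

Let pk : progressive P T B td_k.
Proof.
apply: progressiveD => //; apply: progressiveD; apply: progressiveZ.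
  by apply: (progressive_comp (f := @Num.norm R R)) => //; exact: normr_measurable.
apply: (progressive_comp (f := @powR R ^~ alpha)); first exact: measurable_powR.
exact: progressive_enorm.
Qed.

Let within_comb (c c' : R) (X X' : Omega -> R -> R) :
  {ae P, forall w, {within `[0, T], continuous (X w)}} ->
  {ae P, forall w, {within `[0, T], continuous (X' w)}} ->
  {ae P, forall w, {within `[0, T], continuous (fun t => c * X w t - c' * X' w t)}}.
Proof.
apply: filterS2 => w h h' t.
by apply: cvgB; apply: cvgZr; [exact: h|exact: h'].
Qed.

Let cU : {ae P, forall w, {within `[0, T], continuous (td_U w)}}.
Proof.
by apply: within_comb; [exact: sol_Y_continuous hYZ|exact: sol_Y_continuous hYZ'].
Qed.

Let path_enorm_sqr (X : Omega -> R -> 'rV[R]_d) w : progressive_rv P T B X ->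
  measurable_fun `[0, T] (fun t => enorm (X w t) ^+ 2).
Proof.
move=> pX; apply: (progressive_path (P := P) (B := B) (X := fun w t => enorm (X w t) ^+ 2)).
  exact: ltW.
apply: (progressive_comp (f := fun y => y ^+ 2)); first exact: measurable_funX.
exact: progressive_enorm.
Qed.

Let intV : {ae P, forall w, path_int `[0, T] (fun t => enorm (td_V w t) ^+ 2)}.
Proof.
have := sol_Z_square_integrable hYZ'; apply: filterS2 (sol_Z_square_integrable hYZ) => w h h'.
apply: (path_int_le _ _ _ (path_intD _ (path_intZ _ (2 * a ^+ 2) h) (path_intZ _ (2 * a' ^+ 2) h'))) => //.
  exact: path_enorm_sqr.
move=> t _; rewrite ger0_norm ?sqr_ge0//; exact: enorm_comb_sqr.
Qed.

Let intk : {ae P, forall w, path_int `[0, T] (td_k w)}.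
Proof.
apply: (filterS _ (filterI intf (filterI cU intV))) => w [hf [hU hV]].
apply: path_intD => //; apply: path_intD => //; apply: path_intZ => //.
  apply: continuous_compact_integrable; first exact: segment_compact.
  by move=> t; apply: cvg_norm; exact: hU.
have h1 : path_int `[0, T] (fun=> 1).
  by apply: continuous_compact_integrable; [exact: segment_compact|move=> t; exact: cvg_cst].
apply: (path_int_le _ _ _ (path_intD _ h1 hV)) => //.
  apply: (progressive_path (P := P) (B := B) (X := fun w t => enorm (td_V w t) `^ alpha)).
    exact: ltW.
  apply: (progressive_comp (f := @powR R ^~ alpha)); first exact: measurable_powR.
  exact: progressive_enorm.
move=> t _; rewrite ger0_norm ?powR_ge0//; set y := enorm _.
have y0 : 0 <= y by exact: enorm_ge0.
have a0 : 0 <= alpha by apply: le_trans (ltW alpha1).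
have [hy|hy] := leP y 1.
  apply: (@le_trans _ _ (1 `^ alpha)); first by apply: ge0_ler_powR; rewrite ?nnegrE.
  by rewrite powR1 lerDl sqr_ge0.
apply: (@le_trans _ _ (y ^+ 2)); last by rewrite lerDr.
by rewrite -powR_mulrn//; apply: ler_powR; exact: ltW.
Qed.

Let td_approx (eta rho : R) : 0 < eta -> 0 < rho ->
    exists x v L, elementary P T B x v L /\ almost_prob P (fun w =>
    (forall t, 0 <= t <= T -> `|x w t - td_M w t| <= eta) /\
    (\int[lebesgue_measure]_(t in `[0%R, T]) (enorm (v w t - td_V w t) ^+ 2)%:E <= eta%:E)%E) rho.
Proof.
move=> e0 r0; have r20 : 0 < rho / 2 by rewrite divr_gt0.
(* Dominates both the factor |a| + |a'| of the uniform error and the factor 2a^2 + 2a'^2 of the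
   squared L2 error; the 1 keeps it positive. *)
pose c := 1 + (`|a| + `|a'|) + (2 * a ^+ 2 + 2 * a' ^+ 2).
have c0 : 0 < c by rewrite ltr_wpDr ?ltr_wpDr// ?addr_ge0// mulr_ge0// sqr_ge0.
have e10 : 0 < eta / c by rewrite divr_gt0.
have [x [v [L [el ap]]]] := ito_elementary Pcomplete hB T0 (sol_Z_progressive hYZ) hM e10 r20.
have [x' [v' [L' [el' ap']]]] := ito_elementary Pcomplete hB T0 (sol_Z_progressive hYZ') hM' e10 r20.
exists (fun w t => a * x w t - a' * x' w t), (fun w t => a *: v w t - a' *: v' w t), (L ++ L').
split; first exact: elementary_comb.
rewrite (splitr rho); apply: almost_prob_sub (almost_prob_and ap ap') => w [[h1 h2] [h1' h2']].
have ec : eta = c * (eta / c) by rewrite mulrCA divff ?mulr1// gt_eqF.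
have sq0 (y : R) : 0 <= 2 * y ^+ 2 by rewrite mulr_ge0// sqr_ge0.
split.
  move=> t tT; rewrite /td_M.
  have -> : a * x w t - a' * x' w t - (a * M w t - a' * M' w t) =
    a * (x w t - M w t) - a' * (x' w t - M' w t) by ring.
  apply: le_trans (ler_normB _ _) _; rewrite !normrM.
  apply: (@le_trans _ _ ((`|a| + `|a'|) * (eta / c))).
    by rewrite mulrDl lerD// ler_wpM2l// ?h1 ?h1'.
  rewrite [leRHS]ec ler_wpM2r ?(ltW e10)// /c.
  by apply: (@le_trans _ _ (1 + (`|a| + `|a'|))); rewrite ?lerDl ?lerDr ?addr_ge0.
have pd (X X' : Omega -> R -> 'rV[R]_d) : progressive_rv P T B X -> progressive_rv P T B X' ->
    progressive_rv P T B (fun w t => X w t - X' w t).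
  move=> hX hX'; have -> : (fun w t => X w t - X' w t) = (fun w t => 1 *: X w t - 1 *: X' w t).
    by apply/funext => y; apply/funext => t; rewrite !scale1r.
  exact: progressive_rv_comb.
have mv : measurable_fun `[0, T] (fun t => enorm (v w t - Z w t) ^+ 2).
  by apply: (path_enorm_sqr (X := fun w t => v w t - Z w t)); apply: pd; [exact: el_progressive el|exact: sol_Z_progressive hYZ].
have mv' : measurable_fun `[0, T] (fun t => enorm (v' w t - Z' w t) ^+ 2).
  by apply: (path_enorm_sqr (X := fun w t => v' w t - Z' w t)); apply: pd; [exact: el_progressive el'|exact: sol_Z_progressive hYZ'].
have mvv : measurable_fun `[0, T] (fun t => enorm (a *: v w t - a' *: v' w t - td_V w t) ^+ 2).
  apply: (path_enorm_sqr (X := fun w t => a *: v w t - a' *: v' w t - td_V w t)).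
  apply: pd => //; apply: progressive_rv_comb; [exact: el_progressive el|exact: el_progressive el'].
apply: (@le_trans _ _ (\int[lebesgue_measure]_(t in `[0%R, T])
    ((2 * a ^+ 2)%:E * (enorm (v w t - Z w t) ^+ 2)%:E
     + (2 * a' ^+ 2)%:E * (enorm (v' w t - Z' w t) ^+ 2)%:E))%E).
  apply: ge0_le_integral => //.
  - by move=> t _; rewrite lee_fin sqr_ge0.
  - exact/measurable_EFinP.
  - by apply: emeasurable_funD; apply: measurable_funeM; exact/measurable_EFinP.
  - move=> t _; rewrite -!EFinM -EFinD lee_fin.
    have -> : a *: v w t - a' *: v' w t - td_V w t =
        a *: (v w t - Z w t) - a' *: (v' w t - Z' w t).
      by apply/rowP => i; rewrite !mxE; ring.
    exact: enorm_comb_sqr.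
rewrite ge0_integralD//; last 4 first.
- by move=> t _; rewrite -EFinM lee_fin mulr_ge0// sqr_ge0.
- by apply: measurable_funeM; exact/measurable_EFinP.
- by move=> t _; rewrite -EFinM lee_fin mulr_ge0// sqr_ge0.
- by apply: measurable_funeM; exact/measurable_EFinP.
rewrite !ge0_integralZl//; last 6 first.
- exact/measurable_EFinP.
- by move=> t _; rewrite lee_fin sqr_ge0.
- by rewrite lee_fin.
- exact/measurable_EFinP.
- by move=> t _; rewrite lee_fin sqr_ge0.
- by rewrite lee_fin.
apply: (@le_trans _ _ ((2 * a ^+ 2)%:E * (eta / c)%:E + (2 * a' ^+ 2)%:E * (eta / c)%:E)%E).
  by apply: leeD; (apply: lee_wpmul2l; first by rewrite lee_fin; exact: sq0); [exact: h2|exact: h2'].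
rewrite -!EFinM -EFinD lee_fin -mulrDl [leRHS]ec ler_wpM2r ?(ltW e10)// /c lerDr.
by rewrite addr_ge0// addr_ge0.
Qed.


Let intl2 x v L : elementary P T B x v L ->
  {ae P, forall w, path_int `[0, T] (fun t => enorm (v w t - td_V w t) ^+ 2)}.
Proof.
move=> el; have [C C0 vC] := el_bounded el.
apply: filterS intV => w hV.
have h1 : path_int `[0, T] (fun=> 1).
  by apply: continuous_compact_integrable; [exact: segment_compact|move=> t; exact: cvg_cst].
have pd : progressive_rv P T B (fun w t => v w t - td_V w t).
  have -> : (fun w t => v w t - td_V w t) = (fun w t => 1 *: v w t - 1 *: td_V w t).
    by apply/funext => y; apply/funext => t; rewrite !scale1r.
  by apply: progressive_rv_comb => //; exact: el_progressive el.
apply: (path_int_le _ _ _ (path_intD _ (path_intZ _ (2 * (d%:R * C ^+ 2)) h1) (path_intZ _ 2 hV))) => //.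
  exact: (path_enorm_sqr (X := fun w t => v w t - td_V w t)).
move=> t _; rewrite ger0_norm ?sqr_ge0//.
have := enorm_comb_sqr 1 1 (v w t) (td_V w t); rewrite !scale1r expr1n !mulr1 => /le_trans; apply.
by apply: lerD => //; apply: ler_wpM2l => //; exact: enorm_sqr_bound.
Qed.

Let sub_swap (p q r z : R) : p - q <= r - z -> z - q <= r - p.
Proof. by move=> *; lra. Qed.

Let drift_increment (x x' m m' ms ms' mt mt' p p' q q' k k' : R) :
  a * (p - p') - a' * (q - q') <= k - k' ->
  a * (x + p - (m - ms)) - a' * (x' + q - (m' - ms')) - (a * ms - a' * ms') - (k - k') <=
  a * (x + p' - (m - mt)) - a' * (x' + q' - (m' - mt')) - (a * mt - a' * mt').
Proof. by move=> *; lra. Qed.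

Let growth_increment (bu bk gv e s : R) : bu <= bk ->
  gv <= gamma * (2 * e + 1 + 2 * s) ->
  bu + gv <= bk + 2 * gamma * e + 2 * gamma + 2 * gamma * s.
Proof. by have := gamma0; lra. Qed.

Let sub_sub_le (k k' p p' c e : R) :
  k - k' <= p - p' + (c + e) -> k - p - (k' - p') <= c + e.
Proof. by move=> *; lra. Qed.

Lemma td_scheme_hyp : scheme_hyp P T B alpha beta gamma td_U td_M td_F td_J td_V.
Proof.
split.
- move=> t tT; split.
  + by apply: progressive_adapted tT.
  + by apply: adapted_comb; [exact: (ito_adapted hM)|exact: (ito_adapted hM')].
  + exact: Rintegral_adapted.
  + exact: Rintegral_adapted.
- exact: cU.
- by apply: within_comb; [exact: (ito_continuous hM)|exact: (ito_continuous hM')].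
- by apply: filterS intk => w h; apply: Rintegral_continuous h; exact: ltW.
- apply: filterS2 intk intf => w hk hf s t s0 st tT.
  have sT := le_trans st tT.
  have F0 : 0 <= \int[lebesgue_measure]_(s in `]s, t]) f w s by exact: Rintegral_ge0.
  have F1 : \int[lebesgue_measure]_(s in `]s, t]) f w s <=
      \int[lebesgue_measure]_(s in `]s, t]) td_k w s.
    apply: le_Rintegral; [by []|exact: (itg_oc s0 tT hf)|exact: (itg_oc s0 tT hk)|].
    by move=> r _; rewrite lerDl addr_ge0// mulr_ge0 ?powR_ge0// ltW.
  have E1 := Rintegral_sub_start hf s0 st tT.
  have E2 := Rintegral_sub_start hk s0 st tT.
  split.
  + exact: Rintegral_ge0.
  + by rewrite -subr_ge0 /td_F E1.
  + apply: le_Rintegral; [by []|exact: (itg_cc (lexx _) sT hf)|exact: (itg_cc (lexx _) sT hk)|].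
    by move=> r _; rewrite lerDl addr_ge0// mulr_ge0 ?powR_ge0// ltW.
  + move: F1; rewrite -E1 -E2 /td_F /td_J; exact: sub_swap.
- apply: (filterS _ (filterI (filterI (filterI eqY eqY') (filterI key intk))
    (filterI (sol_g_integrable hYZ) (sol_g_integrable hYZ')))) => w [[[e1 e2] [hkey hk]] [i1 i2]] s t s0 st tT.
  have sT := le_trans st tT; have t0 := le_trans s0 st.
  have sI : 0 <= s <= T by rewrite s0 sT.
  have tI : 0 <= t <= T by rewrite t0 tT.
  rewrite /td_U /td_M (e1 _ sI) (e1 _ tI) (e2 _ sI) (e2 _ tI).
  have E1 := Rintegral_sub_end i1 s0 st tT.
  have E2 := Rintegral_sub_end i2 s0 st tT.
  have E3 := Rintegral_sub_start hk s0 st tT.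
  have j1 := itg_oc s0 tT i1.
  have j2 := itg_oc s0 tT i2.
  (* By the two equations, the increment of U - M over the interval is minus the integral on the
     left. *)
  have : \int[lebesgue_measure]_(r in `]s, t])
     (a * g w r (Y w r) (Z w r) - a' * g' w r (Y' w r) (Z' w r)) <=
     \int[lebesgue_measure]_(r in `]s, t]) td_k w r.
    apply: Rintegral_ae_le => //.
    + by apply: path_intB => //; apply: path_intZ.
    + exact: (itg_oc s0 tT hk).
    + move: hkey => [N [mN N0 hN]]; exists N; split => // r /= nr; apply: hN => /= h.
      apply: nr; rewrite in_itv/= => /andP[r1 r2]; apply: h.
      by rewrite (le_trans s0 (ltW r1)) (le_trans r2 tT).
  rewrite RintegralB//; [|exact: (path_intZ _ a j1)|exact: (path_intZ _ a' j2)].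
  rewrite !RintegralZl// -E1 -E2 -E3 /td_J.
  exact: drift_increment.
- exact: pV.
- exact: td_approx.
- move=> x v L el.
  apply: (filterS _ (filterI (intl2 el) (filterI intf intk))) => w [hl [hf hk]] s t s0 st tT.
  have E1 := Rintegral_sub_start hl s0 st tT.
  have E2 := Rintegral_sub_start hf s0 st tT.
  have E3 := Rintegral_sub_start hk s0 st tT.
  split.
    apply/andP; split; first by apply: Rintegral_ge0 => r _; exact: sqr_ge0.
    rewrite -subr_ge0 /l2dist -/(Rintegral _ _ _) -/(Rintegral _ _ _) E1.
    by apply: Rintegral_ge0 => r _; exact: sqr_ge0.
  move=> c K hK hc.
  have h1 : path_int `]s, t] (fun=> beta * K + 2 * gamma * enorm c `^ alpha + 2 * gamma).
    apply: (itg_oc s0 tT).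
    by apply: continuous_compact_integrable; [exact: segment_compact|move=> r; exact: cvg_cst].
  have h2 := path_intZ _ (2 * gamma) (itg_oc s0 tT hl).
  have {}h2 := h2 (measurable_itv _).
  have jf := itg_oc s0 tT hf.
  have : \int[lebesgue_measure]_(r in `]s, t]) td_k w r <=
    \int[lebesgue_measure]_(r in `]s, t]) (f w r +
      ((beta * K + 2 * gamma * enorm c `^ alpha + 2 * gamma)
       + 2 * gamma * enorm (v w r - td_V w r) ^+ 2)).
    apply: le_Rintegral; [by []|exact: (itg_oc s0 tT hk)| |].
      by apply: path_intD => //; apply: path_intD => //; exact: h2.
    move=> r /=; rewrite in_itv/= => rr; rewrite lerD2l.
    have r' : s <= r <= t by move: rr => /andP[/ltW-> ->].
    have := enorm_powR_le (td_V w r) (v w r) alpha1 alpha2.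
    rewrite (hc _ rr) => hp.
    have hb : beta * `|td_U w r| <= beta * K by apply: ler_wpM2l => //; exact: hK.
    have hg : gamma * enorm (td_V w r) `^ alpha <=
       gamma * (2 * enorm c `^ alpha + 1 + 2 * enorm (c - td_V w r) ^+ 2).
      by apply: ler_wpM2l => //; exact: ltW.
    exact: growth_increment hb hg.
  rewrite RintegralD//; last by apply: path_intD => //; exact: h2.
  rewrite [X in (_ <= _ + X) -> _]RintegralD//.
  rewrite RintegralZl//; last exact: (itg_oc s0 tT hl).
  rewrite Rintegral_itv_cst// -E1 -E2 -E3 /l2dist -!/(Rintegral _ _ _) /td_J /td_F.
  exact: sub_sub_le.
Qed.

End ThetaDifference.


Section ConvexDifference.
Context {R : realType} {d : nat}.
Implicit Types (phi : R -> 'rV[R]_d -> R) (y : R) (z : 'rV[R]_d).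

Lemma enormN z : enorm (- z) = enorm z.
Proof. by rewrite /enorm /dotrv; congr Num.sqrt; apply: eq_bigr => i _; rewrite !mxE mulrNN. Qed.

(** The point (y, z) is the convex combination, with weights 1/r and 1 - 1/r, of the extrapolated
    point and (y', z'); the convexity inequality is multiplied by r. *)
Lemma convex_theta phi (r y y' : R) (z z' : 'rV[R]_d) : convex_yz phi -> 1 <= r ->
  r * phi y z - (r - 1) * phi y' z' <= phi (r * y - (r - 1) * y') (r *: z - (r - 1) *: z').
Proof.
move=> cphi r1; have r0 : 0 < r by apply: lt_le_trans r1.
have i0 : 0 <= r^-1 by rewrite invr_ge0 ltW.
have i1 : r^-1 <= 1 by rewrite invf_le1.
set u := r * y - (r - 1) * y'; set v := r *: z - (r - 1) *: z'.
have := cphi (Itv01 i0 i1) (u, v) (y', z'); rewrite !inE => /(_ I I) /=.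
rewrite convRE /= /unstable.onem.
have -> : r^-1 *: (u : R^o) + (1 - r^-1) *: (y' : R^o) = y.
  by rewrite /GRing.scale/= /u; field; exact: lt0r_neq0.
have -> : r^-1 *: v + (1 - r^-1) *: z' = z.
  by apply/rowP => i; rewrite /v !mxE; field; exact: lt0r_neq0.
move=> /= h.
have := ler_wpM2l (ltW r0) h; rewrite mulrDr !mulrA mulrBr mulr1 mulfV ?mul1r ?gt_eqF//.
by rewrite -lerBlDr.
Qed.

(** [convex_theta] for -phi with the two points exchanged. The extrapolated point is minus the
    combination in use, which the growth bound does not distinguish. *)
Lemma concave_theta phi (r y y' : R) (z z' : 'rV[R]_d) : concave_yz phi -> 1 <= r ->
  (r - 1) * phi y z - r * phi y' z' <=
  - phi (- ((r - 1) * y - r * y')) (- ((r - 1) *: z - r *: z')).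
Proof.
move=> cphi r1; have := @convex_theta (fun y z => - phi y z) r y' y z' z cphi r1.
rewrite !opprB => h.
by apply: le_trans h; rewrite !mulrN opprK addrC.
Qed.

End ConvexDifference.

Section ThetaKey.
Context {R : realType} {dO : measure_display} {Omega : measurableType dO}.
Context {d : nat}.
Variables (P : probability Omega R) (T : R) (alpha beta gamma : R).

Lemma convex_growth (phi : R -> 'rV[R]_d -> R) (r y y' : R) (z z' : 'rV[R]_d) :
  (forall y z, `|phi y z| <= `|phi 0 0| + beta * `|y| + gamma * enorm z `^ alpha) ->
  convex_yz phi -> 1 <= r -> r * phi y z - (r - 1) * phi y' z' <=
  `|phi 0 0| + (beta * `|r * y - (r - 1) * y'| + gamma * enorm (r *: z - (r - 1) *: z') `^ alpha).
Proof.
move=> hg cphi r1; apply: le_trans (convex_theta y y' z z' cphi r1) _.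
by apply: le_trans (ler_norm _) _; rewrite addrA; exact: hg.
Qed.

Lemma concave_growth (phi : R -> 'rV[R]_d -> R) (r y y' : R) (z z' : 'rV[R]_d) :
  (forall y z, `|phi y z| <= `|phi 0 0| + beta * `|y| + gamma * enorm z `^ alpha) ->
  concave_yz phi -> 1 <= r -> (r - 1) * phi y z - r * phi y' z' <=
  `|phi 0 0| + (beta * `|(r - 1) * y - r * y'| + gamma * enorm ((r - 1) *: z - r *: z') `^ alpha).
Proof.
move=> hg cphi r1; apply: le_trans (concave_theta y y' z z' cphi r1) _.
apply: le_trans (ler_norm _) _; rewrite normrN addrA.
by have := hg (- ((r - 1) * y - r * y')) (- ((r - 1) *: z - r *: z')); rewrite enormN normrN.
Qed.

Variables (g g' : Omega -> R -> R -> 'rV[R]_d -> R) (Y Y' : Omega -> R -> R)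
  (Z Z' : Omega -> R -> 'rV[R]_d).

Definition theta_fst (b : bool) (r : R) : R := if b then r else r - 1.
Definition theta_snd (b : bool) (r : R) : R := if b then r - 1 else r.

Let ineq b r w t : Prop :=
  theta_fst b r * g w t (Y w t) (Z w t) - theta_snd b r * g' w t (Y' w t) (Z' w t) <=
  td_k alpha beta gamma Y Y' Z Z' (fun w t => `|g w t 0 0| + `|g' w t 0 0|)
    (theta_fst b r) (theta_snd b r) w t.

Let ae2 (A C D : Omega -> R -> Prop) : (forall w t, A w t -> C w t -> D w t) ->
  ae_dPdt P T A -> ae_dPdt P T C -> ae_dPdt P T D.
Proof.
move=> h [N [mN N0 hN]] [N' [mN' N'0 hN']]; exists (N `|` N'); split.
- exact: measurableU.
- apply/eqP; rewrite eq_le measure_ge0 andbT.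
  have le0 : ((P \x lebesgue_measure)%E N <= 0)%E by rewrite N0.
  have le0' : ((P \x lebesgue_measure)%E N' <= 0)%E by rewrite N'0.
  apply: le_trans (measureU2 _ mN mN') _.
  by rewrite -[leRHS]adde0; exact: leeD.
- move=> x /= nx; have [a|na] := pselect (N x); [by left|right; apply: hN' => /= cx].
  apply: na; apply: hN => /= ax; apply: nx => xT.
  by apply: h; [exact: ax|exact: cx].
Qed.

(** The assumed inequality between g and g' carries a nonnegative weight r or r - 1, so it replaces
    the uncontrolled generator by the controlled one at the same point; convexity or concavity then
    applies to that one alone. The choice of b precedes r. *)
Lemma theta_key :
  [/\ growth_bound P T alpha beta gamma g, ae_convex_or_concave P T g
    & ae_dPdt P T (fun w t => g w t (Y' w t) (Z' w t) <= g' w t (Y' w t) (Z' w t))] \/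
  [/\ growth_bound P T alpha beta gamma g', ae_convex_or_concave P T g'
    & ae_dPdt P T (fun w t => g w t (Y w t) (Z w t) <= g' w t (Y w t) (Z w t))] ->
  exists b : bool, forall r : R, 1 <= r ->
    {ae P, forall w, {ae @lebesgue_measure R, forall t, 0 <= t <= T -> ineq b r w t}}.
Proof.
have pos r : 1 <= r -> 0 <= r :> R by apply: le_trans.
have pos1 r : 1 <= r -> 0 <= r - 1 :> R by rewrite subr_ge0.
suff H : [/\ growth_bound P T alpha beta gamma g, ae_convex_or_concave P T g
    & ae_dPdt P T (fun w t => g w t (Y' w t) (Z' w t) <= g' w t (Y' w t) (Z' w t))] \/
  [/\ growth_bound P T alpha beta gamma g', ae_convex_or_concave P T g'
    & ae_dPdt P T (fun w t => g w t (Y w t) (Z w t) <= g' w t (Y w t) (Z w t))] ->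
  exists b : bool, forall r : R, 1 <= r -> ae_dPdt P T (ineq b r).
  by move=> /H [b hb]; exists b => r /hb; exact: ae_dPdt_path.
move=> [[hg [cg|cg] hc]|[hg [cg|cg] hc]].
- exists true => r r1; apply: (ae2 _ (ae2 (fun w t => @conj _ _) hg cg) hc) => w t [h1 h2] h3.
  have := convex_growth (Y w t) (Y' w t) (Z w t) (Z' w t) h1 h2 r1.
  have : (r - 1) * g w t (Y' w t) (Z' w t) <= (r - 1) * g' w t (Y' w t) (Z' w t).
    by apply: ler_wpM2l => //; exact: pos1.
  have := normr_ge0 (g' w t 0 0).
  rewrite /ineq /td_k /td_U /td_V /=.
  by move: (beta * _ + _) => *; lra.
- exists false => r r1; apply: (ae2 _ (ae2 (fun w t => @conj _ _) hg cg) hc) => w t [h1 h2] h3.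
  have := concave_growth (Y w t) (Y' w t) (Z w t) (Z' w t) h1 h2 r1.
  have : r * g w t (Y' w t) (Z' w t) <= r * g' w t (Y' w t) (Z' w t).
    by apply: ler_wpM2l => //; exact: pos.
  have := normr_ge0 (g' w t 0 0).
  rewrite /ineq /td_k /td_U /td_V /=.
  by move: (beta * _ + _) => *; lra.
- exists true => r r1; apply: (ae2 _ (ae2 (fun w t => @conj _ _) hg cg) hc) => w t [h1 h2] h3.
  have := convex_growth (Y w t) (Y' w t) (Z w t) (Z' w t) h1 h2 r1.
  have : r * g w t (Y w t) (Z w t) <= r * g' w t (Y w t) (Z w t).
    by apply: ler_wpM2l => //; exact: pos.
  have := normr_ge0 (g w t 0 0).
  rewrite /ineq /td_k /td_U /td_V /=.
  by move: (beta * _ + _) => *; lra.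
- exists false => r r1; apply: (ae2 _ (ae2 (fun w t => @conj _ _) hg cg) hc) => w t [h1 h2] h3.
  have := concave_growth (Y w t) (Y' w t) (Z w t) (Z' w t) h1 h2 r1.
  have : (r - 1) * g w t (Y w t) (Z w t) <= (r - 1) * g' w t (Y w t) (Z w t).
    by apply: ler_wpM2l => //; exact: pos1.
  have := normr_ge0 (g w t 0 0).
  rewrite /ineq /td_k /td_U /td_V /=.
  by move: (beta * _ + _) => *; lra.
Qed.

End ThetaKey.

(** * Exponential moments and conclusion *)


Section Tails.
Context {R : realType} {dO : measure_display} {Omega : measurableType dO}.
Variable P : probability Omega R.

Lemma rv_tail (Phi X : Omega -> R) (eps : R) : rvL1 P Phi -> (forall w, 0 <= Phi w) ->
  measurable_fun setT X -> 0 < eps ->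
  exists2 N : R, 0 <= N & rvE P (fun w => \1_(~` [set w | X w <= N]) w * Phi w) <= eps.
Proof.
move=> hP P0 mX e0.
have mA N : measurable [set w | X w <= N].
  by apply: measurable_set_le => //; exact: measurable_cst.
pose h (n : nat) w := \1_(~` [set w | X w <= n%:R]) w * Phi w.
have mh n : measurable_fun setT (h n).
  apply: measurable_funM; last exact: rvL1_measurable hP.
  by apply/measurable_indicP; exact: measurableC.
have h_le n w : `|h n w| <= Phi w.
  rewrite /h indicE; case: (_ \in _); rewrite ?mul1r ?mul0r ?normr0//.
  by rewrite ger0_norm.
have h0 : {ae P, forall w, [set: Omega] w -> (EFin \o h n) w @[n --> \oo] --> (cst 0%E : Omega -> \bar R) w}.
  apply: aeW => w _ /=.
  have [n hn] : exists n : nat, X w <= n%:R.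
    exists (Num.bound `|X w|); apply: le_trans (ler_norm _) _.
    by apply: ltW; exact: archi_boundP.
  apply: cvg_near_cst; exists n => // k /= nk.
  rewrite /h indicE memNset ?mul0r// => /=; apply.
  by apply: le_trans hn _; rewrite ler_nat.
have h1 : {ae P, forall w n, [set: Omega] w -> (`|(EFin \o h n) w| <= (EFin \o Phi) w)%E}.
  by apply: aeW => w n _ /=; rewrite lee_fin.
have mh' n : measurable_fun setT (EFin \o h n) by apply/measurable_EFinP.
have m0 : measurable_fun [set: Omega] (cst 0%E : Omega -> \bar R) by exact: measurable_cst.
have [_ _ hc] := dominated_convergence measurableT mh' m0 h0 hP h1.
rewrite integral0 in hc.
move/fine_cvgP : hc => [_ /cvgrPdist_lt/(_ eps e0)] [n _ hn].
exists n%:R => //.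
have := hn n (leqnn n); rewrite /= sub0r normrN => /ltW.
by apply: le_trans; exact: ler_norm.
Qed.

Lemma measurable_expeR : measurable_fun setT (@expeR R).
Proof.
have -> : @expeR R = (fun x => if x == -oo%E then 0%E else
    if x == +oo%E then +oo%E else (expR (fine x))%:E).
  by apply/funext; case.
apply: measurable_fun_ifT => //=; first exact: measurable_fun_eqe.
apply: measurable_fun_ifT => //=; first exact: measurable_fun_eqe.
apply/measurable_EFinP.
by apply: (measurableT_comp (f := expR)); [exact: measurable_expR|exact: fine_measurable].
Qed.

(** The moment with p = 1 already forces S to be finite almost surely, after which the extended and
    the real exponentials agree. *)
Lemma exp_moment_finite (S : Omega -> \bar R) (q : R) : 0 < q ->
  measurable_fun setT S -> (forall w, 0 <= S w)%E ->
  (forall p : R, 0 < p -> (\int[P]_w expeR (p%:E * poweR (S w) q) < +oo)%E) ->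
  {ae P, forall w, S w \is a fin_num} /\
  forall p : R, 0 < p -> rvL1 P (fun w => expR (p * fine (S w) `^ q)).
Proof.
move=> q0 mS S0 hS.
have mE p : measurable_fun setT (fun w => expeR (p%:E * poweR (S w) q)).
  apply: (measurableT_comp (f := expeR)); first exact: measurable_expeR.
  apply: measurable_funeM; apply: (measurableT_comp (f := fun x => poweR x q)) => //.
  exact: measurable_poweR.
have fin : {ae P, forall w, S w \is a fin_num}.
  have i1 : P.-integrable setT (fun w => expeR (1%:E * poweR (S w) q)).
    apply/integrableP; split; first exact: mE.
    by under eq_integral do rewrite gee0_abs ?expeR_ge0//; exact: hS.
  have := integrable_ae measurableT i1; apply: filterS => w /(_ I).
  rewrite mul1e; have := S0 w; case: (S w) => // _.
  by rewrite poweRyr ?gt_eqF.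
split => // p p0.
apply/integrableP; split.
  apply/measurable_EFinP; apply: (measurableT_comp (f := expR)); first exact: measurable_expR.
  apply: measurable_funM => //; apply: (measurableT_comp (f := @powR R ^~ q)).
    exact: measurable_powR.
  by apply: (measurableT_comp (f := fine)) => //; exact: fine_measurable.
rewrite (_ : integral _ _ _ = (\int[P]_w expeR (p%:E * poweR (S w) q))%E); first exact: hS.
apply: ae_eq_integral => //.
  apply: measurableT_comp => //; apply/measurable_EFinP.
  apply: (measurableT_comp (f := expR)); first exact: measurable_expR.
  apply: measurable_funM => //; apply: (measurableT_comp (f := @powR R ^~ q)).
    exact: measurable_powR.
  by apply: (measurableT_comp (f := fine)) => //; exact: fine_measurable.
apply: filterS fin => w fw _; rewrite gee0_abs ?lee_fin ?expR_ge0//.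
by rewrite -[in RHS](fineK fw) poweR_EFin.
Qed.

End Tails.


Section Comparison.
Context {R : realType} {dO : measure_display} {Omega : measurableType dO}.
Context {d : nat}.
Variables (P : probability Omega R) (T : R) (B : Omega -> R -> 'rV[R]_d).
Hypotheses (Pcomplete : measure_is_complete P) (hB : is_brownian_motion P T B)
  (T0 : 0 < T).
Variables (alpha beta gamma : R).
Hypotheses (alpha1 : 1 < alpha) (alpha2 : alpha < 2) (beta0 : 0 <= beta) (gamma0 : 0 < gamma).
Variables (xi xi' : Omega -> R) (g g' : Omega -> R -> R -> 'rV[R]_d -> R)
  (Y Y' : Omega -> R -> R) (Z Z' : Omega -> R -> 'rV[R]_d).
Hypotheses (hg : is_generator P T B g) (hg' : is_generator P T B g')
  (hYZ : bsde_solution P T B xi g Y Z) (hYZ' : bsde_solution P T B xi' g' Y' Z').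

Let f w t := `|g w t 0 0| + `|g' w t 0 0|.
Let q := 2 * (alpha - 1) / alpha.

Definition sup_data (w : Omega) : \bar R :=
  (ereal_sup [set (`|Y w t| + `|Y' w t|)%:E | t in `[0%R, T]%classic]
   + \int[lebesgue_measure]_(t in `[0%R, T]) (f w t)%:E)%E.

Hypotheses
  (hexp : forall p : R, 0 < p ->
    (\int[P]_w expeR (p%:E * poweR (sup_data w) q) < +oo)%E)
  (hxixi' : {ae P, forall w, xi w <= xi' w}).
Variable b : bool.
Hypothesis key : forall r : R, 1 <= r ->
  {ae P, forall w, {ae @lebesgue_measure R, forall t, 0 <= t <= T ->
    theta_fst b r * g w t (Y w t) (Z w t) - theta_snd b r * g' w t (Y' w t) (Z' w t) <=
    td_k alpha beta gamma Y Y' Z Z' f (theta_fst b r) (theta_snd b r) w t}}.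

Let T00 : 0 <= T. Proof. exact: ltW. Qed.
Let I0 : 0 <= (0 : R) <= T. Proof. by rewrite lexx T00. Qed.
Let IT : 0 <= T <= T. Proof. by rewrite lexx T00. Qed.

Let f0 w t : 0 <= f w t. Proof. exact: addr_ge0. Qed.

Let pf : progressive P T B f.
Proof.
by apply: progressiveD; apply: (progressive_comp (f := @Num.norm R R));
  (try exact: normr_measurable); [exact: gen_progressive hg 0 0|exact: gen_progressive hg' 0 0].
Qed.

Let sup0 w : (0 <= ereal_sup [set (`|Y w t| + `|Y' w t|)%:E | t in `[0%R, T]%classic])%E.
Proof.
apply: (@le_trans _ _ (`|Y w 0| + `|Y' w 0|)%:E); first by rewrite lee_fin addr_ge0.
by apply: ereal_sup_ubound; exists 0 => //=; rewrite in_itv/= I0.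
Qed.

Let int0 w : (0 <= \int[lebesgue_measure]_(t in `[0%R, T]) (f w t)%:E)%E.
Proof. by apply: integral_ge0 => t _; rewrite lee_fin. Qed.

Lemma sup_data_ge0 w : (0 <= sup_data w)%E.
Proof. exact: adde_ge0. Qed.

Let adY t : 0 <= t <= T -> adapted_at P B t (Y^~ t).
Proof. by apply: progressive_adapted; exact: sol_Y_progressive hYZ. Qed.
Let adY' t : 0 <= t <= T -> adapted_at P B t (Y'^~ t).
Proof. by apply: progressive_adapted; exact: sol_Y_progressive hYZ'. Qed.
Let mY t : 0 <= t <= T -> measurable_fun setT (Y^~ t).
Proof. by move=> tT; have /andP[_ h] := tT; exact: (adapted_measurable Pcomplete hB h (adY tT)). Qed.
Let mY' t : 0 <= t <= T -> measurable_fun setT (Y'^~ t).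
Proof. by move=> tT; have /andP[_ h] := tT; exact: (adapted_measurable Pcomplete hB h (adY' tT)). Qed.

Lemma sup_data_measurable : measurable_fun setT sup_data.
Proof.
apply: emeasurable_funD; last exact: (progressive_integral_measurable Pcomplete hB T0 pf f0).
apply: (measurable_path_sup (P := P) (X := fun w t => `|Y w t| + `|Y' w t|)) => //.
  by move=> t tT; apply: measurable_funD; apply: measurableT_comp => //; [exact: mY|exact: mY'].
apply: filterS2 (sol_Y_continuous hYZ) (sol_Y_continuous hYZ') => w h h' t.
by apply: cvgD; apply: cvg_norm; [exact: h|exact: h'].
Qed.

Let q0 : 0 < q.
Proof. by rewrite /q divr_gt0// ?mulr_gt0// ?subr_gt0// (lt_trans ltr01). Qed.

Let S w := fine (sup_data w).
Let S0 w : 0 <= S w. Proof. by rewrite fine_ge0// sup_data_ge0. Qed.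
Let mS : measurable_fun setT S.
Proof. by apply: (measurableT_comp (f := fine)); [exact: fine_measurable|exact: sup_data_measurable]. Qed.

Let finS : {ae P, forall w, sup_data w \is a fin_num}.
Proof. by have [] := exp_moment_finite q0 sup_data_measurable sup_data_ge0 hexp. Qed.

Let L1S p : 0 < p -> rvL1 P (fun w => expR (p * S w `^ q)).
Proof. by have [_] := exp_moment_finite q0 sup_data_measurable sup_data_ge0 hexp; apply. Qed.

Let intf : {ae P, forall w, path_int `[0, T] (f w)}.
Proof.
apply: filterS finS => w; rewrite fin_numD => /andP[_ fi].
apply/integrableP; split.
  by apply/measurable_EFinP; exact: (progressive_path w T00 pf).
under eq_integral do rewrite gee0_abs ?lee_fin//.
by have := fi; rewrite ge0_fin_numE//; exact: int0.
Qed.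

Let dataS : {ae P, forall w, forall t, 0 <= t <= T ->
  `|Y w t| + `|Y' w t| <= S w /\ 0 <= td_F f w t <= S w}.
Proof.
apply: filterS finS => w fw t tT; split.
  rewrite -lee_fin fineK//; apply: (@le_trans _ _ (ereal_sup
    [set (`|Y w t| + `|Y' w t|)%:E | t in `[0%R, T]%classic])); last by rewrite leeDl.
  by apply: ereal_sup_ubound; exists t => //=; rewrite in_itv.
have /andP[t0 tT'] := tT.
rewrite Rintegral_ge0//=.
have h1 : (\int[lebesgue_measure]_(s in `[0%R, t]) (f w s)%:E <= sup_data w)%E.
  apply: (@le_trans _ _ (\int[lebesgue_measure]_(s in `[0%R, T]) (f w s)%:E)%E); last first.
    by rewrite leeDr.
  apply: ge0_subset_integral => //.
  - by apply/measurable_EFinP; exact: (progressive_path w T00 pf).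
  - by move=> s _; rewrite lee_fin.
  - by move=> s /=; rewrite !in_itv/= => /andP[-> /le_trans]; apply.
have h0 : (0 <= \int[lebesgue_measure]_(s in `[0%R, t]) (f w s)%:E)%E.
  by apply: integral_ge0 => s _; rewrite lee_fin.
apply: fine_le => //; rewrite ge0_fin_numE//.
by apply: le_lt_trans h1 _; rewrite -ge0_fin_numE// sup_data_ge0.
Qed.

Variables (G Gs Gx Gxx : R -> R -> R -> R).
Hypotheses (tfH : is_test_function alpha (2 * gamma) (2 * beta + 2 * gamma) G Gs Gx Gxx)
  (growth : exists2 A : R, 0 < A & forall c : R, 0 <= c -> exists2 p : R, 0 < p &
    forall s F x : R, 0 <= F -> F <= s -> `|x| <= c * s + 1 -> G T F x <= A * expR (p * s `^ q)).

(** Independence of r rests on the terminal majorant [Phi1], which is chosen before r. The majorant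
    [Phi2] does depend on r, but N is taken after it so that the event outside [Om] contributes at
    most 1; hence 6 = 5 + 1. *)
Lemma theta_tail : exists C : R, forall r t0 y : R, 1 <= r -> 0 <= t0 <= T ->
  G 0 0 (y - 1) *
  fine (P [set w | y <= td_U Y Y' (theta_fst b r) (theta_snd b r) w t0]) <= C.
Proof.
have [A A0 hA] := growth.
have [p1 p10 hp1] := hA 1 ler01.
pose Phi1 w := A * expR (p1 * S w `^ q).
have L1 : rvL1 P Phi1 by apply: rvL1Z; exact: L1S.
exists (6 + rvE P Phi1) => r t0 y r1 tT.
set a := theta_fst b r; set a' := theta_snd b r.
have a0 : 0 <= a by rewrite /a /theta_fst; case: b; rewrite ?subr_ge0// (le_trans _ r1).
have a'0 : 0 <= a' by rewrite /a' /theta_snd; case: b; rewrite ?subr_ge0// (le_trans _ r1).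
have c0 : 0 <= a + a' by exact: addr_ge0.
have [p2 p20 hp2] := hA _ c0.
pose Phi2 w := A * expR (p2 * S w `^ q).
have L2 : rvL1 P Phi2 by apply: rvL1Z; exact: L1S.
have P10 w : 0 <= Phi1 w by rewrite mulr_ge0 ?expR_ge0// ltW.
have P20 w : 0 <= Phi2 w by rewrite mulr_ge0 ?expR_ge0// ltW.
have [M hM eqY] := sol_equation hYZ.
have [M' hM' eqY'] := sol_equation hYZ'.
have sch := td_scheme_hyp Pcomplete hB T0 alpha1 alpha2 beta0 gamma0 hYZ hYZ' hM hM' eqY eqY'
  pf f0 intf (key r1).
rewrite -/a -/a' in sch.
pose U := td_U Y Y' a a'.
pose J := td_J alpha beta gamma Y Y' Z Z' f a a'.
pose F := td_F f.
set g0 := G 0 0 (y - 1).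
have g00 : 0 < g0 by exact: (tf_gt0 tfH).
have mJ : measurable_fun setT (J^~ T).
  by have [_ _ _ h] := sc_adapted sch IT; exact: (adapted_measurable Pcomplete hB (lexx T) h).
have mU : measurable_fun setT (U^~ t0).
  have [h _ _ _] := sc_adapted sch tT; have /andP[_ h'] := tT.
  exact: (adapted_measurable Pcomplete hB h' h).
have J0 w : 0 <= J w T.
  apply: Rintegral_ge0 => s _; rewrite /td_k addr_ge0// addr_ge0// mulr_ge0 ?powR_ge0//.
  exact: ltW.
(* J increases in time and |U| is at most (a + a') S, so one random variable keeps the whole path in
   the box. *)
pose X w := J w T + (a + a') * S w.
have mX : measurable_fun setT X by apply: measurable_funD => //; apply: measurable_funM.
have L2g : rvL1 P (fun w => Phi2 w + g0) by apply: rvL1D => //; exact: rvL1_cst.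
(* Adding [g0] makes the same N also control the part of the event [y <= U] that lies outside
   [Om]. *)
have [N N0 hN] := @rv_tail _ _ _ P (fun w => Phi2 w + g0) X 1 L2g
  (fun w => addr_ge0 (P20 w) (ltW g00)) mX ltr01.
pose Om := [set w | X w <= N].
have mOm : measurable Om by apply: measurable_set_le => //; exact: measurable_cst.
have Ubd : {ae P, forall w, forall t, 0 <= t <= T -> `|U w t| <= (a + a') * S w}.
  apply: filterS dataS => w h t /h[h1 _].
  apply: le_trans (ler_normB _ _) _; rewrite !normrM (ger0_norm a0) (ger0_norm a'0).
  have h2 : `|Y w t| <= S w by apply: le_trans h1; rewrite lerDl.
  have h3 : `|Y' w t| <= S w by apply: le_trans h1; rewrite lerDr.
  by rewrite mulrDl; apply: lerD; exact: ler_wpM2l.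
have hOm : {ae P, forall w, Om w -> forall t, 0 <= t <= T -> (J w t <= N) && (`|U w t| <= N)}.
  apply: filterS2 (sc_F sch) Ubd => w hF hU wO t tI; have /andP[t_0 t_T] := tI.
  have [_ h1 _ h2] := hF _ _ t_0 t_T (lexx _).
  have h3 : (a + a') * S w <= N by apply: le_trans wO; rewrite /X lerDr.
  have h4 : J w T <= N by apply: le_trans wO; rewrite /X lerDl mulr_ge0.
  rewrite (le_trans (hU _ tI) h3) andbT; apply: le_trans h4.
  by have := lerD h1 h2; rewrite !subrKC.
have hP1 : {ae P, forall w, G T (F w T) (U w T + 1) <= Phi1 w}.
  apply: (filterS _ (filterI (filterI dataS hxixi') (filterI eqY eqY'))) =>
    w [[hd hx] [e1 e2]].
  have [d1 /andP[F0 FS]] := hd _ IT.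
  have Yx : Y w T = xi w.
    by rewrite (e1 _ IT) subrr subr0 set_itv1 Rintegral_set1 addr0.
  have Yx' : Y' w T = xi' w.
    by rewrite (e2 _ IT) subrr subr0 set_itv1 Rintegral_set1 addr0.
  (* At T, U is xi - (r-1)(xi' - xi) in the convex case and -xi' - (r-1)(xi' - xi) in the concave
     one; the term with r is nonpositive. *)
  have US : U w T <= S w.
    apply: le_trans d1; rewrite /U /td_U Yx Yx' /a /a' /theta_fst /theta_snd.
    have h1 : 0 <= (r - 1) * (xi' w - xi w) by rewrite mulr_ge0// subr_ge0.
    have := ler_norm (xi w); have := ler_norm (- xi' w); rewrite normrN.
    have := normr_ge0 (xi w); have := normr_ge0 (xi' w).
    by move: h1; case: b => h1 n1 n2 n3 n4; lra.
  have h1 : G T (F w T) (U w T + 1) <= G T (F w T) (S w + 1).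
    by apply: (tf_le tfH) => //; rewrite lerD2r.
  apply: le_trans h1 _; apply: hp1 => //.
  by rewrite mul1r ger0_norm// addr_ge0.
have hP2 : {ae P, forall w, forall t, 0 <= t <= T -> G t (F w t) (U w t + 1) <= Phi2 w}.
  apply: filterS2 dataS Ubd => w hd hU t tI.
  have [_ /andP[F0 FS]] := hd _ tI; have /andP[_ t_T] := tI.
  apply: (@le_trans _ _ (G T (F w t) (U w t + 1))); first exact: (tf_le tfH).
  apply: hp2 => //; apply: le_trans (ler_normD _ _) _.
  by rewrite normr1 lerD2r; exact: hU.
have main := scheme_bound Pcomplete hB T0 beta0 gamma0 tfH y sch N0 tT mOm hOm L1 L2 P10 P20 hP1 hP2.
pose E := [set w | y <= U w t0].
have mE : measurable E by apply: measurable_set_le => //; exact: measurable_cst.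
have mI : measurable (~` Om) by exact: measurableC.
have Lc : rvL1 P (fun w => \1_(~` Om) w * g0).
  by have := rvL1Z g0 (rvL1_indic P mI); congr rvL1; apply/funext => w; rewrite mulrC.
have L2' : rvL1 P (fun w => \1_(~` Om) w * Phi2 w).
  apply: (@rvL1Mb _ _ _ _ _ _ 1) => //.
  by move=> w; rewrite indicE; case: (_ \in _); rewrite ?normr0 ?normr1.
have tail : rvE P (fun w => \1_(~` Om) w * Phi2 w) + g0 * fine (P (~` Om)) <= 1.
  have -> : g0 * fine (P (~` Om)) = rvE P (fun w => \1_(~` Om) w * g0).
    rewrite -(rvE_indic P mI) -(rvEZ g0 (rvL1_indic P mI)).
    by congr rvE; apply/funext => w; rewrite mulrC.
  rewrite -(rvED L2' Lc); apply: le_trans hN.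
  by rewrite le_eqVlt; apply/orP; left; apply/eqP; congr rvE; apply/funext => w; rewrite mulrDr.
have PE : fine (P E) <= fine (P (E `&` Om)) + fine (P (~` Om)).
  rewrite -fineD ?fin_num_measure//; last exact: measurableI.
  have mEO : measurable (E `&` Om) by exact: measurableI.
  apply: fine_le; rewrite ?fin_num_measure//.
    by rewrite fin_numD !fin_num_measure.
  have sub : E `<=` (E `&` Om) `|` ~` Om.
    by move=> w h; have [?|?] := pselect (Om w); [left|right].
  apply: le_trans (measureU2 P mEO mI); apply: le_measure => //; rewrite inE//.
  exact: measurableU.
have := ler_wpM2l (ltW g00) PE; rewrite mulrDr.
move: main tail; rewrite -/g0 -/E -/(U).
move: (rvE P Phi1) (rvE P _) (g0 * _) (g0 * _) (g0 * _) => *.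
by lra.
Qed.

End Comparison.

(** The combination equals r (x - x') plus x' or minus x, so it is large with r wherever x exceeds
    x'. *)
Lemma theta_comb_ge (R : realType) (b : bool) (r x x' z k : R) :
  `|z| + 1 + k <= r * (x - x') -> `|x| + `|x'| <= k ->
  z + 1 <= theta_fst b r * x - theta_snd b r * x'.
Proof.
have := ler_norm z; have := ler_norm x; have := ler_norm x'.
have := ler_norm (- x'); rewrite !normrN.
have := normr_ge0 x; have := normr_ge0 x'.
by rewrite /theta_fst /theta_snd; case: b => *; lra.
Qed.

Theorem theorem4p2 (R : realType) (dO : measure_display)
    (Omega : measurableType dO) (P : probability Omega R)
    (Pcomplete : measure_is_complete P)
    (T : R) (T0 : 0 < T) (d : nat) (d0 : (1 <= d)%N)
    (B : Omega -> R -> 'rV[R]_d) (hB : is_brownian_motion P T B)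
    (alpha beta gamma : R) (alpha1 : 1 < alpha) (alpha2 : alpha < 2)
    (beta0 : 0 <= beta) (gamma0 : 0 < gamma)
    (xi xi' : Omega -> R) (g g' : Omega -> R -> R -> 'rV[R]_d -> R)
    (Y Y' : Omega -> R -> R) (Z Z' : Omega -> R -> 'rV[R]_d)
    (hxi : is_terminal_condition P T B xi)
    (hxi' : is_terminal_condition P T B xi')
    (hg : is_generator P T B g) (hg' : is_generator P T B g')
    (hYZ : bsde_solution P T B xi g Y Z)
    (hYZ' : bsde_solution P T B xi' g' Y' Z')
    (hexp : let alphastar := alpha / (alpha - 1) in
      forall p : R, 0 < p ->
      (\int[P]_w expeR (p%:E *
         poweR (ereal_sup [set (`|Y w t| + `|Y' w t|)%:E | t in `[0%R, T]%classic]
                + \int[lebesgue_measure]_(t in `[0%R, T])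
                    (`|g w t 0%R 0%R| + `|g' w t 0%R 0%R|)%:E)
               (2 / alphastar)) < +oo)%E)
    (hxixi' : {ae P, forall w, xi w <= xi' w})
    (hcases :
      [/\ growth_bound P T alpha beta gamma g,
          ae_convex_or_concave P T g
        & ae_dPdt P T (fun w t =>
            g w t (Y' w t) (Z' w t) <= g' w t (Y' w t) (Z' w t))]
      \/
      [/\ growth_bound P T alpha beta gamma g',
          ae_convex_or_concave P T g'
        & ae_dPdt P T (fun w t =>
            g w t (Y w t) (Z w t) <= g' w t (Y w t) (Z w t))]) :
  {ae P, forall w, forall t, 0 <= t <= T -> Y w t <= Y' w t}.
Proof.
have [b key] := theta_key hcases.
have gam20 : 0 < 2 * gamma by rewrite mulr_gt0.
have c00 : 0 <= 2 * beta + 2 * gamma by rewrite addr_ge0// mulr_ge0// ltW.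
have [G [Gs [Gx [Gxx [tfH coer growth]]]]] := exists_test_function alpha1 alpha2 gam20 c00.
have qE : 2 / (alpha / (alpha - 1)) = 2 * (alpha - 1) / alpha.
  by rewrite invf_div mulrA.
have hexp' p : 0 < p -> (\int[P]_w expeR (p%:E *
    poweR (sup_data T g g' Y Y' w) (2 * (alpha - 1) / alpha)) < +oo)%E.
  by move=> p0; have := hexp p p0; rewrite /= qE.
have [C hC] := theta_tail Pcomplete hB T0 alpha1 alpha2 beta0 gamma0 hg hg' hYZ hYZ'
  hexp' hxixi' key tfH (growth T).
have mY t : 0 <= t <= T -> measurable_fun setT (Y^~ t).
  move=> tT; have /andP[_ h] := tT; apply: (adapted_measurable Pcomplete hB h).
  by apply: progressive_adapted tT; exact: sol_Y_progressive hYZ.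
have mY' t : 0 <= t <= T -> measurable_fun setT (Y'^~ t).
  move=> tT; have /andP[_ h] := tT; apply: (adapted_measurable Pcomplete hB h).
  by apply: progressive_adapted tT; exact: sol_Y_progressive hYZ'.
have fixed t : 0 <= t <= T -> {ae P, forall w, Y w t <= Y' w t}.
  move=> tT.
  pose D (k : nat) := [set w | k.+1%:R^-1 <= Y w t - Y' w t] `&`
    [set w | `|Y w t| + `|Y' w t| <= k%:R].
  have mD k : measurable (D k).
    apply: measurableI; apply: measurable_set_le; [exact: measurable_cst| | |exact: measurable_cst].
      by apply: measurable_funB; [exact: mY|exact: mY'].
    by apply: measurable_funD; apply: measurableT_comp => //; [exact: mY|exact: mY'].
  have PD k : P (D k) = 0%E.
    rewrite -(fineK (fin_num_measure P _ (mD k))); congr EFin.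
    apply/eqP; rewrite eq_le fine_ge0// andbT leNgt; apply/negP => p0.
    set p := fine (P (D k)) in p0.
    (* For this z the product G(0, 0, z) p is at least |C| + 1, against the bound C that is uniform
       in r. *)
    have [z hz] := coer ((`|C| + 1) / p).
    (* On [D k] the difference is at least 1/(k+1), so this r lifts the combination to z + 1 despite
       the loss of at most k. *)
    pose r := 1 + (`|z| + 1 + k%:R) * k.+1%:R.
    have r1 : 1 <= r by rewrite lerDl mulr_ge0// !addr_ge0.
    have := hC r t (z + 1) r1 tT; rewrite addrK; set E := [set w | _] => hE.
    have DE : D k `<=` E.
      move=> w [/= h1 h2]; rewrite /E/= /td_U.
      have h3 : `|z| + 1 + k%:R <= r * (Y w t - Y' w t).
        apply: le_trans (ler_wpM2l _ h1); last exact: le_trans r1.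
        rewrite ler_pdivlMr// /r lerDr; exact: ler01.
      exact: theta_comb_ge h3 h2.
    have mE : measurable E.
      apply: measurable_set_le; first exact: measurable_cst.
      by apply: measurable_funB; apply: measurable_funM => //; [exact: mY|exact: mY'].
    have pE : p <= fine (P E).
      by apply: fine_le; rewrite ?fin_num_measure//; apply: le_measure; rewrite ?inE.
    have Gz : 0 < G 0 0 z by exact: (tf_gt0 tfH).
    have h1 := ler_wpM2l (ltW Gz) pE.
    move: hz; rewrite ler_pdivrMr// => h2.
    by have := ler_norm C; lra.
  have neg : P.-negligible (\bigcup_k D k).
    by apply: negligible_bigcup => k; exists (D k); split => //; exact: PD.
  apply: negligibleS neg => w /= /negP; rewrite -ltNge => hw.
  have e0 : 0 < Y w t - Y' w t by rewrite subr_gt0.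
  pose n1 := Num.bound (Y w t - Y' w t)^-1; pose n2 := Num.bound (`|Y w t| + `|Y' w t|).
  exists (n1 + n2)%N => //; split => /=.
    rewrite invf_ple ?posrE//.
    have h : (Y w t - Y' w t)^-1 < n1%:R by apply: archi_boundP; rewrite invr_ge0 ltW.
    by apply: le_trans (ltW h) _; rewrite ler_nat (leq_trans (leq_addr n2 n1)).
  have h : `|Y w t| + `|Y' w t| < n2%:R by apply: archi_boundP; rewrite addr_ge0.
  by apply: le_trans (ltW h) _; rewrite ler_nat leq_addl.
(* The null set for a fixed time depends on that time; countably many times give a common one, and
   continuity of the paths extends the inequality to all times. *)
have dense := ae_foralln (fun n => fixed _ (dense_time_itv T0 n)).
apply: (filterS _ (filterI dense (filterI (sol_Y_continuous hYZ) (sol_Y_continuous hYZ')))).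
move=> w [hn [cY cY']] t tT; rewrite leNgt; apply/negP => lt.
have e0 : 0 < (Y w t - Y' w t) / 2 by rewrite divr_gt0// subr_gt0.
have [d1 d10 h1] := within_unif_continuous cY e0.
have [d2 d20 h2] := within_unif_continuous cY' e0.
have d120 : 0 < Num.min d1 d2 by rewrite lt_min d10.
have [n tn] := dense_time_dense T0 tT d120.
have nT := dense_time_itv T0 n.
have := h1 _ _ tT nT; have := h2 _ _ tT nT.
move: tn; rewrite lt_min => /andP[-> ->] /(_ isT) + /(_ isT).
rewrite !ltr_norml => /andP[q1 _] /andP[_ q2].
by have := hn n; lra.
Qed.
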